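(* Let $f\in L^\infty([0,1]\times\mathbb{R}\times\mathbb{R})$ be real-valued and satisfy, for a constant $K>0$, $$|f(x,t,v_1)-f(x,t,v_2)|\le K|v_1-v_2|,\qquad 0\le x\le 1,\ t\in\mathbb{R},\ v_1,v_2\in\mathbb{R}.$$ Let $p>0$, $\gamma>0$, $\delta>0$, and let $g,h,g^\delta,h^\delta\in L^2(\mathbb{R})$ satisfy $\|g^\delta-g\|_{L^2(\mathbb{R})}+\|h^\delta-h\|_{L^2(\mathbb{R})}\le\delta$. Assume that the exact problem with data $(g,h)$ has a unique (exact) solution $u$ and that, for some $M_3>0$, $$\int_{-\infty}^{+\infty}\exp\big(2(1+\gamma-x)\Re(k(\omega))\big)\,|\widehat u(x,\omega)|^2\,d\omega<M_3^2,\qquad 0\le x<1 .$$ Let the regularization parameter $\epsilon>0$ satisfy $$\epsilon<\left[\frac{\alpha\gamma\cos\frac{\alpha\pi}{4}}{2p}\right]^{\frac2\alpha},$$ and let $u_\epsilon^\delta$ be the regularized solution with parameter $\epsilon$ and data $(g^\delta,h^\delta)$. Then, with $C_3=\max\{5e^{K^2},\,3M_3(e^{K^2}+1)\}$, for all $0\le x<1$, $$\|u_\epsilon^\delta(x,\cdot)-u(x,\cdot)\|_{H^p(\mathbb{R})}\le C_3(1+\epsilon^{-2})^p\exp\Big(x\,\epsilon^{-\frac\alpha2}\cos\tfrac{\alpha\pi}{4}\Big)\delta+C_3(1+\epsilon^{-2})^p\exp\Big((x-\gamma-1)\,\epsilon^{-\frac\alpha2}\cos\tfrac{\alpha\pi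}{4}\Big).$$
   Context: Fix $0<\alpha<1$. $L^2(\mathbb{R})$ consists of real-valued functions of $t\in\mathbb{R}$. The Fourier transform in $t$ is $\widehat v(\omega)=\frac{1}{\sqrt{2\pi}}\int_{-\infty}^{\infty}v(t)e^{-i\omega t}\,dt$, and $\|v\|_{H^p(\mathbb{R})}=\left(\int_{\mathbb{R}}(1+\omega^2)^p|\widehat v(\omega)|^2\,d\omega\right)^{1/2}$. Put $$k(\omega)=(i\omega)^{\alpha/2}=|\omega|^{\alpha/2}\Big(\cos\tfrac{\alpha\pi}{4}+i\,\mathrm{sign}(\omega)\sin\tfrac{\alpha\pi}{4}\Big),\qquad \Re(k(\omega))=|\omega|^{\alpha/2}\cos\tfrac{\alpha\pi}{4},$$ and interpret $\sinh(k(\omega)y)/k(\omega)$ as $y$ at $\omega=0$. For a function $w$ on $[0,1]\times\mathbb{R}$, $\widehat w(x,\omega)$ denotes the Fourier transform of $w(x,\cdot)$, and $\widehat f(z,\omega,w(z,\omega))$ denotes the Fourier transform with respect to $t$ of $t\mapsto f(z,t,w(z,t))$. Standing assumption: $(z,t)\mapsto f(z,t,w(z,t))$ belongs to $L^2((0,1)\times\mathbb{R})$ for every $w\in C([0,1];L^2(\mathbb{R}))$, so that these Fourier transforms are those of $L^2$ functions. Exact problem with data $(g,h)$: find $u\in C([0,1];L^2(\mathbb{R}))$ such that for $0\le x\le1$ and a.e. $\omega\in\mathbb{R}$ $$\widehat u(x,\omega)=\cosh(k(\omega)x)\,\widehat g(\omega)+\frac{\sinh(k(\omega)x)}{k(\omega)}\,\widehat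 h(\omega)-\int_0^x\frac{\sinh(k(\omega)(x-z))}{k(\omega)}\,\widehat f(z,\omega,u(z,\omega))\,dz .$$ (This is the integral form of the problem $D_t^\alpha u-u_{xx}=f(x,t,u)$, $u(x,0)=0$, $u(0,t)=g(t)$, $u_x(0,t)=h(t)$, with $D_t^\alpha$ the Caputo derivative.) Regularized solution with parameter $\epsilon>0$ and data $(g^\delta,h^\delta)$: the unique $u_\epsilon^\delta\in C([0,1];L^2(\mathbb{R}))$ such that $w=u_\epsilon^\delta$ satisfies, for $0\le x\le1$ and a.e. $\omega\in\mathbb{R}$, $$\widehat w(x,\omega)=\chi_{[-1/\epsilon,1/\epsilon]}(\omega)\left[\cosh(k(\omega)x)\,\widehat{g^\delta}(\omega)+\frac{\sinh(k(\omega)x)}{k(\omega)}\,\widehat{h^\delta}(\omega)-\int_0^x\frac{\sinh(k(\omega)(x-z))}{k(\omega)}\,\widehat f(z,\omega,w(z,\omega))\,dz\right],$$ where $\chi_I$ is the indicator function of $I$. *)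

(* Defs.v *)
(* Functions on R and on R * R are measurable in the sense of the library, that
   is, Borel measurable; every class of square-integrable functions has such a
   representative. *)
From HB Require Import structures.
From mathcomp Require Import all_boot all_order all_algebra.
From mathcomp Require Import all_classical all_reals all_analysis.
From mathcomp Require Import complex.

Set Implicit Arguments.
Unset Strict Implicit.
Unset Printing Implicit Defensive.

Import Order.TTheory GRing.Theory Num.Theory.
Import numFieldNormedType.Exports.

Local Open Scope classical_set_scope.
Local Open Scope ring_scope.
Local Open Scope complex_scope.

Section complex_functions.
Context {R : realType}.
Implicit Types (z : R[i]).

Local Notation mu := (@lebesgue_measure R).

Definition cexp z : R[i] :=
  (expR (complex.Re z) * cos (complex.Im z))
    +i* (expR (complex.Re z) * sin (complex.Im z)).

Definition ccosh z : R[i] := (cexp z + cexp (- z)) / 2%:R.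

Definition csinh z : R[i] := (cexp z - cexp (- z)) / 2%:R.

Definition cintegral (D : set R) (F : R -> R[i]) : R[i] :=
  (\int[mu]_(t in D) complex.Re (F t)) +i* (\int[mu]_(t in D) complex.Im (F t)).

End complex_functions.

Section L2.
Context {R : realType}.
Implicit Types (v : R -> R) (V : R -> R[i]) (w F : R -> R -> R).

Local Notation mu := (@lebesgue_measure R).

Definition L2norm v : \bar R := 'N[mu]_(2%:E)[EFin \o v]%E.

Definition in_L2 v : Prop := v \in Lfun mu 2%:E.

Definition in_cL2 V : Prop :=
  in_L2 (fun t => complex.Re (V t)) /\ in_L2 (fun t => complex.Im (V t)).

Definition in_L2_strip F : Prop :=
  (fun q : R * R => F q.1 q.2) \_ ((`]0, 1[ : set R) `*` [set: R])
    \in Lfun (mu \x mu)%E 2%:E.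

Definition in_Linfty (f : R -> R -> R -> R) : Prop :=
  (fun q : R * R * R => f q.1.1 q.1.2 q.2)
    \_ (((`[0, 1] : set R) `*` [set: R]) `*` [set: R])
    \in Lfun ((mu \x mu) \x mu)%E +oo%E.

(* C([0,1]; L^2(R)), with x |-> w x given by a jointly measurable
   representative; every element has one. For an arbitrary choice of
   representative of each class w x, a composite (z, t) |-> f z t (w z t) need
   not be measurable. *)
Definition in_CL2 w : Prop :=
  [/\ measurable_fun ((`[0, 1] : set R) `*` [set: R]) (fun q : R * R => w q.1 q.2),
      (forall x : R, 0 <= x <= 1 -> in_L2 (w x)) &
      (forall x : R, 0 <= x <= 1 ->
         L2norm (w y \- w x) @[y --> within `[0, 1] (nbhs x)] --> 0%E)].

End L2.

Section fourier.
Context {R : realType}.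
Implicit Types (v : R -> R) (V : R -> R[i]) (F : R -> R -> R)
  (G : R -> R -> R[i]).

Local Notation mu := (@lebesgue_measure R).

Definition fourier_trunc v (n : nat) (w : R) : R[i] :=
  ((Num.sqrt (2 * pi))^-1)%:C *
  cintegral `[- n%:R, n%:R] (fun t => (v t)%:C * cexp (0 -i* (w * t))).

(* On L^2(R) the integral over R is the limit in L^2 of the integrals over
   [-n, n]; this determines the transform up to a null set. *)
Definition is_fourier v V : Prop :=
  in_cL2 V /\
  (\int[mu]_w ((Normc.normc (V w - fourier_trunc v n w)) ^+ 2)%:E)%E
    @[n --> \oo] --> 0%E.

Definition fourier v : R -> R[i] :=
  xget (fun=> 0) [set V | is_fourier v V].

(* G is a jointly measurable version on (0,1) x R of the Fourier transform in
   the second variable. Joint measurability is required because each fourier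
   (F z) is determined only up to a null set; it determines G up to a null set
   of (0,1) x R. *)
Definition is_fourier_snd F G : Prop :=
  [/\ measurable_fun ((`]0, 1[ : set R) `*` [set: R])
        (fun q : R * R => complex.Re (G q.1 q.2)),
      measurable_fun ((`]0, 1[ : set R) `*` [set: R])
        (fun q : R * R => complex.Im (G q.1 q.2)) &
      {ae mu, forall z, 0 < z < 1 ->
        {ae mu, forall w, G z w = fourier (F z) w}}].

Definition Hnorm (p : R) v : \bar R :=
  ((\int[mu]_w ((1 + w ^+ 2) `^ p * (Normc.normc (fourier v w)) ^+ 2)%:E)
    `^ 2^-1)%E.

End fourier.

Section problem.
Context {R : realType}.
Implicit Types (alpha eps x z w : R) (f : R -> R -> R -> R) (g h : R -> R)
  (u : R -> R -> R) (G : R -> R -> R[i]).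

Local Notation mu := (@lebesgue_measure R).

(* (i w)^(alpha / 2), principal branch *)
Definition kroot alpha w : R[i] :=
  (`|w| `^ (alpha / 2))%:C *
  (cos (alpha * pi / 4) +i* (Num.sg w * sin (alpha * pi / 4))).

Definition sinhk alpha w x : R[i] :=
  if w == 0 then x%:C else csinh (kroot alpha w * x%:C) / kroot alpha w.

(* G stands for the Fourier transform in t of (z, t) |-> f z t (u z t). *)
Definition mild_rhs alpha g h G x w : R[i] :=
  ccosh (kroot alpha w * x%:C) * fourier g w + sinhk alpha w x * fourier h w
  - cintegral `[0, x] (fun z => sinhk alpha w (x - z) * G z w).

Definition is_exact_solution alpha f g h u : Prop :=
  in_CL2 u /\
  exists2 G, is_fourier_snd (fun z t => f z t (u z t)) G &
    forall x : R, 0 <= x <= 1 ->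
      {ae mu, forall w, fourier (u x) w = mild_rhs alpha g h G x w}.

Definition is_unique_exact_solution alpha f g h u : Prop :=
  is_exact_solution alpha f g h u /\
  forall u', is_exact_solution alpha f g h u' ->
    forall x : R, 0 <= x <= 1 -> {ae mu, forall t, u' x t = u x t}.

(* Uniqueness is not part of the predicate: it is a consequence when f is
   Lipschitz in its last argument. *)
Definition is_regularized_solution alpha f eps g h u : Prop :=
  in_CL2 u /\
  exists2 G, is_fourier_snd (fun z t => f z t (u z t)) G &
    forall x : R, 0 <= x <= 1 ->
      {ae mu, forall w, fourier (u x) w =
        (\1_(`[- eps^-1, eps^-1] : set R) w)%:C * mild_rhs alpha g h G x w}.

End problem.

(* Main.v *)
(**
Plancherel's theorem on the line is an Abel summation: for u supported in
[-A, A], the integral of exp(-e |w|) |u^(w)|^2 is the quadratic form of the Poisson kernel at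
u; letting e tend to 0 gives the Plancherel inequality, with equality when u is
continuous on ]-A, A[, and density of these functions gives equality for all u.
Riesz-Fischer then yields the transform of an arbitrary L^2 function.

Write kappa = eps^(-alpha/2) cos(alpha pi/4) and phi(x) for the squared L^2 norm
of the error at x. For |w| <= 1/eps the kernels cosh(k x) and sinh(k x)/k are
bounded by exp(kappa x), while for |w| > 1/eps the regularized solution vanishes
and the a priori bound controls u. With Cauchy-Schwarz in z, Plancherel in t and
the Lipschitz condition, phi(x) exp(-2 kappa x) is at most
A + (3/2) K^2 times the integral over [0, x] of phi(z) exp(-2 kappa z), where
A = 6 delta^2 + M3^2 exp(-2 (1 + gamma) kappa). Taking the supremum of
phi(x) exp(-2 kappa x - 2 K^2 x) yields phi(x) <= 4 A exp(2 kappa x + 2 K^2 x).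
The factor (1 + w^2)^p is at most (1 + eps^-2)^p on the low frequencies; on the
high ones the smallness of eps makes (1 + w^2)^p exp(-2 (1 + gamma - x) Re k(w))
no larger than its value at |w| = 1/eps.
*)
Require Import Defs.
From mathcomp Require Import all_boot all_order all_algebra.
From mathcomp Require Import all_classical all_reals all_analysis.
From mathcomp Require Import measurable_realfun complex ring lra.

Import Order.TTheory GRing.Theory Num.Theory.
Import numFieldNormedType.Exports.

Local Open Scope classical_set_scope.
Local Open Scope ring_scope.

(** * Abel summation of the cosine integral *)

(** The transform is a choice among representatives, so identities between transforms hold only up
    to null sets; additivity and Plancherel are proved for the truncated integrals and passed to the
    limit. Functions on the strip are extended by zero so that Tonelli's theorem applies on the
    whole plane. The constants come from |a - b|^2 <= (1 + theta) |a|^2 + (1 + 1/theta) |b|^2 with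
    theta = 2: the two data terms get 3 * 2 = 6 and the Duhamel term 3/2. The extra weight exp(-2
    K^2 x) turns (3/2) K^2 into (3/2) K^2 / (2 K^2) = 3/4 < 1, whence the factor 4 = 1 / (1 - 3/4).
    Finally 4 * 6 = 24 <= 5^2, and 4 M3^2 exp(2 K^2) + M3^2 <= 9 M3^2 (exp(K^2) + 1)^2: these
    squares are the two entries of the maximum C3. The supremum argument rests on the boundedness of
    phi, which the energy inequality itself provides because the sources are square integrable on
    the strip. *)

Section abel_kernel.
Context {R : realType}.
Implicit Types e s t w A : R.
Local Notation mu := (@lebesgue_measure R).

(** Times the exponential, the trigonometric quotient is the real part of -exp(-(e - i s) w) / (e -
    i s); the term [- e^-1] accounts for the added 1. *)
Lemma abel_primitive_derivative e s w : 0 < e ->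
  is_derive w 1 (fun w => expR (- (e * w)) *
      (- e^-1 + (- e * cos (w * s) + s * sin (w * s)) / (e ^+ 2 + s ^+ 2)))
    (expR (- (e * w)) * (1 + cos (w * s))).
Proof.
move=> e0.
apply: is_derive_eq.
rewrite /GRing.scale/=.
field.
by rewrite (gt_eqF e0) gt_eqF// ltr_pwDl ?exprn_gt0 ?sqr_ge0.
Qed.

Lemma norm_sin_cos_le e s w :
  `|- e * cos (w * s) + s * sin (w * s)| <= `|e| + `|s|.
Proof.
rewrite (le_trans (ler_normD _ _))// lerD// normrM ?normrN ler_piMr//.
- by rewrite ler_norml cos_geN1 cos_le1.
- by rewrite ler_norml sin_geN1 sin_le1.
Qed.

Lemma cvgr_expRN e : 0 < e -> expR (- (e * w)) @[w --> +oo] --> (0 : R).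
Proof.
move=> e0.
apply: (cvg_comp (fun w => e * w) (fun w => expR (- w)) _ (@cvgr_expR R)).
exact: gt0_cvgMry.
Qed.

Lemma abel_primitive_cvg e s : 0 < e ->
  expR (- (e * w)) *
      (- e^-1 + (- e * cos (w * s) + s * sin (w * s)) / (e ^+ 2 + s ^+ 2))
  @[w --> +oo] --> (0 : R).
Proof.
move=> e0.
pose M := e^-1 + (`|e| + `|s|) / (e ^+ 2 + s ^+ 2).
have d0 : 0 < e ^+ 2 + s ^+ 2 by rewrite ltr_pwDl ?exprn_gt0 ?sqr_ge0.
have cvgM : expR (- (e * w)) * M @[w --> +oo] --> (0 : R).
  by rewrite -(mul0r M); apply: cvgMl; exact: cvgr_expRN.
apply: (@squeeze_cvgr _ _ _ _ (fun w => - (expR (- (e * w)) * M))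
  (fun w => expR (- (e * w)) * M)) => //; last first.
  by rewrite -oppr0; exact: cvgN.
near=> w.
rewrite -ler_norml normrM (ger0_norm (expR_ge0 _)) ler_pM2l ?expR_gt0//.
rewrite (le_trans (ler_normD _ _))// lerD//.
  by rewrite normrN ger0_norm// invr_ge0 ltW.
rewrite normrM (@ger0_norm _ (_^-1)) ?invr_ge0 ?(ltW d0)// ler_pM2r ?invr_gt0//.
exact: norm_sin_cos_le.
Unshelve. all: by end_near. Qed.

Lemma abel_cos_continuous e s :
  continuous (fun w => expR (- (e * `|w|)) * (1 + cos (w * s))).
Proof.
move=> w; apply: cvgM.
  apply: (cvg_comp _ expR); last exact: continuous_expR.
  by apply: cvgN; apply: cvgMr; exact: norm_continuous.
apply: cvgD; first exact: cvg_cst.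
by apply: (cvg_comp _ cos); [apply: cvgMl; exact: cvg_id|exact: continuous_cos].
Qed.

(* Adding 1 to the cosine makes the integrand nonnegative. *)
Lemma integral_abel_1cos e s : 0 < e ->
  (\int[mu]_w (expR (- (e * `|w|)) * (1 + cos (w * s)))%:E =
   (2 / e + 2 * e / (e ^+ 2 + s ^+ 2))%:E)%E.
Proof.
move=> e0.
have d0 : e ^+ 2 + s ^+ 2 != 0.
  by rewrite gt_eqF// ltr_pwDl ?exprn_gt0 ?sqr_ge0.
rewrite ge0_symfun_integralT; last 3 first.
- move=> w; rewrite mulr_ge0 ?expR_ge0// -lerBlDl sub0r; exact: cos_geN1.
- exact: abel_cos_continuous.
- by move=> w; rewrite /= normrN mulNr cosN.
rewrite -set_itvcy.
under eq_integral => w /[!inE]/= /itvP w0 do rewrite ger0_norm ?w0//.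
rewrite (@ge0_continuous_FTC2y _ _ (fun w => expR (- (e * w)) *
      (- e^-1 + (- e * cos (w * s) + s * sin (w * s)) / (e ^+ 2 + s ^+ 2))) 0 0).
- rewrite !mul0r mulr0 oppr0 expR0 cos0 sin0 -EFinB -EFinM; congr EFin.
  by field; rewrite d0 gt_eqF.
- by move=> w _; rewrite mulr_ge0 ?expR_ge0// -lerBlDl sub0r; exact: cos_geN1.
- apply: continuous_subspaceT => w.
  apply: differentiable_continuous; apply/derivable1_diffP.
  exact: ex_derive.
- exact: abel_primitive_cvg.
- by move=> w _; case: (@abel_primitive_derivative e s w e0).
- apply: cvg_at_right_filter.
  case: (@abel_primitive_derivative e s 0 e0) => dF _.
  by have /derivable1_diffP/differentiable_continuous := dF.
- move=> w _; rewrite derive1E.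
  by case: (@abel_primitive_derivative e s w e0).
Qed.

(** At [s = 0] the integrand of [integral_abel_1cos] is twice the exponential, which is thereby
    dominated by a function of finite integral. *)
Lemma integrable_abel e : 0 < e ->
  mu.-integrable setT (fun w => (expR (- (e * `|w|)))%:E).
Proof.
move=> e0.
have mq : measurable_fun setT (fun w => expR (- (e * `|w|))).
  by apply: continuous_measurable_fun => w; apply: (cvg_comp _ expR);
    [apply: cvgN; apply: cvgMr; exact: norm_continuous|exact: continuous_expR].
apply/integrableP; split; first exact/measurable_EFinP.
have := @integral_abel_1cos e 0 e0.
under eq_integral do rewrite mulr0 cos0.
move=> I.
apply: (@le_lt_trans _ _ ((2 / e + 2 * e / (e ^+ 2 + 0 ^+ 2))%:E)); last exact: ltry.
rewrite -I; apply: ge0_le_integral => //.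
- by apply: measurableT_comp => //; exact/measurable_EFinP.
- by apply/measurable_EFinP; apply: measurable_funM.
- by move=> w _; rewrite lee_fin ger0_norm ?expR_ge0// ler_peMr ?expR_ge0// lerDl.
Qed.

Lemma integrable_abel_cos e s : 0 < e ->
  mu.-integrable setT (fun w => (expR (- (e * `|w|)) * cos (w * s))%:E).
Proof.
move=> e0; apply: le_integrable (integrable_abel e e0) => //.
  apply/measurable_EFinP; apply: continuous_measurable_fun => w.
  apply: cvgM; first by apply: (cvg_comp _ expR);
    [apply: cvgN; apply: cvgMr; exact: norm_continuous|exact: continuous_expR].
  by apply: (cvg_comp _ cos); [apply: cvgMl; exact: cvg_id|exact: continuous_cos].
move=> w _ /=; rewrite lee_fin normrM ler_piMr//.
by rewrite ler_norml cos_geN1 cos_le1.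
Qed.

Lemma Rintegral_abel_cos e s : 0 < e ->
  \int[mu]_w (expR (- (e * `|w|)) * cos (w * s)) = 2 * e / (e ^+ 2 + s ^+ 2).
Proof.
move=> e0.
have H r : \int[mu]_w (expR (- (e * `|w|)) * (1 + cos (w * r))) =
    2 / e + 2 * e / (e ^+ 2 + r ^+ 2).
  by rewrite /Rintegral integral_abel_1cos.
have D r : \int[mu]_w (expR (- (e * `|w|)) * (1 + cos (w * r))) =
    \int[mu]_w expR (- (e * `|w|)) + \int[mu]_w (expR (- (e * `|w|)) * cos (w * r)).
  under eq_Rintegral do rewrite mulrDr mulr1.
  by rewrite RintegralD//; [exact: integrable_abel|exact: integrable_abel_cos].
(* At [s = 0] the exponential is counted twice, which determines its integral; subtracting that
   value at a general [s] leaves the cosine integral. *)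
have Q : \int[mu]_w expR (- (e * `|w|)) = 2 / e.
  have := D 0; rewrite H.
  under [X in _ = _ + X]eq_Rintegral do rewrite mulr0 cos0 mulr1.
  rewrite expr0n/= addr0.
  have -> : 2 * e / e ^+ 2 = 2 / e by field; rewrite gt_eqF.
  lra.
by have := D s; rewrite H Q => /addrI.
Qed.

Lemma Rintegral_poisson e t A : 0 < e -> 0 < A ->
  \int[mu]_(s in `[- A, A]) (2 * e / (e ^+ 2 + (t - s) ^+ 2)) =
  2 * (atan ((A - t) / e) + atan ((A + t) / e)).
Proof.
move=> e0 A0.
have dF s : is_derive s 1 (fun s => 2 * atan ((s - t) / e))
     (2 * e / (e ^+ 2 + (t - s) ^+ 2)).
  have d0 : e ^+ 2 + (t - s) ^+ 2 != 0.
    by rewrite gt_eqF// ltr_pwDl ?exprn_gt0 ?sqr_ge0.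
  apply: is_derive_eq; rewrite /GRing.scale/=.
  by field; rewrite d0 gt_eqF.
rewrite /Rintegral (@continuous_FTC2 _ _ (fun s => 2 * atan ((s - t) / e)))//.
- rewrite -EFinB /= -mulrBr; congr (_ * _).
  by rewrite -opprD mulNr atanN opprK.
- by rewrite gtrN.
- apply: continuous_subspaceT => s; apply: cvgMr; apply: cvgV.
    by rewrite gt_eqF// ltr_pwDl ?exprn_gt0 ?sqr_ge0.
  apply: cvgD; first exact: cvg_cst.
  by apply: cvgM; apply: cvgB; [exact: cvg_cst|exact: cvg_id|
    exact: cvg_cst|exact: cvg_id].
- split.
  + by move=> s _; case: (dF s).
  + apply: cvg_at_right_filter; case: (dF (- A)) => + _.
    by move=> /derivable1_diffP/differentiable_continuous.
  + apply: cvg_at_left_filter; case: (dF A) => + _.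
    by move=> /derivable1_diffP/differentiable_continuous.
- by move=> s _; rewrite derive1E; case: (dF s).
Qed.

End abel_kernel.

(** * Fubini's theorem for a bounded kernel between two integrable functions *)

Section kernel_fubini.
Context {R : realType}.
Implicit Types (a b : R -> R) (K : R -> R -> R) (M : R).
Local Notation mu := (@lebesgue_measure R).

Lemma integrable_mulrl D k b : measurable D -> mu.-integrable D (EFin \o b) ->
  mu.-integrable D (EFin \o (fun x => k * b x)).
Proof. by move=> mD ib; apply: eq_integrable (integrableZl mD k ib). Qed.

Lemma integrable_mulrr D k b : measurable D -> mu.-integrable D (EFin \o b) ->
  mu.-integrable D (EFin \o (fun x => b x * k)).
Proof. by move=> mD ib; apply: eq_integrable (integrableZr mD k ib). Qed.

Lemma integrable_addr D a b : measurable D ->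
  mu.-integrable D (EFin \o a) -> mu.-integrable D (EFin \o b) ->
  mu.-integrable D (EFin \o (fun x => a x + b x)).
Proof.
move=> mD ia ib; have := integrableD mD ia ib.
by apply: eq_integrable => // x _ /=; rewrite EFinD.
Qed.

Lemma measurable_tonelli (f : R * R -> \bar R) :
  measurable_fun setT f -> (forall z, 0 <= f z)%E ->
  measurable_fun setT (fun x => \int[mu]_y f (x, y))%E.
Proof. by move=> mf f0; exact: (measurable_fun_fubini_tonelli_F (m2 := mu) f mf f0). Qed.

Lemma integrable_kernel_section b K M x :
  mu.-integrable setT (EFin \o b) ->
  measurable_fun setT (fun z : R * R => K z.1 z.2) ->
  (forall x y, `|K x y| <= M) ->
  mu.-integrable setT (fun y => (b y * K x y)%:E).
Proof.
move=> ib mK KM.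
have mb : measurable_fun setT b by apply/measurable_EFinP; case/integrableP: ib.
have mKx : measurable_fun setT (K x).
  exact: (measurableT_comp mK (measurable_pair1 x)).
have iMb : mu.-integrable setT (fun y => (M * b y)%:E).
  by under eq_fun do rewrite EFinM; exact: integrableZl.
apply: le_integrable iMb => //.
- by apply/measurable_EFinP; exact: measurable_funM.
- move=> y _; rewrite !abse_EFin lee_fin !normrM mulrC ler_wpM2r//.
  by rewrite (le_trans (KM x y))// ler_norm.
Qed.

Lemma integrable_kernel_prod a b K M :
  mu.-integrable setT (EFin \o a) -> mu.-integrable setT (EFin \o b) ->
  measurable_fun setT (fun z : R * R => K z.1 z.2) ->
  (forall x y, `|K x y| <= M) ->
  (mu \x mu)%E.-integrable setT (fun z => (a z.1 * (b z.2 * K z.1 z.2))%:E).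
Proof.
move=> ia ib mK KM.
have ma : measurable_fun setT a by apply/measurable_EFinP; case/integrableP: ia.
have mb : measurable_fun setT b by apply/measurable_EFinP; case/integrableP: ib.
have mF : measurable_fun setT (fun z : R * R => (a z.1 * (b z.2 * K z.1 z.2))%:E).
  apply/measurable_EFinP; apply: measurable_funM.
    exact: measurableT_comp ma measurable_fst.
  by apply: measurable_funM => //; exact: measurableT_comp mb measurable_snd.
apply/integrable12ltyP => //=.
have M0 : 0 <= M by rewrite (le_trans _ (KM 0 0)).
have mna : measurable_fun setT (fun x => `|a x|%:E).
  by apply/measurable_EFinP; exact: measurableT_comp.
have mnb : measurable_fun setT (fun y => `|b y|%:E).
  by apply/measurable_EFinP; exact: measurableT_comp.
have b0 : (0 <= \int[mu]_y `|b y|%:E)%E.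
  by apply: integral_ge0 => y _; rewrite lee_fin.
have fb : (\int[mu]_y `|b y|%:E \is a fin_num)%E.
  by rewrite ge0_fin_numE//; case/integrableP: ib.
apply: (@le_lt_trans _ _ (\int[mu]_x (`|a x|%:E * (M%:E * \int[mu]_y `|b y|%:E)))%E).
  apply: ge0_le_integral => //.
  - by move=> x _; exact: integral_ge0.
  - apply: (measurable_tonelli
      (fun z : R * R => `|(a z.1 * (b z.2 * K z.1 z.2))%:E|%E)) => //.
    exact: measurableT_comp.
  - by apply: emeasurable_funM => //.
  - move=> x _.
    have -> : (`|a x|%:E * (M%:E * \int[mu]_y `|b y|%:E) =
        \int[mu]_y (`|a x|%:E * (M%:E * `|b y|%:E)))%E.
      rewrite ge0_integralZl//; [|exact: measurable_funeM|
        by move=> y _; rewrite mule_ge0// lee_fin].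
      by rewrite ge0_integralZl//; move=> y _; rewrite lee_fin.
    apply: ge0_le_integral => //.
    + do 2! apply: measurableT_comp => //.
      apply: measurable_funM => //; apply: measurable_funM => //.
      exact: (measurableT_comp mK (measurable_pair1 x)).
    + by apply: measurable_funeM; exact: measurable_funeM.
    + move=> y _; rewrite -!EFinM lee_fin !normrM.
      by rewrite ler_wpM2l// mulrC ler_wpM2r.
have Mb0 : (0 <= M%:E * \int[mu]_y `|b y|%:E)%E by rewrite mule_ge0.
rewrite ge0_integralZr//.
rewrite lte_mul_pinfty//.
- by rewrite integral_ge0// => y _; rewrite lee_fin.
- rewrite ge0_fin_numE; last by apply: integral_ge0 => y _; rewrite lee_fin.
  by case/integrableP: ia.
- by rewrite -(fineK fb) -EFinM ltry.
Qed.

Lemma Rintegral_kernelE a b K M x :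
  mu.-integrable setT (EFin \o b) ->
  measurable_fun setT (fun z : R * R => K z.1 z.2) ->
  (forall x y, `|K x y| <= M) ->
  (\int[mu]_y (a x * (b y * K x y))%:E = (a x * \int[mu]_y (b y * K x y)%R)%:E)%E.
Proof.
move=> ib mK KM.
have i := integrable_kernel_section _ _ _ x ib mK KM.
under eq_integral do rewrite EFinM.
by rewrite integralZl// EFinM fineK//; exact: integrable_fin_num.
Qed.

Lemma Rintegral_kernel_swap a b K M :
  mu.-integrable setT (EFin \o a) -> mu.-integrable setT (EFin \o b) ->
  measurable_fun setT (fun z : R * R => K z.1 z.2) ->
  (forall x y, `|K x y| <= M) ->
  \int[mu]_x (a x * \int[mu]_y (b y * K x y)) =
  \int[mu]_y (b y * \int[mu]_x (a x * K x y)).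
Proof.
move=> ia ib mK KM.
have mK' : measurable_fun setT (fun z : R * R => K z.2 z.1).
  apply: (measurableT_comp (g := fun z : R * R => (z.2, z.1)) mK).
  exact: measurable_swap.
have := Fubini (integrable_kernel_prod _ _ _ _ ia ib mK KM) => /=.
under eq_integral do rewrite (Rintegral_kernelE _ _ _ _ _ ib mK KM).
under [X in _ = X -> _]eq_integral => y _.
  under eq_integral do rewrite mulrCA.
  rewrite (Rintegral_kernelE b a (fun y x => K x y) M y ia mK' (fun y x => KM x y)).
  over.
by move=> /(congr1 fine).
Qed.

Lemma integrable_kernel_Rintegral a b K M :
  mu.-integrable setT (EFin \o a) -> mu.-integrable setT (EFin \o b) ->
  measurable_fun setT (fun z : R * R => K z.1 z.2) ->
  (forall x y, `|K x y| <= M) ->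
  mu.-integrable setT (fun x => (a x * \int[mu]_y (b y * K x y))%:E).
Proof.
move=> ia ib mK KM.
have := integrable_fubini_F (integrable_kernel_prod _ _ _ _ ia ib mK KM) => /=.
by apply: eq_integrable => // x _; exact: (Rintegral_kernelE _ _ _ _ _ ib mK KM).
Qed.

(** Fubini yields measurability in [x] only after multiplication by an integrable function of [x];
    the weight exp(-|x|) is such a function and, being positive, is divided out again. *)
Lemma measurable_kernel_Rintegral b K M :
  mu.-integrable setT (EFin \o b) ->
  measurable_fun setT (fun z : R * R => K z.1 z.2) ->
  (forall x y, `|K x y| <= M) ->
  measurable_fun setT (fun x => \int[mu]_y (b y * K x y)).
Proof.
move=> ib mK KM.
pose a (x : R) : R := expR (- (1 * `|x|)).
have ia : mu.-integrable setT (EFin \o a) by exact: integrable_abel.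
have /integrableP[/measurable_EFinP mF _] :=
  integrable_kernel_Rintegral _ _ _ _ ia ib mK KM.
have ma : measurable_fun setT a by apply/measurable_EFinP; case/integrableP: ia.
rewrite (_ : (fun _ => _) = fun x => expR (1 * `|x|) * (a x * \int[mu]_y (b y * K x y))).
  apply: measurable_funM => //; apply: measurableT_comp => //.
  by apply: measurable_funM => //; exact: measurableT_comp.
by apply/funext => x; rewrite mulrA /a -expRD subrr expR0 mul1r.
Qed.

Lemma le_norm_kernel_Rintegral b K M x :
  mu.-integrable setT (EFin \o b) ->
  measurable_fun setT (fun z : R * R => K z.1 z.2) ->
  (forall x y, `|K x y| <= M) ->
  `|\int[mu]_y (b y * K x y)| <= M * \int[mu]_y `|b y|.
Proof.
move=> ib mK KM.
have i := integrable_kernel_section _ _ _ x ib mK KM.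
rewrite (le_trans (le_normr_Rintegral _ i))// -RintegralZl//; last exact: integrable_norm ib.
apply: le_Rintegral => //.
- exact: integrable_norm i.
- have := integrableZl measurableT M (integrable_norm ib).
  by apply: eq_integrable.
- by move=> y _; rewrite normrM mulrC ler_wpM2r.
Qed.

End kernel_fubini.

(** * Cosine and sine transforms of integrable functions *)

Section trigonometric_transforms.
Context {R : realType}.
Implicit Types (u : R -> R) (e t s w A : R).
Local Notation mu := (@lebesgue_measure R).

(** With [sin_transform]: the real part and minus the imaginary part of the integral of u(t) exp(-i
    w t). The factor 1/sqrt(2 pi) enters only in [fourier_truncE], so the analysis stays over the
    reals. *)
Definition cos_transform u w : R := \int[mu]_t (u t * cos (w * t)).
Definition sin_transform u w : R := \int[mu]_t (u t * sin (w * t)).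

Lemma measurable_cos_kernel :
  measurable_fun setT (fun z : R * R => cos (z.1 * z.2)).
Proof.
apply: (measurableT_comp (f := cos)).
  by apply: continuous_measurable_fun; exact: continuous_cos.
by apply: measurable_funM; [exact: measurable_fst|exact: measurable_snd].
Qed.

Lemma measurable_sin_kernel :
  measurable_fun setT (fun z : R * R => sin (z.1 * z.2)).
Proof.
apply: (measurableT_comp (f := sin)).
  by apply: continuous_measurable_fun; exact: continuous_sin.
by apply: measurable_funM; [exact: measurable_fst|exact: measurable_snd].
Qed.

Lemma norm_cos_le1 t : `|cos t| <= 1.
Proof. by rewrite ler_norml cos_geN1 cos_le1. Qed.

Lemma norm_sin_le1 t : `|sin t| <= 1.
Proof. by rewrite ler_norml sin_geN1 sin_le1. Qed.

Lemma integrable_mul_cos u w : mu.-integrable setT (EFin \o u) ->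
  mu.-integrable setT (fun t => (u t * cos (w * t))%:E).
Proof.
move=> iu; exact: (integrable_kernel_section u (fun w t => cos (w * t)) 1 w iu
  measurable_cos_kernel (fun x y => norm_cos_le1 _)).
Qed.

Lemma integrable_mul_sin u w : mu.-integrable setT (EFin \o u) ->
  mu.-integrable setT (fun t => (u t * sin (w * t))%:E).
Proof.
move=> iu; exact: (integrable_kernel_section u (fun w t => sin (w * t)) 1 w iu
  measurable_sin_kernel (fun x y => norm_sin_le1 _)).
Qed.

Lemma measurable_cos_transform u : mu.-integrable setT (EFin \o u) ->
  measurable_fun setT (cos_transform u).
Proof.
move=> iu; exact: (measurable_kernel_Rintegral u (fun w t => cos (w * t)) 1 iu
  measurable_cos_kernel (fun x y => norm_cos_le1 _)).
Qed.

Lemma measurable_sin_transform u : mu.-integrable setT (EFin \o u) ->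
  measurable_fun setT (sin_transform u).
Proof.
move=> iu; exact: (measurable_kernel_Rintegral u (fun w t => sin (w * t)) 1 iu
  measurable_sin_kernel (fun x y => norm_sin_le1 _)).
Qed.

Lemma le_norm_cos_transform u w : mu.-integrable setT (EFin \o u) ->
  `|cos_transform u w| <= \int[mu]_t `|u t|.
Proof.
move=> iu; rewrite -[leRHS]mul1r.
exact: (le_norm_kernel_Rintegral u (fun w t => cos (w * t)) 1 w iu
  measurable_cos_kernel (fun x y => norm_cos_le1 _)).
Qed.

Lemma le_norm_sin_transform u w : mu.-integrable setT (EFin \o u) ->
  `|sin_transform u w| <= \int[mu]_t `|u t|.
Proof.
move=> iu; rewrite -[leRHS]mul1r.
exact: (le_norm_kernel_Rintegral u (fun w t => sin (w * t)) 1 w iu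
  measurable_sin_kernel (fun x y => norm_sin_le1 _)).
Qed.

(** By the addition formula the sum of squares is the double integral of
    [u t * u s * cos (w * (t - s))]. The Abel weight makes everything absolutely integrable, so the
    integral over [w] may be carried out first, where [Rintegral_abel_cos] evaluates it. *)
Lemma abel_parseval e u : 0 < e -> mu.-integrable setT (EFin \o u) ->
  \int[mu]_w (expR (- (e * `|w|)) * (cos_transform u w ^+ 2 + sin_transform u w ^+ 2)) =
  \int[mu]_t (u t * \int[mu]_s (u s * (2 * e / (e ^+ 2 + (t - s) ^+ 2)))).
Proof.
move=> e0 iu.
have mC := measurable_cos_transform u iu.
have mS := measurable_sin_transform u iu.
pose L := \int[mu]_t `|u t|.
pose K w t := cos (w * t) * cos_transform u w + sin (w * t) * sin_transform u w.
have L0 : 0 <= L by apply: Rintegral_ge0.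
have mK : measurable_fun setT (fun z : R * R => K z.1 z.2).
  apply: measurable_funD; apply: measurable_funM.
  - exact: measurable_cos_kernel.
  - exact: (measurableT_comp mC measurable_fst).
  - exact: measurable_sin_kernel.
  - exact: (measurableT_comp mS measurable_fst).
have KM w t : `|K w t| <= L + L.
  rewrite (le_trans (ler_normD _ _))// lerD// normrM.
  - by rewrite (le_trans _ (le_norm_cos_transform u w iu))// ler_piMl// norm_cos_le1.
  - by rewrite (le_trans _ (le_norm_sin_transform u w iu))// ler_piMl// norm_sin_le1.
have iq := integrable_abel e e0.
(* Only one factor of each square is expanded; the other stays in [K], bounded by [L + L]. The
   triple integral is thus handled by two exchanges of two variables each. *)
have step1 w : cos_transform u w ^+ 2 + sin_transform u w ^+ 2 = \int[mu]_t (u t * K w t).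
  under eq_Rintegral do rewrite /K mulrDr !mulrA.
  have ic := integrable_mul_cos u w iu.
  have isn := integrable_mul_sin u w iu.
  rewrite RintegralD//; last 2 first.
  - exact: integrable_mulrr.
  - exact: integrable_mulrr.
  by rewrite !RintegralZr.
under eq_Rintegral do rewrite step1.
rewrite (Rintegral_kernel_swap _ u K (L + L))//.
apply: eq_Rintegral => t _; congr (_ * _).
have step2 w : K w t = \int[mu]_s (u s * cos (w * (t - s))).
  transitivity (\int[mu]_s (cos (w * t) * (u s * cos (w * s)) +
                            sin (w * t) * (u s * sin (w * s)))).
    have ic := integrable_mul_cos u w iu.
    have isn := integrable_mul_sin u w iu.
    rewrite RintegralD//; last 2 first.
    - exact: integrable_mulrl.
    - exact: integrable_mulrl.
    by rewrite !RintegralZl.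
  by apply: eq_Rintegral => s _; rewrite mulrBr cosB; ring.
under eq_Rintegral do rewrite step2.
rewrite (Rintegral_kernel_swap _ u (fun w s => cos (w * (t - s))) 1)//.
- by apply: eq_Rintegral => s _; rewrite Rintegral_abel_cos.
- apply: (measurableT_comp (f := cos)).
    by apply: continuous_measurable_fun; exact: continuous_cos.
  apply: measurable_funM; first exact: measurable_fst.
  by apply: measurable_funB => //; exact: measurable_snd.
- by move=> x y; exact: norm_cos_le1.
Qed.

End trigonometric_transforms.

(** * The Poisson kernel *)

Section poisson_form.
Context {R : realType}.
Implicit Types (u : R -> R) (e t s w A N : R).
Local Notation mu := (@lebesgue_measure R).

(** This is 2 pi times the Poisson kernel of the upper half-plane at height [e]. Its mass 2 pi is
    the source of that factor in Plancherel's identity for unnormalized transforms. *)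
Definition poisson e t s : R := 2 * e / (e ^+ 2 + (t - s) ^+ 2).

Lemma poisson_denom_gt0 e t s : 0 < e -> 0 < e ^+ 2 + (t - s) ^+ 2.
Proof. by move=> e0; rewrite ltr_pwDl ?exprn_gt0 ?sqr_ge0. Qed.

Lemma poisson_ge0 e t s : 0 < e -> 0 <= poisson e t s.
Proof. by move=> e0; rewrite divr_ge0 ?mulr_ge0 ?ltW ?poisson_denom_gt0. Qed.

Lemma poissonC e t s : poisson e t s = poisson e s t.
Proof. by rewrite /poisson -(opprB s t) sqrrN. Qed.

Lemma norm_poisson_le e t s : 0 < e -> `|poisson e t s| <= 2 / e.
Proof.
move=> e0; rewrite ger0_norm ?poisson_ge0//.
rewrite ler_pdivrMr ?poisson_denom_gt0//.
have -> : 2 / e * (e ^+ 2 + (t - s) ^+ 2) = 2 * e + 2 / e * (t - s) ^+ 2.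
  by field; rewrite gt_eqF.
by rewrite lerDl mulr_ge0 ?sqr_ge0// divr_ge0 ?ltW.
Qed.

Lemma poisson_le_far e d t s : 0 < e -> 0 < d -> d <= `|t - s| ->
  poisson e t s <= 2 * e / d ^+ 2.
Proof.
move=> e0 d0 ds; rewrite ler_wpM2l ?mulr_ge0 ?(ltW e0)//.
rewrite lef_pV2 ?posrE ?exprn_gt0 ?poisson_denom_gt0//.
rewrite -(real_normK (num_real (t - s))) (@le_trans _ _ (`|t - s| ^+ 2))//.
  by rewrite lerXn2r ?nnegrE ?(ltW d0).
by rewrite lerDr sqr_ge0.
Qed.

Lemma measurable_poisson e : 0 < e ->
  measurable_fun setT (fun z : R * R => poisson e z.1 z.2).
Proof.
move=> e0; apply: measurable_funM => //.
apply: (measurableT_comp (f := fun x : R => (e ^+ 2 + x ^+ 2)^-1) (g := fun z : R * R => z.1 - z.2)).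
  apply: continuous_measurable_fun => x; apply: cvgV.
    by rewrite gt_eqF// ltr_pwDl ?exprn_gt0 ?sqr_ge0.
  by apply: cvgD; [exact: cvg_cst|exact: exprn_continuous].
by apply: measurable_funB; [exact: measurable_fst|exact: measurable_snd].
Qed.

Lemma integrable_indic_sym A :
  mu.-integrable setT (EFin \o (\1_(`[- A, A] : set R) : R -> R)).
Proof. exact: (integrable_indic_itv (- A) A true false). Qed.

Lemma Rintegral_poisson_indic e t A : 0 < e -> 0 < A ->
  \int[mu]_s (\1_(`[- A, A] : set R) s * poisson e t s) =
  2 * (atan ((A - t) / e) + atan ((A + t) / e)).
Proof.
move=> e0 A0; rewrite -Rintegral_poisson// [RHS]Rintegral_mkcond.
apply: eq_Rintegral => s _; rewrite patchE indicE.
by case: ifPn => _; rewrite ?mul1r ?mul0r.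
Qed.

Lemma Rintegral_poisson_indic_le e t A : 0 < e -> 0 < A ->
  \int[mu]_s (\1_(`[- A, A] : set R) s * poisson e t s) <= 2 * pi.
Proof.
move=> e0 A0; rewrite Rintegral_poisson_indic// ler_wpM2l//.
have := @atan_ltpi2 R ((A - t) / e); have := @atan_ltpi2 R ((A + t) / e).
lra.
Qed.

(** Schur's test: [u t * u s] is at most half of [u t ^+ 2 * E s + E t * u s ^+ 2], the two halves
    have equal integrals because the kernel is symmetric, and the kernel has mass at most 2 pi. The
    indicator [E] of the support replaces the constant 1, which is not integrable. *)
Lemma poisson_form_le e A u : 0 < e -> 0 < A ->
  mu.-integrable setT (EFin \o u) ->
  mu.-integrable setT (EFin \o (fun t => u t ^+ 2)) ->
  (forall t, t \notin `[- A, A] -> u t = 0) ->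
  \int[mu]_t (u t * \int[mu]_s (u s * poisson e t s)) <=
  2 * pi * \int[mu]_t (u t ^+ 2).
Proof.
move=> e0 A0 iu iu2 supp.
pose E : R -> R := \1_(`[- A, A] : set R).
have iE : mu.-integrable setT (EFin \o E) by exact: integrable_indic_sym.
have mP := measurable_poisson e e0.
have PM t s : `|poisson e t s| <= 2 / e by exact: norm_poisson_le.
have sect b t : mu.-integrable setT (EFin \o b) ->
    mu.-integrable setT (EFin \o (fun s => b s * poisson e t s)).
  by move=> ib; exact: (integrable_kernel_section b _ _ t ib mP PM).
pose F t := u t ^+ 2 * \int[mu]_s (E s * poisson e t s).
pose G t := E t * \int[mu]_s (u s ^+ 2 * poisson e t s).
have iF : mu.-integrable setT (EFin \o F).
  exact: (integrable_kernel_Rintegral _ E _ (2 / e) iu2 iE mP PM).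
have iG : mu.-integrable setT (EFin \o G).
  exact: (integrable_kernel_Rintegral _ _ _ (2 / e) iE iu2 mP PM).
have FG : \int[mu]_t G t = \int[mu]_t F t.
  rewrite /G (Rintegral_kernel_swap E _ _ (2 / e) iE iu2 mP PM).
  apply: eq_Rintegral => t _; congr (_ * _); apply: eq_Rintegral => s _.
  by rewrite poissonC.
have le1 t : u t * \int[mu]_s (u s * poisson e t s) <= 2^-1 * F t + 2^-1 * G t.
  rewrite -RintegralZl//; last exact: sect.
  rewrite /F /G !mulrA -!RintegralZl//; [|exact: sect..].
  rewrite -RintegralD//; [|by apply: integrable_mulrl => //; exact: sect..].
  apply: le_Rintegral => //.
  - by apply: integrable_mulrl => //; exact: sect.
  - apply: integrable_addr => //; apply: integrable_mulrl => //; exact: sect.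
  - move=> s _; have := poisson_ge0 e t s e0; move: (poisson e t s) => P P0.
    rewrite !mulrA -mulrDl ler_wpM2r//.
    have EE r : E r = (r \in `[- A, A])%:R by rewrite /E indicE mem_setE.
    rewrite !EE.
    have [tE|/supp ->] := boolP (t \in `[- A, A]); last first.
      by rewrite /= !(mul0r, mulr0, addr0).
    have [sE|/supp ->] := boolP (s \in `[- A, A]); last first.
      by rewrite /= !(mul0r, mulr0, addr0).
    by rewrite !mulr1; have := sqr_ge0 (u t - u s); nra.
apply: (@le_trans _ _ (\int[mu]_t (2^-1 * F t + 2^-1 * G t))).
  apply: le_Rintegral => //.
  - exact: (integrable_kernel_Rintegral _ _ _ (2 / e) iu iu mP PM).
  - by apply: integrable_addr => //; exact: integrable_mulrl.
rewrite RintegralD//; [|exact: integrable_mulrl..].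
rewrite !RintegralZl// FG -mulrDl.
have -> : 2^-1 + 2^-1 = 1 :> R by field.
rewrite mul1r.
rewrite -RintegralZl//; apply: le_Rintegral => //; first exact: integrable_mulrl.
move=> t _; rewrite /F mulrC ler_wpM2r ?sqr_ge0//.
exact: Rintegral_poisson_indic_le.
Qed.

End poisson_form.

(** * Letting the Abel parameter tend to 0: the Plancherel inequality *)

Section abel_limit.
Context {R : realType}.
Implicit Types (u : R -> R) (e t s w A N : R).
Local Notation mu := (@lebesgue_measure R).

(** For integrable [u] this is 2 pi |u^|^2, with u^ the normalized transform. *)
Definition power_spectrum u w := cos_transform u w ^+ 2 + sin_transform u w ^+ 2.

Lemma power_spectrum_ge0 u w : 0 <= power_spectrum u w.
Proof. by rewrite addr_ge0 ?sqr_ge0. Qed.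

Lemma measurable_power_spectrum u : mu.-integrable setT (EFin \o u) ->
  measurable_fun setT (power_spectrum u).
Proof.
move=> iu; apply: measurable_funD; apply: measurable_funX.
  exact: measurable_cos_transform.
exact: measurable_sin_transform.
Qed.

Lemma ler_norm_sqr (x y : R) : `|x| <= y -> x ^+ 2 <= y ^+ 2.
Proof.
move=> xy; rewrite -(real_normK (num_real x)) lerXn2r ?nnegrE//.
exact: le_trans xy.
Qed.

Lemma integrable_abel_power_spectrum e u : 0 < e ->
  mu.-integrable setT (EFin \o u) ->
  mu.-integrable setT (EFin \o (fun w => expR (- (e * `|w|)) * power_spectrum u w)).
Proof.
move=> e0 iu.
have mG := measurable_power_spectrum u iu.
have iq := integrable_abel e e0.
have [mq _] := integrableP _ _ _ iq.
pose L := \int[mu]_t `|u t|.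
have L0 : 0 <= L by apply: Rintegral_ge0.
apply: le_integrable (integrable_mulrr _ (L ^+ 2 + L ^+ 2) _ measurableT iq) => //.
  by apply/measurable_EFinP; apply: measurable_funM => //; exact/measurable_EFinP.
move=> w _; rewrite /= lee_fin !normrM ler_wpM2l//.
rewrite !ger0_norm ?power_spectrum_ge0 ?addr_ge0 ?sqr_ge0// lerD//.
  exact/ler_norm_sqr/le_norm_cos_transform.
exact/ler_norm_sqr/le_norm_sin_transform.
Qed.

Lemma cvg_harmonicM_norm w :
  expR (- (n.+1%:R^-1 * `|w|)) @[n --> \oo] --> (1 : R).
Proof.
rewrite -[X in _ --> X](expR0 R) -[X in _ --> expR X]oppr0.
apply: (cvg_comp _ expR); last exact: continuous_expR.
apply: cvgN; rewrite -[X in _ --> X](mul0r `|w|).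
by apply: cvgMl; exact: (@cvg_harmonic R).
Qed.

(** The weights exp(-|w|/(n+1)) increase to 1, so monotone convergence applies before the spectrum
    is known to be integrable; hence a limit in the extended reals. *)
Lemma abel_limit u : mu.-integrable setT (EFin \o u) ->
  (\int[mu]_w (expR (- (n.+1%:R^-1 * `|w|)) * power_spectrum u w))%:E @[n --> \oo] -->
  (\int[mu]_w (power_spectrum u w)%:E)%E.
Proof.
move=> iu.
have mG := measurable_power_spectrum u iu.
have i n := integrable_abel_power_spectrum (n.+1%:R^-1) u (ltac:(by [])) iu.
have := @cvg_monotone_convergence _ _ _ mu setT measurableT
  (fun n w => (expR (- (n.+1%:R^-1 * `|w|)) * power_spectrum u w)%:E).
have -> : (\int[mu]_w limn (fun n => (expR (- (n.+1%:R^-1 * `|w|)) * power_spectrum u w)%:E)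
    = \int[mu]_w (power_spectrum u w)%:E)%E.
  apply: eq_integral => w _; apply/cvg_lim => //.
  apply/fine_cvgP; split; first exact: nearW.
  rewrite /comp/= -[X in _ --> X]mul1r; apply: cvgMl; exact: cvg_harmonicM_norm.
have -> : (fun n => (\int[mu]_w (expR (- (n.+1%:R^-1 * `|w|)) * power_spectrum u w))%:E)
   = (fun n => (\int[mu]_w (expR (- (n.+1%:R^-1 * `|w|)) * power_spectrum u w)%:E)%E).
  by apply/funext => n; rewrite /Rintegral fineK//; exact: integrable_fin_num (i n).
apply.
- by move=> n; have [] := integrableP _ _ _ (i n).
- by move=> n w _; rewrite lee_fin mulr_ge0 ?expR_ge0 ?power_spectrum_ge0.
- move=> w _ m n mn; rewrite lee_fin ler_wpM2r ?power_spectrum_ge0//.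
  rewrite ler_expR lerN2 ler_wpM2r// lef_pV2 ?posrE//.
  by rewrite ler_nat ltnS.
Qed.

Lemma power_spectrum_integral_le A u : 0 < A ->
  mu.-integrable setT (EFin \o u) ->
  mu.-integrable setT (EFin \o (fun t => u t ^+ 2)) ->
  (forall t, t \notin `[- A, A] -> u t = 0) ->
  (\int[mu]_w (power_spectrum u w)%:E <= (2 * pi * \int[mu]_t (u t ^+ 2))%:E)%E.
Proof.
move=> A0 iu iu2 supp.
have cv := abel_limit u iu.
rewrite -(cvg_lim _ cv)//.
apply: lime_le; first by apply/cvg_ex; eexists; exact: cv.
apply: nearW => n; rewrite lee_fin abel_parseval//.
exact: (poisson_form_le n.+1%:R^-1 A).
Qed.

(* Split the integral according to whether [s] is within [d] of [t]. *)
Lemma poisson_mean_sub_le e d eta N A t u : 0 < e -> 0 < d -> 0 <= eta -> 0 < A ->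
  mu.-integrable setT (EFin \o u) ->
  (forall s, s \notin `[- A, A] -> u s = 0) ->
  (forall s, `|u s| <= N) ->
  (forall s, `|t - s| < d -> `|u s - u t| <= eta) ->
  `|\int[mu]_s (u s * poisson e t s) -
    u t * \int[mu]_s (\1_(`[- A, A] : set R) s * poisson e t s)| <=
  eta * (2 * pi) + 2 * N * (2 * e / d ^+ 2) * (2 * A).
Proof.
move=> e0 d0 eta0 A0 iu supp uN ud.
pose E : R -> R := \1_(`[- A, A] : set R).
have EE r : E r = (r \in `[- A, A])%:R by rewrite /E indicE mem_setE.
have iE : mu.-integrable setT (EFin \o E) by exact: integrable_indic_sym.
have mP := measurable_poisson e e0.
have PM t' s : `|poisson e t' s| <= 2 / e by exact: norm_poisson_le.
have sect b : mu.-integrable setT (EFin \o b) ->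
    mu.-integrable setT (EFin \o (fun s => b s * poisson e t s)).
  by move=> ib; exact: (integrable_kernel_section b _ _ t ib mP PM).
have N0 : 0 <= N by rewrite (le_trans _ (uN 0)).
have c0 : 0 <= 2 * N * (2 * e / d ^+ 2).
  by rewrite !mulr_ge0// ?invr_ge0 ?sqr_ge0// ltW.
have IE : \int[mu]_s E s = 2 * A.
  rewrite /Rintegral integral_indic//= setIT lebesgue_measure_itv/= lte_fin gtrN//.
  by rewrite -EFinB /= opprK mulr2n mulrDl mul1r.
rewrite -RintegralZl//; last exact: sect.
rewrite -RintegralB//; [|exact: sect|by apply: integrable_mulrl => //; exact: sect].
have i1 : mu.-integrable setT (EFin \o (fun s => u s * poisson e t s - u t * (E s * poisson e t s))).
  have := integrableB measurableT (sect _ iu)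
    (integrable_mulrl _ (u t) _ measurableT (sect _ iE)).
  by apply: eq_integrable => // s _ /=; rewrite EFinB.
have i2 : mu.-integrable setT (EFin \o (fun s => eta * (E s * poisson e t s) +
    2 * N * (2 * e / d ^+ 2) * E s)).
  apply: integrable_addr => //; first by apply: integrable_mulrl => //; exact: sect.
  exact: integrable_mulrl.
rewrite (le_trans (le_normr_Rintegral _ i1))//.
apply: (@le_trans _ _ (\int[mu]_s (eta * (E s * poisson e t s) +
    2 * N * (2 * e / d ^+ 2) * E s))).
  apply: le_Rintegral => //; first exact: integrable_norm i1.
  move=> s _; rewrite EE; have [sE|/supp ->] := boolP (s \in `[- A, A]); last first.
    by rewrite /= !(mul0r, mulr0, subr0, addr0) normr0.
  rewrite !mulr1 mul1r -mulrBl normrM (ger0_norm (poisson_ge0 _ _ _ e0)).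
  have [ts|ts] := ltP `|t - s| d.
    rewrite (@le_trans _ _ (eta * poisson e t s))//.
      by rewrite ler_wpM2r ?poisson_ge0//; exact: ud.
    by rewrite lerDl.
  rewrite (@le_trans _ _ (2 * N * (2 * e / d ^+ 2)))//.
    apply: ler_pM => //; first exact: poisson_ge0.
      by rewrite (le_trans (ler_normB _ _))// mulr2n mulrDl mul1r lerD.
    exact: poisson_le_far.
  by rewrite lerDr mulr_ge0// poisson_ge0.
rewrite RintegralD//; [|by apply: integrable_mulrl => //; exact: sect|exact: integrable_mulrl].
rewrite !RintegralZl//; last exact: sect.
rewrite IE lerD2r ler_wpM2l//.
exact: Rintegral_poisson_indic_le.
Qed.

End abel_limit.

(** * Plancherel's equality for bounded functions continuous on an open interval *)

Section plancherel_continuous.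
Context {R : realType}.
Implicit Types (u : R -> R) (e t s w A N : R).
Local Notation mu := (@lebesgue_measure R).

Lemma cvg_atan_harmonic (x : R) : 0 < x ->
  atan (x / n.+1%:R^-1) @[n --> \oo] --> pi / 2.
Proof.
move=> x0.
have cn : (n.+1%:R : R) @[n --> \oo] --> +oo.
  by rewrite (cvg_shiftS (fun n => n%:R : R)); exact: cvgr_idn.
have cx : x * y @[y --> +oo] --> +oo by apply: gt0_cvgMry => //; exact: cvg_id.
under eq_fun do rewrite invrK.
exact: (cvg_comp _ _ (cvg_comp _ _ cn cx) (@cvgy_atan R)).
Qed.

(** The kernel is an approximate identity. For [t] strictly inside the interval both arctangents of
    the mass formula tend to pi/2, so the full mass 2 pi is recovered; at an endpoint only half of
    it would be. *)
Lemma poisson_mean_cvg A N t u : 0 < A -> - A < t < A ->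
  mu.-integrable setT (EFin \o u) ->
  (forall s, s \notin `[- A, A] -> u s = 0) ->
  (forall s, `|u s| <= N) ->
  {for t, continuous u} ->
  \int[mu]_s (u s * poisson n.+1%:R^-1 t s) @[n --> \oo] --> 2 * pi * u t.
Proof.
move=> A0 /andP[At tA] iu supp uN ut.
pose E : R -> R := \1_(`[- A, A] : set R).
have N0 : 0 <= N by rewrite (le_trans _ (uN 0)).
have pi0 : 0 < pi :> R by exact: pi_gt0.
have cvgE : u t * \int[mu]_s (E s * poisson n.+1%:R^-1 t s) @[n --> \oo] --> 2 * pi * u t.
  rewrite mulrC; apply: cvgMr.
  under eq_fun do rewrite Rintegral_poisson_indic//.
  have -> : 2 * pi = 2 * (pi / 2 + pi / 2) :> R by rewrite -splitr.
  apply: cvgMr; apply: cvgD.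
    by apply: cvg_atan_harmonic; rewrite subr_gt0.
  by apply: cvg_atan_harmonic; rewrite -ltrBlDl sub0r.
suff dab : (\int[mu]_s (u s * poisson n.+1%:R^-1 t s) -
    u t * \int[mu]_s (E s * poisson n.+1%:R^-1 t s)) @[n --> \oo] --> (0 : R).
  rewrite -[X in _ --> X]add0r.
  rewrite (_ : (fun _ => _) = (fun n =>
    (\int[mu]_s (u s * poisson n.+1%:R^-1 t s) -
    u t * \int[mu]_s (E s * poisson n.+1%:R^-1 t s)) +
    u t * \int[mu]_s (E s * poisson n.+1%:R^-1 t s))); first exact: cvgD.
  by apply/funext => n; rewrite subrK.
apply/cvgr0Pnorm_le => eta eta0.
(* The near part of [poisson_mean_sub_le] is this oscillation times the mass 2 pi, that is eta/2;
   the far part is the remaining eta/2. *)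
have eta4 : 0 < eta / (4 * pi) by rewrite divr_gt0// mulr_gt0.
have /cvgrPdist_le/(_ _ eta4)/nbhs_ballP[d /= d0 ud] := ut.
pose c := 2 * N * (2 / d ^+ 2) * (2 * A).
have /cvgr0Pnorm_le/(_ (eta / 2)) : c * n.+1%:R^-1 @[n --> \oo] --> (0 : R).
  by rewrite -[X in _ --> X](mulr0 c); apply: cvgMr; exact: (@cvg_harmonic R).
rewrite divr_gt0// => /(_ isT) cn.
near=> n.
have cne : `|c * n.+1%:R^-1| <= eta / 2 by near: n.
apply: (le_trans (@poisson_mean_sub_le R n.+1%:R^-1 d (eta / (4 * pi)) N A t u
  _ _ _ _ _ _ _ _)) => //.
- exact: ltW.
- by move=> s ts; rewrite distrC; apply: ud.
- have -> : eta / (4 * pi) * (2 * pi) = eta / 2.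
    by move: (pi) pi0 => P P0; field; rewrite gt_eqF.
  rewrite [leRHS]splitr lerD2l (le_trans _ cne)// (le_trans _ (ler_norm _))//.
  by rewrite /c le_eqVlt; apply/orP; left; apply/eqP; ring.
Unshelve. all: by end_near. Qed.

(** Dominated convergence in the Poisson form. Every point either lies in the open interval, where
    the means converge, or is a zero of [u], where the integrand vanishes; jumps at the endpoints
    are therefore harmless. *)
Lemma power_spectrum_integral_continuous A N u : 0 < A ->
  measurable_fun setT u ->
  (forall s, s \notin `]- A, A[ -> u s = 0) ->
  (forall s, `|u s| <= N) ->
  {in `]- A, A[, continuous u} ->
  (\int[mu]_w (power_spectrum u w)%:E = (2 * pi * \int[mu]_t (u t ^+ 2))%:E)%E.
Proof.
move=> A0 mu_ supp0 uN cu.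
have supp s : s \notin `[- A, A] -> u s = 0.
  by move=> sA; apply: supp0; apply: contra sA; exact: subset_itv_oo_cc.
have N0 : 0 <= N by rewrite (le_trans _ (uN 0)).
pose E : R -> R := \1_(`[- A, A] : set R).
have EE r : E r = (r \in `[- A, A])%:R by rewrite /E indicE mem_setE.
have iE : mu.-integrable setT (EFin \o E) by exact: integrable_indic_sym.
have iu : mu.-integrable setT (EFin \o u).
  apply: le_integrable (integrable_mulrr _ N _ measurableT iE) => //.
    exact/measurable_EFinP.
  move=> t _; rewrite /= lee_fin normrM (ger0_norm N0) EE.
  have [_|/supp ->] := boolP (t \in _); last by rewrite normr0 mulr_ge0.
  by rewrite normr1 mul1r.
have cv := abel_limit u iu.
rewrite -(cvg_lim _ cv)//; apply/cvg_lim => //.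
apply/fine_cvgP; split; first exact: nearW.
rewrite /comp/=.
under eq_fun do rewrite abel_parseval//.
pose H n t := u t * \int[mu]_s (u s * poisson n.+1%:R^-1 t s).
have iH n : mu.-integrable setT (EFin \o H n).
  apply: (integrable_kernel_Rintegral _ _ _ (2 / n.+1%:R^-1) iu iu).
    exact: measurable_poisson.
  by move=> x y; exact: norm_poisson_le.
have mP n : measurable_fun setT (fun z : R * R => poisson n.+1%:R^-1 z.1 z.2).
  exact: measurable_poisson.
have PM n (x y : R) : `|poisson n.+1%:R^-1 x y| <= 2 / n.+1%:R^-1 by exact: norm_poisson_le.
have piN0 : 0 <= 2 * pi * N by rewrite !mulr_ge0// ltW// pi_gt0.
(* A bound uniform in [n], which makes [|u t| * (2 * pi * N)] a dominating function. *)
have Hb n t : `|\int[mu]_s (u s * poisson n.+1%:R^-1 t s)| <= 2 * pi * N.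
  have i1 := integrable_kernel_section u (poisson _) _ t iu (mP n) (PM n).
  have i2 := integrable_kernel_section E (poisson _) _ t iE (mP n) (PM n).
  rewrite (le_trans (le_normr_Rintegral _ i1))//.
  apply: (@le_trans _ _ (\int[mu]_s (N * (E s * poisson n.+1%:R^-1 t s)))).
    apply: le_Rintegral => //; first exact: integrable_norm i1.
      exact: integrable_mulrl.
    move=> s _; rewrite normrM (ger0_norm (poisson_ge0 _ _ _ _))// mulrA.
    rewrite ler_wpM2r ?poisson_ge0// EE.
    have [_|/supp ->] := boolP (s \in _); first by rewrite mulr1.
    by rewrite normr0 mulr0.
  rewrite RintegralZl// mulrC ler_wpM2r//.
  exact: Rintegral_poisson_indic_le.
have [|||||iUU _ cvI] := @dominated_convergence _ _ R mu setT measurableT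
  (fun n t => (H n t)%:E) (fun t => (u t * (2 * pi * u t))%:E)
  (fun t => (`|u t| * (2 * pi * N))%:E).
- by move=> n; have [] := integrableP _ _ _ (iH n).
- by apply/measurable_EFinP; apply: measurable_funM => //; exact: measurable_funM.
- apply: aeW => t _; apply/fine_cvgP; split; first exact: nearW.
  rewrite /comp/= /H.
  have [tA|/supp0 ->] := boolP (t \in `]- A, A[); last first.
    by under eq_fun do rewrite mul0r; rewrite mul0r; exact: cvg_cst.
  apply: cvgMr; apply: (poisson_mean_cvg A N) => //; exact: cu.
- exact: (integrable_mulrr _ _ _ measurableT (integrable_norm iu)).
- apply: aeW => t n _; rewrite /= lee_fin normrM ler_wpM2l//.
have -> : 2 * pi * \int[mu]_t u t ^+ 2 = \int[mu]_t (u t * (2 * pi * u t)).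
  rewrite -RintegralZl//.
    by apply: eq_Rintegral => t _; ring.
  apply: le_integrable (integrable_mulrr _ N _ measurableT (integrable_norm iu)) => //.
    by apply/measurable_EFinP; apply: measurable_funX.
  move=> t _; rewrite /= lee_fin normrX expr2 normrM normr_id (ger0_norm N0).
  by rewrite ler_wpM2l.
rewrite -(fineK (integrable_fin_num _ iUU))// in cvI.
exact: (fine_cvg cvI).
Qed.

End plancherel_continuous.

(** * Plancherel's theorem for compactly supported functions *)

Section clip.
Context {R : realType}.
Implicit Types N x y : R.

Definition clip N x := Num.max (- N) (Num.min x N).

Lemma clip_id N x : `|x| <= N -> clip N x = x.
Proof.
by rewrite ler_norml => /andP[Nx xN]; rewrite /clip (min_idPl xN); apply/max_idPr.
Qed.

Lemma norm_clip N x : 0 <= N -> `|clip N x| <= N.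
Proof.
move=> N0; rewrite ler_norml /clip le_max lexx/= ge_max ge_min lexx orbT andbT.
by rewrite ge0_cp.
Qed.

Lemma dist_clip N x y : `|clip N x - clip N y| <= `|x - y|.
Proof.
rewrite /clip /Num.max /Num.min.
have := ler_norm (x - y); have := ler_norm (- (x - y)); rewrite normrN.
move: `|x - y| => D D1 D2.
rewrite ler_norml; apply/andP; split; case: (ltP x N) => ?; case: (ltP y N) => ?;
  repeat (match goal with |- context [if ?a < ?b then _ else _] =>
  case: (ltP a b) => ? end); lra.
Qed.

Lemma le_dist_clip N x : 0 <= N -> `|x - clip N x| <= `|x|.
Proof.
move=> N0; rewrite /clip /Num.max /Num.min.
have := ler_norm x; have := ler_norm (- x); rewrite normrN.
move: `|x| => D D1 D2.
rewrite ler_norml; apply/andP; split; case: (ltP x N) => ?;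
  repeat (match goal with |- context [if ?a < ?b then _ else _] =>
  case: (ltP a b) => ? end); lra.
Qed.

Lemma continuous_clip N : continuous (clip N).
Proof.
move=> x; apply/cvgrPdist_le => e e0; near=> y.
rewrite (le_trans (dist_clip _ _ _))//.
Unshelve. all: by end_near. Qed.

Lemma clip0 N : 0 <= N -> clip N 0 = 0.
Proof. by move=> N0; rewrite clip_id// normr0. Qed.

End clip.

(** * Density in L^2 of bounded functions continuous on an open interval *)

Section continuous_approximation.
Context {R : realType}.
Implicit Types (u v : R -> R) (e t s w A N eta : R).
Local Notation mu := (@lebesgue_measure R).

Lemma clip_approximation u eta : 0 < eta ->
  measurable_fun setT u ->
  mu.-integrable setT (EFin \o (fun t => u t ^+ 2)) ->
  exists n : nat, \int[mu]_t ((u t - clip n%:R (u t)) ^+ 2) <= eta.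
Proof.
move=> eta0 mu_ iu2.
have mclip n : measurable_fun setT (fun t => clip n%:R (u t)).
  apply: (measurableT_comp (f := clip n%:R)) => //.
  by apply: continuous_measurable_fun; exact: continuous_clip.
have mF n : measurable_fun setT (fun t => (u t - clip n%:R (u t)) ^+ 2).
  by apply: measurable_funX; exact: measurable_funB.
have [||||| _ _ cvI] := @dominated_convergence _ _ R mu setT measurableT
  (fun n t => ((u t - clip n%:R (u t)) ^+ 2)%:E) (cst 0%E) (EFin \o (fun t => u t ^+ 2)).
- by move=> n; apply/measurable_EFinP; exact: mF.
- exact: measurable_cst.
- apply: aeW => t _; apply/fine_cvgP; split; first exact: nearW.
  apply: cvg_near_cst; near=> n; rewrite /= clip_id ?subrr ?expr0n//.
  near: n; exact: nbhs_infty_ger.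
- by [].
- apply: aeW => t n _; rewrite /= lee_fin normrX.
  by rewrite -(real_normK (num_real (u t))) lerXn2r ?nnegrE// le_dist_clip.
rewrite integral0 in cvI.
have cvF : \int[mu]_t ((u t - clip n%:R (u t)) ^+ 2) @[n --> \oo] --> (0 : R).
  exact: (fine_cvg cvI).
have /cvgr0Pnorm_le/(_ _ eta0)[n _ nI] := cvF.
exists n; apply: le_trans (nI n (leqnn n)); exact: ler_norm.
Unshelve. all: by end_near. Qed.

(** Density in L^1 is upgraded to L^2 by clipping: two values bounded by [N] satisfy |a - b|^2 <= 2
    N |a - b|. The function [u] is clipped first, then the continuous approximant at the same level,
    which does not increase the distance. Cutting the approximant off outside the interval is why
    continuity is claimed only inside. *)
Lemma continuous_L2_approximation A u eta : 0 < A -> 0 < eta ->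
  measurable_fun setT u ->
  mu.-integrable setT (EFin \o (fun t => u t ^+ 2)) ->
  (forall s, s \notin `]- A, A[ -> u s = 0) ->
  exists N (v : R -> R), [/\ measurable_fun setT v,
    (forall s, s \notin `]- A, A[ -> v s = 0),
    (forall s, `|v s| <= N),
    {in `]- A, A[, continuous v} &
    \int[mu]_t ((u t - v t) ^+ 2) <= eta].
Proof.
move=> A0 eta0 mu_ iu2 supp.
have eta4 : 0 < eta / 4 by rewrite divr_gt0.
have [n nI] := clip_approximation u _ eta4 mu_ iu2.
set N : R := n%:R in nI.
have N0 : 0 <= N by [].
have mclip f : measurable_fun setT f -> measurable_fun setT (fun t : R => clip N (f t) : R).
  move=> mf; apply: (measurableT_comp (f := clip N)) => //.
  by apply: continuous_measurable_fun; exact: continuous_clip.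
pose D : set R := `]- A, A[%classic.
have mD : measurable (D : set (measurableTypeR R)) by exact: measurable_itv.
have fD : (mu D < +oo)%E by rewrite /D lebesgue_measure_itv/= lte_fin gtrN// -EFinB ltry.
have iuN : mu.-integrable D (EFin \o (fun t => clip N (u t))).
  apply: measurable_bounded_integrable => //.
    by apply: measurable_funTS; exact: mclip.
  exists N; split; first exact: num_real.
  by move=> M NM t _; apply: (le_trans (norm_clip _ _ N0)); exact: ltW.
have [g [cg ig gI]] := approximation_continuous_integrable mD fD iuN.
(* Chosen so that [2 * (2 * N) * d <= eta / 2]; the other half is twice the clipping error eta/4.
   The [+ 1] covers [N = 0]. *)
pose d := eta / 4 / (2 * N + 1).
have d0 : 0 < d by rewrite divr_gt0// ltr_wpDl// mulr_ge0.
have [k gk] : exists k, (\int[mu]_(t in D) `|(clip N (u t) - g k t)%:E| <= d%:E)%E.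
  have /fine_cvgP[[a _ fa] /cvgr0Pnorm_le/(_ _ d0)[b _ gb]] := gI.
  exists (maxn a b).
  have := gb (maxn a b) (leq_maxr _ _); have := fa (maxn a b) (leq_maxl _ _).
  move=> /= fn; rewrite -[in X in _ -> X](fineK fn) lee_fin; apply: le_trans.
  exact: ler_norm.
have mg : measurable_fun setT (g k) by apply: continuous_measurable_fun.
pose v t := \1_D t * clip N (g k t).
have mv : measurable_fun setT v by apply: measurable_funM => //; exact: mclip.
have vin t : t \in `]- A, A[ -> v t = clip N (g k t).
  by move=> tA; rewrite /v indicE mem_setE tA mul1r.
have vout t : t \notin `]- A, A[ -> v t = 0.
  by move=> tA; rewrite /v indicE mem_setE (negbTE tA) mul0r.
exists N, v; split => //.
- move=> t; have [tA|/vout ->] := boolP (t \in `]- A, A[); last by rewrite normr0.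
  by rewrite vin// norm_clip.
- move=> t tA; rewrite /continuous_at (vin t tA).
  have cc : {for t, continuous (fun y => clip N (g k y))}.
    by apply: continuous_comp; [exact: cg|exact: continuous_clip].
  apply: cvg_trans cc; apply: near_eq_cvg; near=> y.
  rewrite vin//; near: y.
  exact: near_in_itvoo.
have i1 : mu.-integrable setT (EFin \o (fun t => (u t - clip N (u t)) ^+ 2)).
  apply: le_integrable iu2 => //.
    apply/measurable_EFinP; apply: measurable_funX; apply: measurable_funB => //.
    exact: mclip.
  move=> t _; rewrite /= lee_fin normrX (ger0_norm (sqr_ge0 (u t))).
  by rewrite -(real_normK (num_real (u t))) lerXn2r ?nnegrE// le_dist_clip.
have iD : mu.-integrable setT (EFin \o ((fun t => `|clip N (u t) - g k t|) \_ D)).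
  have iabs : mu.-integrable D (EFin \o (fun t => `|clip N (u t) - g k t|)).
    have := integrable_abse (integrableB mD iuN (ig k)).
    by apply: eq_integrable.
  by have := (@integrable_mkcond _ _ _ mu D _ mD).1 iabs; rewrite restrict_EFin.
have ID : \int[mu]_t (((fun t => `|clip N (u t) - g k t|) \_ D) t) <= d.
  rewrite -Rintegral_mkcond /Rintegral.
  have fI : (\int[mu]_(t in D) `|(clip N (u t) - g k t)%:E| \is a fin_num)%E.
    rewrite ge0_fin_numE; first exact: le_lt_trans gk (ltry _).
    by apply: integral_ge0 => t _.
  by rewrite -lee_fin fineK.
pose F t := 2 * (u t - clip N (u t)) ^+ 2 +
  2 * (2 * N) * ((fun t => `|clip N (u t) - g k t|) \_ D) t.
have uvF t : (u t - v t) ^+ 2 <= F t.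
  have le2 (a b : R) : (a + b) ^+ 2 <= 2 * a ^+ 2 + 2 * b ^+ 2.
    by have := sqr_ge0 (a - b); nra.
  have -> : u t - v t = (u t - clip N (u t)) + (clip N (u t) - v t) by ring.
  rewrite (le_trans (le2 _ _))// lerD2l -mulrA ler_wpM2l//.
  rewrite patchE mem_setE.
  have [tA|tA] := boolP (t \in `]- A, A[); last first.
    by rewrite vout// supp// clip0// subrr expr0n mulr0.
  rewrite vin// -(real_normK (num_real (_ - _))) expr2 ler_pM//.
    rewrite (le_trans (ler_normB _ _))// mulr2n mulrDl mul1r.
    by rewrite lerD// norm_clip.
  have := dist_clip N (clip N (u t)) (g k t).
  by rewrite (clip_id N (clip N (u t)) (norm_clip _ _ N0)).
have iF : mu.-integrable setT (EFin \o F).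
  by apply: integrable_addr => //; exact: integrable_mulrl.
have iuv : mu.-integrable setT (EFin \o (fun t => (u t - v t) ^+ 2)).
  apply: le_integrable iF => //.
    by apply/measurable_EFinP; apply: measurable_funX; exact: measurable_funB.
  by move=> t _; rewrite /= lee_fin ger0_norm ?sqr_ge0// (le_trans (uvF t))// ler_norm.
apply: (le_trans (le_Rintegral measurableT iuv iF (fun t _ => uvF t))).
rewrite RintegralD//; [|exact: integrable_mulrl..].
rewrite !RintegralZl//.
have dN : 2 * (2 * N) * d <= eta / 2.
  have -> : eta / 2 = 2 * (2 * N + 1) * d.
    by rewrite /d; field; rewrite gt_eqF// ltr_wpDl// mulr_ge0.
  by rewrite ler_wpM2r ?(ltW d0)// ler_wpM2l// lerDl.
have := ler_wpM2l _ ID => /(_ (2 * (2 * N))); rewrite !mulr_ge0// => /(_ isT).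
lra.
Unshelve. all: by end_near. Qed.

End continuous_approximation.

(** * Extension of Plancherel's equality by density *)

Section compact_plancherel.
Context {R : realType}.
Implicit Types (u v : R -> R) (e t s w A N : R).
Local Notation mu := (@lebesgue_measure R).

Lemma cos_transformB u v k w :
  mu.-integrable setT (EFin \o u) -> mu.-integrable setT (EFin \o v) ->
  cos_transform (fun t => u t - k * v t) w = cos_transform u w - k * cos_transform v w.
Proof.
move=> iu iv; rewrite /cos_transform.
have ic := integrable_mul_cos u w iu.
have jc := integrable_mul_cos v w iv.
rewrite -RintegralZl// -RintegralB//; last exact: integrable_mulrl.
by apply: eq_Rintegral => t _; rewrite mulrBl mulrA.
Qed.

Lemma sin_transformB u v k w :
  mu.-integrable setT (EFin \o u) -> mu.-integrable setT (EFin \o v) ->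
  sin_transform (fun t => u t - k * v t) w = sin_transform u w - k * sin_transform v w.
Proof.
move=> iu iv; rewrite /sin_transform.
have ic := integrable_mul_sin u w iu.
have jc := integrable_mul_sin v w iv.
rewrite -RintegralZl// -RintegralB//; last exact: integrable_mulrl.
by apply: eq_Rintegral => t _; rewrite mulrBl mulrA.
Qed.

Lemma integrable_of_sqr A u : measurable_fun setT u ->
  mu.-integrable setT (EFin \o (fun t => u t ^+ 2)) ->
  (forall s, s \notin `[- A, A] -> u s = 0) ->
  mu.-integrable setT (EFin \o u).
Proof.
move=> mu_ iu2 supp.
apply: le_integrable (integrable_addr _ _ _ measurableT (integrable_indic_sym A) iu2) => //.
  exact/measurable_EFinP.
move=> t _; rewrite /= lee_fin indicE mem_setE.
have [tA|/supp ->] := boolP (t \in `[- A, A]); last by rewrite normr0.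
rewrite (ger0_norm (addr_ge0 _ _)) ?sqr_ge0//= -(real_normK (num_real (u t))).
have := sqr_ge0 (`|u t| - 1); have := normr_ge0 (u t); nra.
Qed.

Lemma integrable_sqrB u v k : measurable_fun setT u -> measurable_fun setT v ->
  mu.-integrable setT (EFin \o (fun t => u t ^+ 2)) ->
  mu.-integrable setT (EFin \o (fun t => v t ^+ 2)) ->
  mu.-integrable setT (EFin \o (fun t => (u t - k * v t) ^+ 2)).
Proof.
move=> mu_ mv iu iv.
apply: le_integrable (integrable_addr _ _ _ measurableT
  (integrable_mulrl _ 2 _ measurableT iu)
  (integrable_mulrl _ (2 * k ^+ 2) _ measurableT iv)) => //.
  apply/measurable_EFinP; apply: measurable_funX; apply: measurable_funB => //.
  exact: measurable_funM.
move=> t _; rewrite /= lee_fin ger0_norm ?sqr_ge0//.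
rewrite (le_trans _ (ler_norm _))//.
by have := sqr_ge0 (u t + k * v t); nra.
Qed.

Lemma integrable_power_spectrum A u : 0 < A -> measurable_fun setT u ->
  mu.-integrable setT (EFin \o (fun t => u t ^+ 2)) ->
  (forall t, t \notin `[- A, A] -> u t = 0) ->
  mu.-integrable setT (EFin \o power_spectrum u) /\
  \int[mu]_w power_spectrum u w <= 2 * pi * \int[mu]_t (u t ^+ 2).
Proof.
move=> A0 mu_ iu2 supp.
have iu := integrable_of_sqr A u mu_ iu2 supp.
have le := power_spectrum_integral_le A u A0 iu iu2 supp.
have i : mu.-integrable setT (EFin \o power_spectrum u).
  apply/integrableP; split.
    by apply/measurable_EFinP; exact: measurable_power_spectrum.
  apply: le_lt_trans (ltry (2 * pi * \int[mu]_t (u t ^+ 2))).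
  apply: le_trans le; apply: ge0_le_integral => //.
  - by apply: measurableT_comp => //; apply/measurable_EFinP; exact: measurable_power_spectrum.
  - by apply/measurable_EFinP; exact: measurable_power_spectrum.
  - by move=> w _; rewrite /= lee_fin ger0_norm ?power_spectrum_ge0.
split=> //.
by rewrite -lee_fin /Rintegral fineK//; exact: integrable_fin_num i.
Qed.

(* [2 pi |u|^2 - |u^|^2] is a nonnegative quadratic form vanishing on the
   continuous functions, so by the parallelogram law it is at most twice its
   value at the difference of [u] and a continuous function. *)
Lemma compact_plancherel A u : 0 < A -> measurable_fun setT u ->
  mu.-integrable setT (EFin \o (fun t => u t ^+ 2)) ->
  (forall t, t \notin `]- A, A[ -> u t = 0) ->
  \int[mu]_w power_spectrum u w = 2 * pi * \int[mu]_t (u t ^+ 2).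
Proof.
move=> A0 mu_ iu2 supp0.
(* The parallelogram law is applied to [u - v] and [v], whose sum and difference are [u] and
   [u - 2 * v]. The letters [a], [b], [c], [d] are the squared norms of [u], [u - 2 * v], [u - v],
   [v], and [qu], [q2], [q1], [qv] the integrals of their spectra; the inequality is used at
   [u - 2 * v], the equality at [v]. *)
have arith (P a b c d qu q2 q1 qv eta : R) : a + b = 2 * c + 2 * d ->
    q2 <= 2 * P * b -> qv = 2 * P * d -> qu + q2 = 2 * q1 + 2 * qv -> 0 <= q1 ->
    2 * P * c <= eta / 2 -> 2 * P * a <= qu + eta.
  move=> E1 + -> E2.
  have -> : a = 2 * c + 2 * d - b by rewrite -E1 addrK.
  lra.
have close (f : R -> R) : (forall t, t \notin `]- A, A[ -> f t = 0) ->
    forall t, t \notin `[- A, A] -> f t = 0.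
  by move=> f0 t tA; apply: f0; apply: contra tA; exact: subset_itv_oo_cc.
have iu := integrable_of_sqr A u mu_ iu2 (close _ supp0).
have [ipu leu] := integrable_power_spectrum A u A0 mu_ iu2 (close _ supp0).
apply/eqP; rewrite eq_le leu/=; apply/ler_addgt0Pr => eta eta0.
have pi0 : 0 < pi :> R by exact: pi_gt0.
have eta4 : 0 < eta / (4 * pi) by rewrite divr_gt0// mulr_gt0.
have [N [v [mv vsupp vN cv uv]]] := continuous_L2_approximation A u _ A0 eta4 mu_ iu2 supp0.
have iv2 : mu.-integrable setT (EFin \o (fun t => v t ^+ 2)).
  apply: le_integrable (integrable_mulrr _ (N ^+ 2) _ measurableT
    (integrable_indic_sym A)) => //.
    by apply/measurable_EFinP; exact: measurable_funX.
  move=> t _; rewrite /= lee_fin (ger0_norm (sqr_ge0 (v t))) normrM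
    (ger0_norm (sqr_ge0 N)) indicE mem_setE.
  have [tA|/(close _ vsupp) ->] := boolP (t \in `[- A, A]); last first.
    by rewrite expr0n/= mulr_ge0// sqr_ge0.
  by rewrite normr1 mul1r; exact: ler_norm_sqr.
have iv := integrable_of_sqr A v mv iv2 (close _ vsupp).
have ipv := (integrable_power_spectrum A v A0 mv iv2 (close _ vsupp)).1.
have Bv : \int[mu]_w power_spectrum v w = 2 * pi * \int[mu]_t (v t ^+ 2).
  by rewrite /Rintegral (power_spectrum_integral_continuous A N).
have vk k t : t \notin `]- A, A[ -> u t - k * v t = 0.
  by move=> tA; rewrite supp0// vsupp// mulr0 subr0.
have mk k : measurable_fun setT (fun t => u t - k * v t).
  by apply: measurable_funB => //; exact: measurable_funM.
have spec k := integrable_power_spectrum A (fun t => u t - k * v t) A0 (mk k)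
  (integrable_sqrB _ _ k mu_ mv iu2 iv2) (close _ (vk k)).
have [ip1 _] := spec 1; have [ip2 le2] := spec 2.
have i1 := integrable_sqrB _ _ 1 mu_ mv iu2 iv2.
have i2 := integrable_sqrB _ _ 2 mu_ mv iu2 iv2.
have parN : \int[mu]_t (u t ^+ 2) + \int[mu]_t ((u t - 2 * v t) ^+ 2) =
    2 * \int[mu]_t ((u t - 1 * v t) ^+ 2) + 2 * \int[mu]_t (v t ^+ 2).
  rewrite -!RintegralZl// -!RintegralD//; [|exact: integrable_mulrl..].
  by apply: eq_Rintegral => t _; ring.
have parQ : \int[mu]_w power_spectrum u w +
      \int[mu]_w power_spectrum (fun t => u t - 2 * v t) w =
    2 * \int[mu]_w power_spectrum (fun t => u t - 1 * v t) w +
    2 * \int[mu]_w power_spectrum v w.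
  rewrite -!RintegralZl// -!RintegralD//; [|exact: integrable_mulrl..].
  apply: eq_Rintegral => w _; rewrite /power_spectrum !cos_transformB// !sin_transformB//.
  by ring.
have Q1 : 0 <= \int[mu]_w power_spectrum (fun t => u t - 1 * v t) w.
  by apply: Rintegral_ge0 => w _; exact: power_spectrum_ge0.
have E1 : \int[mu]_t ((u t - 1 * v t) ^+ 2) = \int[mu]_t ((u t - v t) ^+ 2).
  by apply: eq_Rintegral => t _; rewrite mul1r.
rewrite E1 in parN.
have uv' : 2 * pi * \int[mu]_t ((u t - v t) ^+ 2) <= eta / 2.
  rewrite (le_trans (ler_wpM2l _ uv)) ?mulr_ge0 ?(ltW pi0)//.
  rewrite le_eqVlt; apply/orP; left; apply/eqP.
  by move: (pi) pi0 => P P0; field; rewrite gt_eqF.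
exact: arith parN le2 Bv parQ Q1 uv'.
Qed.

End compact_plancherel.

(** * Completeness of the space of square-integrable functions *)

Section riesz_fischer.
Context {R : realType}.
Local Notation mu := (@lebesgue_measure R).

Lemma ae_imply (P Q : R -> Prop) : (forall x, P x -> Q x) ->
  {ae mu, forall x, P x} -> {ae mu, forall x, Q x}.
Proof. by move=> PQ; apply: negligibleS => x /= nQ p; exact/nQ/PQ. Qed.

Lemma ae_imply2 (P Q S : R -> Prop) : (forall x, P x -> Q x -> S x) ->
  {ae mu, forall x, P x} -> {ae mu, forall x, Q x} -> {ae mu, forall x, S x}.
Proof.
move=> PQS aP aQ; have := negligibleU aP aQ; apply: negligibleS => x /= nS.
by apply: contrapT => /not_orP[/contrapT p /contrapT q]; exact/nS/PQS.
Qed.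

Lemma cvg_of_geometric_steps (h : nat -> R) (C : R) :
  (forall k, `|h k.+1 - h k| <= C * (2^-1) ^+ k) -> cvgn h.
Proof.
move=> hC.
have cs : cvgn (series (fun k => h k.+1 - h k)).
  apply: normed_cvg; apply: (@series_le_cvg _ _ (geometric C 2^-1)) => //.
  - by move=> n; rewrite /=.
  - by move=> n; exact: (le_trans (normr_ge0 _) (hC n)).
  - apply: is_cvg_geometric_series.
    by rewrite gtr0_norm// invf_lt1// ltr1n.
have -> : h = (fun n => series (fun k => h k.+1 - h k) n + h 0%N).
  apply/funext => n; rewrite /series/= telescope_sumr//.
  by rewrite subrK.
by apply: is_cvgD => //; exact: is_cvg_cst.
Qed.

Lemma fast_subsequence (c : nat -> R) : c n @[n --> \oo] --> (0 : R) ->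
  exists phi : nat -> nat, [/\ forall k, (k <= phi k)%N,
    forall k, (phi k <= phi k.+1)%N & forall k, c (phi k) <= (8^-1) ^+ k].
Proof.
move=> c0.
have H k : exists N : nat, forall n, (N <= n)%N -> c n <= (8^-1) ^+ k.
  have e0 : 0 < (8^-1 : R) ^+ k by rewrite exprn_gt0.
  have /cvgr0Pnorm_le/(_ _ e0)[N _ NP] := c0.
  by exists N => n Nn; rewrite (le_trans (ler_norm _))//; exact: NP.
pose N k := sval (cid (H k)).
have NP k n : (N k <= n)%N -> c n <= (8^-1) ^+ k := svalP (cid (H k)) n.
(* Summing all thresholds makes the sequence monotone and each term at least [N k]; the summand [k]
   makes it at least [k]. *)
exists (fun k => k + \sum_(i < k.+1) N i)%N; split => [k|k|k].
- exact: leq_addr.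
- by rewrite [X in (_ <= _ + X)%N]big_ord_recr/= leq_add// leq_addr.
- by apply: NP; rewrite big_ord_recr/= addnA leq_addl.
Qed.

(** The squared steps, weighted by 4^k, have integrals at most (4/8)^k = 2^-k, so the weighted sum
    [S] is integrable and hence finite almost everywhere. Where it is finite, the k-th step is at
    most sqrt(S) 2^-k and the sequence converges. *)
Lemma ae_cvg_of_fast_L2 (h : nat -> R -> R) :
  (forall k, measurable_fun setT (h k)) ->
  (forall k, (\int[mu]_x ((h k.+1 x - h k x) ^+ 2)%:E <= ((8^-1) ^+ k)%:E)%E) ->
  {ae mu, forall x, cvgn (h ^~ x)}.
Proof.
move=> mh hI.
pose d k x : \bar R := (4 ^+ k * (h k.+1 x - h k x) ^+ 2)%:E.
have d0 k x : (0 <= d k x)%E by rewrite lee_fin mulr_ge0 ?sqr_ge0 ?exprn_ge0.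
have mdk k : measurable_fun setT (fun x => (h k.+1 x - h k x) ^+ 2).
  by apply: measurable_funX; exact: measurable_funB.
have md k : measurable_fun setT (d k).
  by apply/measurable_EFinP; exact: measurable_funM.
pose S x := (\sum_(0 <= k <oo) d k x)%E.
have mS : measurable_fun setT S.
  by apply: ge0_emeasurable_sum => // k x _ _; exact: d0.
have S0 x : (0 <= S x)%E by apply: nneseries_ge0 => k _ _; exact: d0.
have geo : (\sum_(0 <= k <oo) ((2^-1 : R) ^+ k)%:E = 2%:E)%E.
  have cg : series (geometric 1 (2^-1 : R)) @ \oo --> (1 * (1 - 2^-1)^-1 : R).
    by apply: cvg_geometric_series; rewrite gtr0_norm// invf_lt1// ltr1n.
  apply/cvg_lim => //.
  have -> : (2%:E = (1 * (1 - 2^-1)^-1 : R)%:E)%E by congr EFin; field.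
  rewrite (_ : (fun n => _) = EFin \o series (geometric 1 2^-1)).
    exact: cvg_EFin (nearW _ _) cg.
  apply/funext => n; rewrite /= /series/= -sumEFin.
  by apply: eq_bigr => k _; rewrite mul1r.
have IS : (\int[mu]_x S x <= 2%:E)%E.
  rewrite integral_nneseries//.
  rewrite -geo; apply: lee_nneseries => k _.
    by move=> _; apply: integral_ge0 => x _; exact: d0.
  rewrite /d; under eq_integral do rewrite EFinM.
  rewrite ge0_integralZl; [|exact: measurableT|by apply/measurable_EFinP; exact: mdk|
    by move=> x _; rewrite lee_fin sqr_ge0|by rewrite lee_fin exprn_ge0].
  have -> : ((2^-1 : R) ^+ k)%:E = ((4 ^+ k : R)%:E * ((8^-1) ^+ k)%:E)%E.
    by rewrite -EFinM -exprMn; congr (_ ^+ k)%:E; field.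
  by rewrite lee_wpmul2l// lee_fin exprn_ge0.
have iS : mu.-integrable setT S.
  apply/integrableP; split => //.
  under eq_integral do rewrite gee0_abs//.
  exact: le_lt_trans IS (ltry _).
have := integrable_ae measurableT iS.
apply: filterS => x /(_ I) Sx.
apply: (cvg_of_geometric_steps _ (Num.sqrt (fine (S x)))) => k.
have dS : (d k x <= S x)%E.
  rewrite /S (@nneseriesD1 _ _ k)//.
  by rewrite leeDl// nneseries_ge0.
rewrite -(fineK Sx) lee_fin in dS.
have fS : 0 <= fine (S x) by rewrite fine_ge0.
rewrite -(@ler_pXn2r _ 2)// ?nnegrE ?mulr_ge0 ?sqrtr_ge0 ?exprn_ge0//.
rewrite exprMn sqr_sqrtr// real_normK ?num_real// -exprM mulnC exprM.
have -> : (2^-1 : R) ^+ 2 = 4^-1 by field.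
by rewrite exprVn ler_pdivlMr ?exprn_gt0// mulrC.
Qed.

Lemma limn_einf_le (w : (\bar R)^nat) (c : \bar R) n :
  (forall k, (n <= k)%N -> (w k <= c)%E) -> (limn_einf w <= c)%E.
Proof.
move=> wc; rewrite limn_einf_lim; apply: lime_le; first exact: is_cvg_einfs.
near=> k; apply: (@le_trans _ _ (w k)).
  by apply: ereal_inf_lbound; exists k => /=.
by apply: wc; near: k; exact: nbhs_infty_ge.
Unshelve. all: by end_near. Qed.

Lemma limn_einf_ge0 (w : (\bar R)^nat) : (forall k, (0 <= w k)%E) -> (0 <= limn_einf w)%E.
Proof.
move=> w0; rewrite limn_einf_lim; apply: lime_ge; first exact: is_cvg_einfs.
by apply: nearW => k; apply/ereal_infP => _ [i _ <-].
Qed.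

Lemma measurable_limn_einf (w : nat -> R -> \bar R) :
  (forall k, measurable_fun setT (w k)) ->
  measurable_fun setT (fun x => limn_einf (w ^~ x)).
Proof.
move=> mw.
have -> : (fun x => limn_einf (w ^~ x)) =
    (fun x => - limn_esup (fun k => - w k x))%E.
  apply/funext => x; rewrite -limn_einfN; congr limn_einf.
  by apply/funext => k /=; rewrite oppeK.
apply: measurableT_comp => //; apply: measurable_fun_limn_esup => k.
exact: measurableT_comp.
Qed.

(** The limit is the finite part of an upper limit along a fast subsequence, hence measurable even
    where that subsequence diverges. Fatou's lemma along the subsequence transfers the Cauchy bound
    [c n] to the distance from the limit. *)
Lemma riesz_fischer (f : nat -> R -> R) (c : nat -> R) :
  (forall n, measurable_fun setT (f n)) ->
  c n @[n --> \oo] --> (0 : R) ->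
  (forall n m, (n <= m)%N -> (\int[mu]_x ((f m x - f n x) ^+ 2)%:E <= (c n)%:E)%E) ->
  exists2 g : R -> R, measurable_fun setT g &
    forall n, (\int[mu]_x ((g x - f n x) ^+ 2)%:E <= (c n)%:E)%E.
Proof.
move=> mf c0 fc.
have [phi [phik phiS phic]] := fast_subsequence c c0.
pose h k := f (phi k).
have hae : {ae mu, forall x, cvgn (h ^~ x)}.
  apply: ae_cvg_of_fast_L2 => [k|k]; first exact: mf.
  by apply: (le_trans (fc _ _ (phiS k))); rewrite lee_fin.
pose g x := fine (limn_esup (fun k => (h k x)%:E)).
have mg : measurable_fun setT g.
  apply: measurableT_comp => //.
  by apply: measurable_fun_limn_esup => k; apply/measurable_EFinP; exact: mf.
have gE x : cvgn (h ^~ x) -> h k x @[k --> \oo] --> g x.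
  move=> hx.
  have hl : (h k x)%:E @[k --> \oo] --> (limn (h ^~ x))%:E.
    exact: cvg_EFin (nearW _ _) hx.
  by rewrite /g (cvg_limn_einf_sup hl).2.
exists g => // n.
have mfk k : measurable_fun setT (fun x => ((h k x - f n x) ^+ 2)%:E).
  apply/measurable_EFinP; apply: measurable_funX; apply: measurable_funB => //.
  exact: mf.
apply: (@le_trans _ _ (\int[mu]_x limn_einf (fun k => ((h k x - f n x) ^+ 2)%:E))%E).
  apply: ae_ge0_le_integral => //.
  - by move=> x _; rewrite lee_fin sqr_ge0.
  - by apply/measurable_EFinP; apply: measurable_funX; exact: (measurable_funB mg (mf n)).
  - by move=> x _; apply: limn_einf_ge0 => k; rewrite lee_fin sqr_ge0.
  - exact: measurable_limn_einf mfk.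
  - apply: ae_imply hae => x /gE hx _.
    have hl : ((h k x - f n x) ^+ 2)%:E @[k --> \oo] --> ((g x - f n x) ^+ 2)%:E.
      apply: cvg_EFin; first exact: nearW.
      have cB : h k x - f n x @[k --> \oo] --> g x - f n x.
        by apply: cvgB => //; exact: cvg_cst.
      by rewrite expr2; under eq_fun do rewrite expr2; exact: cvgM.
    by rewrite (cvg_limn_einf_sup hl).1.
apply: (le_trans (fatou mu measurableT mfk _)).
  by move=> k x _; rewrite lee_fin sqr_ge0.
by apply: (@limn_einf_le _ _ n) => k nk; apply: fc; exact: leq_trans nk (phik k).
Qed.

End riesz_fischer.

(** * The Fourier transform on square-integrable functions *)

Section complex_L2.
Local Open Scope complex_scope.
Context {R : realType}.
Implicit Types (v : R -> R) (V W : R -> R[i]) (z : R[i]).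
Local Notation mu := (@lebesgue_measure R).
Local Notation Re := complex.Re.
Local Notation Im := complex.Im.

Lemma normc_sqr z : (Normc.normc z) ^+ 2 = Re z ^+ 2 + Im z ^+ 2.
Proof. by case: z => a b /=; rewrite sqr_sqrtr// addr_ge0 ?sqr_ge0. Qed.

Lemma ReB z z' : Re (z - z') = Re z - Re z'.
Proof. by case: z => a b; case: z' => c d. Qed.

Lemma ImB z z' : Im (z - z') = Im z - Im z'.
Proof. by case: z => a b; case: z' => c d. Qed.

Lemma in_L2P v : in_L2 v <->
  measurable_fun setT v /\ mu.-integrable setT (EFin \o (fun t => v t ^+ 2)).
Proof.
split=> [vL|[mv iv2]].
  split; last exact: Lfun2_integrable_sqr.
  by move: vL; rewrite /in_L2 inE => /andP[]; rewrite inE.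
rewrite /in_L2 inE; apply/andP; split; rewrite inE//=.
rewrite /finite_norm unlock /Lnorm; apply: poweR_lty.
have [_] := integrableP _ _ _ iv2; apply: le_lt_trans.
rewrite le_eqVlt; apply/orP; left; apply/eqP; apply: eq_integral => t _ /=.
by rewrite powR_mulrn// normrX.
Qed.

Lemma in_L2B (v1 v2 : R -> R) : in_L2 v1 -> in_L2 v2 -> in_L2 (v1 \- v2).
Proof.
move=> L1 L2.
have [m1 i1] := (in_L2P _).1 L1; have [m2 i2] := (in_L2P _).1 L2.
apply/in_L2P; split; first exact: measurable_funB.
have := integrable_sqrB v1 v2 1 m1 m2 i1 i2.
by apply: eq_integrable => // t _; rewrite /= mul1r.
Qed.

Definition cmeasurable V :=
  measurable_fun setT (fun w => Re (V w)) /\ measurable_fun setT (fun w => Im (V w)).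

(** A squared norm in the extended reals: it presupposes no integrability, and [cL2sqrB_le] takes
    the place of the triangle inequality without square roots. *)
Definition cL2sqr V : \bar R := (\int[mu]_w ((Normc.normc (V w)) ^+ 2)%:E)%E.

Lemma measurable_normc_sqr V : cmeasurable V ->
  measurable_fun setT (fun w => (Normc.normc (V w)) ^+ 2).
Proof.
move=> [mr mi].
rewrite (_ : (fun _ => _) = (fun w => Re (V w) ^+ 2 + Im (V w) ^+ 2)).
  by apply: measurable_funD; exact: measurable_funX.
by apply/funext => w; rewrite normc_sqr.
Qed.

Lemma cmeasurableB V W : cmeasurable V -> cmeasurable W ->
  cmeasurable (fun w => V w - W w).
Proof.
move=> [mr mi] [mr' mi']; split.
  rewrite (_ : (fun _ => _) = (fun w => Re (V w) - Re (W w))).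
    exact: measurable_funB.
  by apply/funext => w; rewrite ReB.
rewrite (_ : (fun _ => _) = (fun w => Im (V w) - Im (W w))).
  exact: measurable_funB.
by apply/funext => w; rewrite ImB.
Qed.

Lemma cL2sqr_ge0 V : (0 <= cL2sqr V)%E.
Proof. by apply: integral_ge0 => w _; rewrite lee_fin sqr_ge0. Qed.

Lemma cL2sqrE V : cmeasurable V ->
  cL2sqr V = (\int[mu]_w (Re (V w) ^+ 2)%:E + \int[mu]_w (Im (V w) ^+ 2)%:E)%E.
Proof.
move=> [mr mi]; rewrite -ge0_integralD//.
- by apply: eq_integral => w _; rewrite normc_sqr.
- by move=> w _; rewrite lee_fin sqr_ge0.
- by apply/measurable_EFinP; exact: measurable_funX.
- by move=> w _; rewrite lee_fin sqr_ge0.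
- by apply/measurable_EFinP; exact: measurable_funX.
Qed.

Lemma cmeasurable_in_cL2 V : in_cL2 V -> cmeasurable V.
Proof. by move=> [/in_L2P[mr _] /in_L2P[mi _]]. Qed.

Lemma in_cL2_cL2sqr V : in_cL2 V <-> cmeasurable V /\ (cL2sqr V < +oo)%E.
Proof.
split=> [cV|[mV]].
  have mV := cmeasurable_in_cL2 _ cV; split=> //; rewrite cL2sqrE//.
  move: cV => [/in_L2P[_ ir] /in_L2P[_ ii]].
  apply: lte_add_pinfty; first exact: (integrable_lty measurableT ir).
  exact: (integrable_lty measurableT ii).
rewrite cL2sqrE// => VI; case: mV => mr mi.
have r0 : (0 <= \int[mu]_w (Re (V w) ^+ 2)%:E)%E.
  by apply: integral_ge0 => w _; rewrite lee_fin sqr_ge0.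
have i0 : (0 <= \int[mu]_w (Im (V w) ^+ 2)%:E)%E.
  by apply: integral_ge0 => w _; rewrite lee_fin sqr_ge0.
split; apply/in_L2P; split=> //; apply/integrableP; split;
  try (by apply/measurable_EFinP; exact: measurable_funX).
  under eq_integral do rewrite /= ger0_norm ?sqr_ge0//.
  by apply: le_lt_trans VI; rewrite leeDl.
under eq_integral do rewrite /= ger0_norm ?sqr_ge0//.
by apply: le_lt_trans VI; rewrite leeDr.
Qed.

(** In each coordinate the two sides differ by [theta^-1 * (theta * a + b) ^+ 2]. The parameter is
    taken arbitrarily small to compare limits, 1 where only finiteness or convergence to 0 matters,
    and 2 in the energy estimate. *)
Lemma normc_sqrB_le (theta : R) z z' : 0 < theta ->
  (Normc.normc (z - z')) ^+ 2 <= (1 + theta) * (Normc.normc z) ^+ 2 +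
    (1 + theta^-1) * (Normc.normc z') ^+ 2.
Proof.
move=> t0; rewrite !normc_sqr ReB ImB.
have key (a b : R) : (a - b) ^+ 2 <= (1 + theta) * a ^+ 2 + (1 + theta^-1) * b ^+ 2.
  rewrite -subr_ge0.
  have -> : (1 + theta) * a ^+ 2 + (1 + theta^-1) * b ^+ 2 - (a - b) ^+ 2 =
      theta^-1 * (theta * a + b) ^+ 2 by field; rewrite gt_eqF.
  by rewrite mulr_ge0 ?sqr_ge0// invr_ge0 ltW.
have := key (Re z) (Re z'); have := key (Im z) (Im z'); lra.
Qed.

Lemma cL2sqrB_le (theta : R) V W : 0 < theta -> cmeasurable V -> cmeasurable W ->
  (cL2sqr (fun w => (V w - W w)%R) <= (1 + theta)%:E * cL2sqr V + (1 + theta^-1)%:E * cL2sqr W)%E.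
Proof.
move=> t0 mV mW.
have t1 : 0 <= 1 + theta by rewrite addr_ge0// ltW.
have t2 : 0 <= 1 + theta^-1 by rewrite addr_ge0// invr_ge0 ltW.
have nV := measurable_normc_sqr _ mV; have nW := measurable_normc_sqr _ mW.
rewrite /cL2sqr -!ge0_integralZl//; try (by apply/measurable_EFinP);
  try (by move=> w _; rewrite lee_fin sqr_ge0).
rewrite -ge0_integralD//.
- apply: ge0_le_integral => //.
  + by move=> w _; rewrite lee_fin sqr_ge0.
  + apply/measurable_EFinP; apply: measurable_normc_sqr; exact: cmeasurableB.
  + by apply: emeasurable_funD; apply: measurable_funeM; apply/measurable_EFinP.
  + by move=> w _; rewrite -!EFinM -EFinD lee_fin normc_sqrB_le.
- by move=> w _; rewrite -EFinM lee_fin mulr_ge0 ?sqr_ge0.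
- by apply: measurable_funeM; apply/measurable_EFinP.
- by move=> w _; rewrite -EFinM lee_fin mulr_ge0 ?sqr_ge0.
- by apply: measurable_funeM; apply/measurable_EFinP.
Qed.

Lemma cL2sqr_sym V W : cL2sqr (fun w => V w - W w) = cL2sqr (fun w => W w - V w).
Proof.
apply: eq_integral => w _; congr EFin; rewrite !normc_sqr !ReB !ImB.
by rewrite -(opprB (Re (W w))) -(opprB (Im (W w))) !sqrrN.
Qed.

Lemma cL2sqr0_ae V : cmeasurable V -> cL2sqr V = 0%E -> {ae mu, forall w, V w = 0}.
Proof.
move=> mV V0.
have : ae_eq mu setT (fun w => ((Normc.normc (V w)) ^+ 2)%:E) (cst 0%E).
  apply/ae_eq_integral_abs => //.
    by apply/measurable_EFinP; exact: measurable_normc_sqr.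
  rewrite -V0; apply: eq_integral => w _.
  by rewrite gee0_abs// lee_fin sqr_ge0.
apply: ae_imply => w /(_ I) [/eqP].
by rewrite sqrf_eq0 => /eqP /Normc.eq0_normc.
Qed.

(** For fixed [theta] the distance term, with its factor 1 + 1/theta, tends to 0. This leaves |W|^2
    <= (1 + theta) l and l <= (1 + theta) |W|^2, and [theta] is arbitrary. *)
Lemma cL2sqr_limit (V : nat -> R -> R[i]) W (l : R) :
  (forall n, cmeasurable (V n)) -> cmeasurable W ->
  cL2sqr (fun w => W w - V n w) @[n --> \oo] --> 0%E ->
  cL2sqr (V n) @[n --> \oo] --> l%:E ->
  cL2sqr W = l%:E.
Proof.
move=> mV mW dist cV.
have cvgT (theta a : R) (b : nat -> \bar R) : b n @[n --> \oo] --> a%:E ->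
    ((1 + theta)%:E * b n + (1 + theta^-1)%:E * cL2sqr (fun w => (W w - V n w)%R))%E
      @[n --> \oo] --> ((1 + theta) * a)%:E.
  move=> ba.
  rewrite -[X in _ --> X]adde0 EFinM -[X in _ --> (_ + X)%E](mule0 (1 + theta^-1)%:E).
  apply: cvgeD; first by rewrite mule0 fin_num_adde_defl.
    by apply: cvgeZl.
  by apply: cvgeZl.
have le1 theta : 0 < theta -> (cL2sqr W <= ((1 + theta) * l)%:E)%E.
  move=> t0; have cT := cvgT theta l _ cV.
  rewrite -(cvg_lim _ cT)//; apply: lime_ge; first by apply/cvg_ex; eexists; exact: cT.
  apply: nearW => n.
  have := cL2sqrB_le _ _ _ t0 (mV n) (cmeasurableB _ _ (mV n) mW).
  rewrite (cL2sqr_sym (V n) W); apply: le_trans.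
  rewrite le_eqVlt; apply/orP; left; apply/eqP; apply: eq_integral => w _.
  by rewrite opprB addrC subrK.
have le2 theta : 0 < theta -> (l%:E <= (1 + theta)%:E * cL2sqr W)%E.
  move=> t0.
  have Wfin : cL2sqr W \is a fin_num.
    by rewrite ge0_fin_numE ?cL2sqr_ge0// (le_lt_trans (le1 _ t0))// ltry.
  have cT := cvgT theta (fine (cL2sqr W)) (fun=> cL2sqr W) (ltac:(rewrite fineK//; exact: cvg_cst)).
  rewrite EFinM fineK// in cT.
  rewrite -(cvg_lim _ cT)// -(cvg_lim _ cV)//; apply: lee_lim.
  - by apply/cvg_ex; eexists; exact: cV.
  - by apply/cvg_ex; eexists; exact: cT.
  apply: nearW => n.
  have := cL2sqrB_le _ _ _ t0 mW (cmeasurableB _ _ mW (mV n)).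
  apply: le_trans.
  rewrite le_eqVlt; apply/orP; left; apply/eqP; apply: eq_integral => w _.
  by rewrite opprB addrC subrK.
have Wfin : cL2sqr W \is a fin_num.
  by rewrite ge0_fin_numE ?cL2sqr_ge0// (le_lt_trans (le1 _ ltr01))// ltry.
have W0 : 0 <= fine (cL2sqr W) by rewrite fine_ge0// cL2sqr_ge0.
move: le1 le2; rewrite -(fineK Wfin) => le1 le2.
have l0 : 0 <= l.
  have := le_trans W0 (le1 1 ltr01 : fine (cL2sqr W) <= (1 + 1) * l); lra.
congr EFin; apply/eqP; rewrite eq_le; apply/andP; split; apply/ler_addgt0Pr => e e0.
  (* Adding 1 to the denominator allows [l = 0] and still gives [theta * l <= e]. *)
  have t0 : 0 < e / (l + 1) by rewrite divr_gt0// ltr_wpDl.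
  have := le1 _ t0; rewrite lee_fin => /le_trans; apply.
  rewrite mulrDl mul1r lerD2l mulrAC ler_pdivrMr ?ltr_wpDl// ler_wpM2l ?(ltW e0)//.
  by rewrite lerDl.
have t0 : 0 < e / (fine (cL2sqr W) + 1) by rewrite divr_gt0// ltr_wpDl.
have := le2 _ t0; rewrite -EFinM lee_fin => /le_trans; apply.
rewrite mulrDl mul1r lerD2l mulrAC ler_pdivrMr ?ltr_wpDl// ler_wpM2l ?(ltW e0)//.
by rewrite lerDl.
Qed.

End complex_L2.

(** * Truncated Fourier integrals *)

Section fourier_L2.
Local Open Scope complex_scope.
Context {R : realType}.
Implicit Types (u v : R -> R) (V W : R -> R[i]) (z : R[i]).
Local Notation mu := (@lebesgue_measure R).
Local Notation Re := complex.Re.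
Local Notation Im := complex.Im.

Definition cutoff v (n : nat) : R -> R := v \_ `[- n%:R, n%:R].

Lemma cutoff_in v n t : t \in `[- n%:R, n%:R] -> cutoff v n t = v t.
Proof. by move=> tn; rewrite /cutoff patchE mem_setE tn. Qed.

Lemma cutoff_out v n t : t \notin `[- n%:R, n%:R] -> cutoff v n t = 0.
Proof. by move=> tn; rewrite /cutoff patchE mem_setE (negbTE tn). Qed.

Lemma itv_nat_sub (n m : nat) (t : R) : (n <= m)%N ->
  t \in `[- n%:R, n%:R] -> t \in `[- m%:R, m%:R].
Proof.
move=> nm; rewrite !in_itv/= => /andP[a b].
have nm' : n%:R <= m%:R :> R by rewrite ler_nat.
by rewrite (le_trans _ a) ?lerN2// (le_trans b).
Qed.

Lemma measurable_cutoff v n : measurable_fun setT v -> measurable_fun setT (cutoff v n).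
Proof.
move=> mv; apply/(measurable_restrictT _ _).1 => //.
exact: measurable_funTS.
Qed.

Lemma sqr_cutoffB_le v n m t : (n <= m)%N ->
  (cutoff v m t - cutoff v n t) ^+ 2 <= (v t - cutoff v n t) ^+ 2.
Proof.
move=> nm; have [tn|tn] := boolP (t \in `[- n%:R, n%:R]).
  by rewrite !cutoff_in ?(itv_nat_sub _ _ _ nm tn).
rewrite (cutoff_out _ _ _ tn) !subr0.
have [tm|tm] := boolP (t \in `[- m%:R, m%:R]); first by rewrite cutoff_in.
by rewrite cutoff_out// expr0n sqr_ge0.
Qed.

Lemma sqr_subr_cutoff_le v n t : (v t - cutoff v n t) ^+ 2 <= v t ^+ 2.
Proof.
have [tn|tn] := boolP (t \in `[- n%:R, n%:R]).
  by rewrite cutoff_in// subrr expr0n sqr_ge0.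
by rewrite cutoff_out// subr0.
Qed.

Lemma sqr_cutoff_le v n t : (cutoff v n t) ^+ 2 <= v t ^+ 2.
Proof.
have [tn|tn] := boolP (t \in `[- n%:R, n%:R]); first by rewrite cutoff_in.
by rewrite cutoff_out// expr0n sqr_ge0.
Qed.

Lemma integrable_sqr_le u v : measurable_fun setT u ->
  mu.-integrable setT (EFin \o (fun t => v t ^+ 2)) ->
  (forall t, u t ^+ 2 <= v t ^+ 2) ->
  mu.-integrable setT (EFin \o (fun t => u t ^+ 2)).
Proof.
move=> mu_ iv uv; apply: le_integrable iv => //.
  by apply/measurable_EFinP; exact: measurable_funX.
by move=> t _; rewrite /= lee_fin !ger0_norm ?sqr_ge0.
Qed.

Lemma integrable_sqr_cutoff v n : in_L2 v ->
  mu.-integrable setT (EFin \o (fun t => cutoff v n t ^+ 2)).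
Proof.
move=> /in_L2P[mv iv]; apply: integrable_sqr_le iv _; first exact: measurable_cutoff.
by move=> t; exact: sqr_cutoff_le.
Qed.

Lemma integrable_cutoff v n : in_L2 v -> mu.-integrable setT (EFin \o cutoff v n).
Proof.
move=> vL; have [mv iv] := (in_L2P _).1 vL.
apply: (integrable_of_sqr n%:R).
- exact: measurable_cutoff.
- exact: integrable_sqr_cutoff.
- by move=> s; exact: cutoff_out.
Qed.

Lemma cvg_cutoff_tail v : in_L2 v ->
  \int[mu]_t ((v t - cutoff v n t) ^+ 2) @[n --> \oo] --> (0 : R).
Proof.
move=> /in_L2P[mv iv].
have mF n : measurable_fun setT (fun t => (v t - cutoff v n t) ^+ 2).
  by apply: measurable_funX; apply: measurable_funB => //; exact: measurable_cutoff.
have [||||| _ _ cvI] := @dominated_convergence _ _ R mu setT measurableT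
  (fun n t => ((v t - cutoff v n t) ^+ 2)%:E) (cst 0%E) (EFin \o (fun t => v t ^+ 2)).
- by move=> n; apply/measurable_EFinP; exact: mF.
- exact: measurable_cst.
- apply: aeW => t _; apply/fine_cvgP; split; first exact: nearW.
  apply: cvg_near_cst; near=> n; rewrite /= cutoff_in ?subrr ?expr0n//.
  rewrite in_itv/= -ler_norml; near: n; exact: nbhs_infty_ger.
- by [].
- by apply: aeW => t n _; rewrite /= lee_fin ger0_norm ?sqr_ge0// sqr_subr_cutoff_le.
rewrite integral0 in cvI; exact: (fine_cvg cvI).
Unshelve. all: by end_near. Qed.

Lemma fourier_truncE v n w : in_L2 v ->
  fourier_trunc v n w =
  ((Num.sqrt (2 * pi))^-1 * cos_transform (cutoff v n) w) +i*
  (- ((Num.sqrt (2 * pi))^-1 * sin_transform (cutoff v n) w)).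
Proof.
move=> vL; have iv := integrable_cutoff v n vL.
rewrite /fourier_trunc /cintegral.
have -> : \int[mu]_(t in `[- n%:R, n%:R]) Re ((v t)%:C * cexp (0 -i* (w * t))) =
    cos_transform (cutoff v n) w.
  rewrite Rintegral_mkcond; apply: eq_Rintegral => t _.
  rewrite patchE /cutoff patchE; case: ifPn => _; last by rewrite mul0r.
  by rewrite /cexp /= expR0 cosN mul0r subr0 mul1r.
have -> : \int[mu]_(t in `[- n%:R, n%:R]) Im ((v t)%:C * cexp (0 -i* (w * t))) =
    - sin_transform (cutoff v n) w.
  rewrite Rintegral_mkcond -[RHS]mulN1r -RintegralZl//; last exact: integrable_mul_sin.
  apply: eq_Rintegral => t _.
  rewrite patchE /cutoff patchE; case: ifPn => _; last by rewrite mul0r mulr0.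
  by rewrite /cexp /= expR0 sinN mul0r addr0 mul1r mulrN mulN1r.
by apply/eqP; rewrite eq_complex /= !mul0r subr0 addr0 mulrN !eqxx.
Qed.

Lemma cmeasurable_fourier_trunc v n : in_L2 v -> cmeasurable (fourier_trunc v n).
Proof.
move=> vL; have iv := integrable_cutoff v n vL.
split; under eq_fun do rewrite fourier_truncE//=.
  by apply: measurable_funM => //; exact: measurable_cos_transform.
apply: measurable_funN; apply: measurable_funM => //.
exact: measurable_sin_transform.
Qed.

(* [k] is 0 or 1: this covers the truncated transforms and their differences. *)
Lemma fourier_trunc_plancherel v n m (k : R) : in_L2 v -> (n <= m)%N ->
  cL2sqr (fun w => fourier_trunc v m w - k%:C * fourier_trunc v n w) =
  (\int[mu]_t ((cutoff v m t - k * cutoff v n t) ^+ 2))%:E.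
Proof.
move=> vL nm.
have [mv iv2] := (in_L2P _).1 vL.
have ivn := integrable_cutoff v n vL; have ivm := integrable_cutoff v m vL.
pose d t := cutoff v m t - k * cutoff v n t.
have md : measurable_fun setT d.
  apply: measurable_funB; first exact: measurable_cutoff.
  by apply: measurable_funM => //; exact: measurable_cutoff.
have id2 : mu.-integrable setT (EFin \o (fun t => d t ^+ 2)).
  by apply: integrable_sqrB; [exact: measurable_cutoff|exact: measurable_cutoff|
    exact: integrable_sqr_cutoff|exact: integrable_sqr_cutoff].
(* [compact_plancherel] asks for an open interval of positive radius. Passing from [m] to [m.+1]
   puts the closed interval inside an open one and covers [m = 0]. *)
have supp t : t \notin `]- (m.+1%:R : R), m.+1%:R[ -> d t = 0.
  move=> tm; rewrite /d.
  have tm' : t \notin `[- m%:R, m%:R].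
    apply: contra tm; rewrite !in_itv/= => /andP[a b].
    have lt : m%:R < m.+1%:R :> R by rewrite ltr_nat.
    by rewrite (lt_le_trans _ a) ?ltrN2// (le_lt_trans b).
  have tn' : t \notin `[- n%:R, n%:R] by apply: contra tm'; exact: itv_nat_sub.
  by rewrite !cutoff_out// mulr0 subr0.
have m0 : 0 < m.+1%:R :> R by [].
have P := compact_plancherel m.+1%:R d m0 md id2 supp.
have pi0 : 0 < 2 * pi :> R by rewrite mulr_gt0// pi_gt0.
have supp' t : t \notin `[- (m.+1%:R : R), m.+1%:R] -> d t = 0.
  by move=> tm; apply: supp; apply: contra tm; exact: subset_itv_oo_cc.
have [ip _] := integrable_power_spectrum m.+1%:R d m0 md id2 supp'.
rewrite /cL2sqr.
under eq_integral => w _.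
  rewrite !fourier_truncE// normc_sqr.
  have -> : Re ((((Num.sqrt (2 * pi))^-1 * cos_transform (cutoff v m) w) +i*
       (- ((Num.sqrt (2 * pi))^-1 * sin_transform (cutoff v m) w))) -
     k%:C * (((Num.sqrt (2 * pi))^-1 * cos_transform (cutoff v n) w) +i*
       (- ((Num.sqrt (2 * pi))^-1 * sin_transform (cutoff v n) w)))) =
     (Num.sqrt (2 * pi))^-1 * cos_transform d w.
    by rewrite /d cos_transformB//=; ring.
  have -> : Im ((((Num.sqrt (2 * pi))^-1 * cos_transform (cutoff v m) w) +i*
       (- ((Num.sqrt (2 * pi))^-1 * sin_transform (cutoff v m) w))) -
     k%:C * (((Num.sqrt (2 * pi))^-1 * cos_transform (cutoff v n) w) +i*
       (- ((Num.sqrt (2 * pi))^-1 * sin_transform (cutoff v n) w)))) =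
     - ((Num.sqrt (2 * pi))^-1 * sin_transform d w).
    by rewrite /d sin_transformB//=; ring.
  rewrite sqrrN !exprMn -mulrDr exprVn sqr_sqrtr ?(ltW pi0)// -/(power_spectrum d w) EFinM.
  over.
rewrite integralZl// /Rintegral -(fineK (integrable_fin_num _ ip))//.
have -> : fine (\int[mu]_w (EFin \o power_spectrum d) w) = \int[mu]_w power_spectrum d w by [].
by rewrite P -EFinM mulKf// gt_eqF.
Qed.

End fourier_L2.

(** Used with truncated transforms for [t1] and [t2]: the defect of additivity becomes a combination
    of three truncation errors. *)
Lemma subrACA_diff (M : zmodType) (a b c t1 t2 : M) :
  a - (b - c) = a - (t1 - t2) - ((b - t1) - (c - t2)).
Proof.
have -> : (b - t1) - (c - t2) = (b - c) - (t1 - t2).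
  by rewrite !opprB addrACA [RHS]addrACA (addrC (- c)).
by rewrite (opprB (b - c)) addrA subrK.
Qed.

(** * Existence, isometry and additivity of the transform on L^2 *)

Section plancherel.
Local Open Scope complex_scope.
Context {R : realType}.
Implicit Types (u v : R -> R) (V W : R -> R[i]) (z : R[i]).
Local Notation mu := (@lebesgue_measure R).
Local Notation Re := complex.Re.
Local Notation Im := complex.Im.

Lemma fourier_trunc_norm v n : in_L2 v ->
  cL2sqr (fourier_trunc v n) = (\int[mu]_t (cutoff v n t ^+ 2))%:E.
Proof.
move=> vL; have := fourier_trunc_plancherel v n n 0 vL (leqnn n).
under eq_Rintegral do rewrite mul0r subr0.
by move<-; apply: eq_integral => w _; rewrite mul0r subr0.
Qed.

(** The bound is a tail independent of [m], the form in which [riesz_fischer] takes its Cauchy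
    hypothesis. *)
Lemma fourier_trunc_cauchy v n m : in_L2 v -> (n <= m)%N ->
  (cL2sqr (fun w => (fourier_trunc v m w - fourier_trunc v n w)%R) <=
  (\int[mu]_t ((v t - cutoff v n t) ^+ 2)%R)%:E)%E.
Proof.
move=> vL nm; have [mv iv] := (in_L2P _).1 vL.
have := fourier_trunc_plancherel v n m 1 vL nm.
under eq_Rintegral do rewrite mul1r.
have -> : cL2sqr (fun w => (fourier_trunc v m w - 1%:C * fourier_trunc v n w)) =
  cL2sqr (fun w => (fourier_trunc v m w - fourier_trunc v n w)).
  by apply: eq_integral => w _; rewrite mul1r.
move=> ->; rewrite lee_fin.
have mc k : measurable_fun setT (cutoff v k) by exact: measurable_cutoff.
have i1 : mu.-integrable setT (EFin \o (fun t => (v t - cutoff v n t) ^+ 2)).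
  apply: integrable_sqr_le iv _; first exact: measurable_funB.
  by move=> t; exact: sqr_subr_cutoff_le.
apply: le_Rintegral => //.
  apply: integrable_sqr_le i1 _; first exact: measurable_funB.
  by move=> t; exact: sqr_cutoffB_le.
by move=> t _; exact: sqr_cutoffB_le.
Qed.

(** Riesz-Fischer is applied to the real and imaginary parts separately; both converge at the rate
    [c n], so the squared distance to the truncations is at most [c n + c n]. *)
Lemma fourier_exists v : in_L2 v -> exists V, is_fourier v V.
Proof.
move=> vL.
have c0 := cvg_cutoff_tail v vL.
have mT n := cmeasurable_fourier_trunc v n vL.
have bound n m : (n <= m)%N -> _ := fourier_trunc_cauchy v n m vL.
pose T n w := fourier_trunc v n w.
have [|n m nm|a ma aI] := @riesz_fischer R (fun n w => Re (T n w)) _ _ c0.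
- by move=> n; exact: (mT n).1.
- apply: le_trans (bound n m nm).
  rewrite cL2sqrE; last exact: cmeasurableB.
  under eq_integral do rewrite -ReB.
  by rewrite leeDl// integral_ge0// => w _; rewrite lee_fin sqr_ge0.
have [|n m nm|b mb bI] := @riesz_fischer R (fun n w => Im (T n w)) _ _ c0.
- by move=> n; exact: (mT n).2.
- apply: le_trans (bound n m nm).
  rewrite cL2sqrE; last exact: cmeasurableB.
  under eq_integral do rewrite -ImB.
  by rewrite leeDr// integral_ge0// => w _; rewrite lee_fin sqr_ge0.
pose V w := a w +i* b w.
have mV : cmeasurable V by split.
pose c n := \int[mu]_t ((v t - cutoff v n t) ^+ 2).
have dist n : (cL2sqr (fun w => (V w - T n w)%R) <= (c n + c n)%:E)%E.
  rewrite cL2sqrE; last exact: cmeasurableB.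
  rewrite EFinD; apply: leeD.
    by under eq_integral do rewrite ReB; exact: aI.
  by under eq_integral do rewrite ImB; exact: bI.
exists V; split.
  apply/in_cL2_cL2sqr; split=> //.
  have -> : cL2sqr V = cL2sqr (fun w => (V w - T 0%N w) - (- T 0%N w)).
    by apply: eq_integral => w _; rewrite opprK subrK.
  have mN : cmeasurable (fun w => - T 0%N w).
    have [m1 m2] := mT 0%N; split.
      rewrite (_ : (fun _ => _) = (fun w => - Re (T 0%N w))); first exact: measurable_funN.
      by apply/funext => w; rewrite /T; case: fourier_trunc.
    rewrite (_ : (fun _ => _) = (fun w => - Im (T 0%N w))); first exact: measurable_funN.
    by apply/funext => w; rewrite /T; case: fourier_trunc.
  apply: (le_lt_trans (cL2sqrB_le 1 _ _ ltr01 (cmeasurableB _ _ mV (mT 0%N)) mN)).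
  have -> : cL2sqr (fun w => - T 0%N w) = cL2sqr (fourier_trunc v 0).
    apply: eq_integral => w _; congr EFin; rewrite !normc_sqr /T.
    by case: fourier_trunc => x y /=; rewrite !sqrrN.
  rewrite fourier_trunc_norm//; apply: lte_add_pinfty; last exact: ltry.
  apply: lte_mul_pinfty => //.
  exact: le_lt_trans (dist 0%N) (ltry _).
have cc : (c n + c n)%:E @[n --> \oo] --> 0%E.
  apply: cvg_EFin; first exact: nearW.
  by rewrite -[X in _ --> X](addr0 (0 : R)); exact: cvgD.
apply: (squeeze_cvge _ (cvg_cst 0%E) cc).
by apply: nearW => n; rewrite dist andbT; exact: cL2sqr_ge0.
Qed.

(** Existence ensures that [xget] returns a genuine transform and not its default value 0. *)
Lemma fourierP v : in_L2 v -> is_fourier v (fourier v).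
Proof.
move=> vL; have [V fV] := fourier_exists v vL.
by rewrite /fourier; apply: (@xgetPex _ (fun=> 0) [set V | is_fourier v V]); exists V.
Qed.

Lemma cmeasurable_fourier v : in_L2 v -> cmeasurable (fourier v).
Proof. by move=> /fourierP[/cmeasurable_in_cL2]. Qed.

Lemma plancherel v : in_L2 v ->
  cL2sqr (fourier v) = (\int[mu]_t (v t ^+ 2))%:E.
Proof.
move=> vL; have [mv iv] := (in_L2P _).1 vL.
have [_ fv] := fourierP v vL.
apply: (cL2sqr_limit (fourier_trunc v)).
- by move=> n; exact: cmeasurable_fourier_trunc.
- exact: cmeasurable_fourier.
- exact: fv.
under eq_fun do rewrite fourier_trunc_norm//.
apply: cvg_EFin; first exact: nearW.
(* The cutoff and the remainder have disjoint supports, so their squares add up to [v t ^+ 2]. *)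
have E n : \int[mu]_t (cutoff v n t ^+ 2) =
    \int[mu]_t (v t ^+ 2) - \int[mu]_t ((v t - cutoff v n t) ^+ 2).
  rewrite -RintegralB//.
    apply: eq_Rintegral => t _.
    have [tn|tn] := boolP (t \in `[- n%:R, n%:R]).
      by rewrite cutoff_in// subrr expr0n subr0.
    by rewrite cutoff_out// subr0 subrr expr0n.
  apply: integrable_sqr_le iv _.
    by apply: measurable_funB => //; exact: measurable_cutoff.
  by move=> t; exact: sqr_subr_cutoff_le.
have H : \int[mu]_t (v t ^+ 2) - \int[mu]_t ((v t - cutoff v n t) ^+ 2) @[n --> \oo]
    --> \int[mu]_t (v t ^+ 2) - 0.
  by apply: cvgB; [exact: cvg_cst|exact: cvg_cutoff_tail].
rewrite subr0 in H.
by apply: cvg_trans H; rewrite /comp/=; under eq_fun do rewrite E.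
Qed.

(** The representatives are chosen independently for the three functions, so equality can hold only
    almost everywhere. Truncated integrals are additive at every frequency; in the limit the defect
    has norm 0. *)
Lemma fourierB v1 v2 : in_L2 v1 -> in_L2 v2 ->
  {ae mu, forall w, fourier (v1 \- v2) w = fourier v1 w - fourier v2 w}.
Proof.
move=> L1 L2.
have L12 := in_L2B _ _ L1 L2.
have [_ f1] := fourierP _ L1; have [_ f2] := fourierP _ L2.
have [_ f12] := fourierP _ L12.
have M1 := cmeasurable_fourier _ L1; have M2 := cmeasurable_fourier _ L2.
have M12 := cmeasurable_fourier _ L12.
have MM := cmeasurableB _ _ M1 M2.
have mD := cmeasurableB _ _ M12 MM.
have TB n w : fourier_trunc (v1 \- v2) n w = fourier_trunc v1 n w - fourier_trunc v2 n w.
  rewrite !fourier_truncE//.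
  have -> : cutoff (v1 \- v2) n = (fun t => cutoff v1 n t - 1 * cutoff v2 n t).
    apply/funext => t; rewrite mul1r.
    have [tn|tn] := boolP (t \in `[- n%:R, n%:R]); first by rewrite !cutoff_in.
    by rewrite !cutoff_out// subrr.
  have c1 := integrable_cutoff v1 n L1; have c2 := integrable_cutoff v2 n L2.
  rewrite cos_transformB// sin_transformB// !mul1r.
  by apply/eqP; rewrite eq_complex /=; apply/andP; split; apply/eqP; ring.
have TE n w : fourier (v1 \- v2) w - (fourier v1 w - fourier v2 w) =
    (fourier (v1 \- v2) w - fourier_trunc (v1 \- v2) n w) -
    ((fourier v1 w - fourier_trunc v1 n w) - (fourier v2 w - fourier_trunc v2 n w)).
  by rewrite TB; exact: subrACA_diff.
have Z : cL2sqr (fun w => fourier (v1 \- v2) w - (fourier v1 w - fourier v2 w)) = 0%E.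
  apply/eqP; rewrite eq_le cL2sqr_ge0 andbT.
  pose a n := cL2sqr (fun w => (fourier (v1 \- v2) w - fourier_trunc (v1 \- v2) n w)%R).
  pose b n := cL2sqr (fun w => (fourier v1 w - fourier_trunc v1 n w)%R).
  pose c n := cL2sqr (fun w => (fourier v2 w - fourier_trunc v2 n w)%R).
  have bd n : (cL2sqr (fun w => (fourier (v1 \- v2) w - (fourier v1 w - fourier v2 w))%R) <=
      2%:E * a n + 2%:E * (2%:E * b n + 2%:E * c n))%E.
    have T1 := cmeasurable_fourier_trunc v1 n L1.
    have T2 := cmeasurable_fourier_trunc v2 n L2.
    have T12 := cmeasurable_fourier_trunc _ n L12.
    have D1 := cmeasurableB _ _ M1 T1. have D2 := cmeasurableB _ _ M2 T2.
    have D12 := cmeasurableB _ _ M12 T12.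
    have D := cmeasurableB _ _ D1 D2.
    have e2 : (1 + 1 = 2 :> R) by [].
    have := cL2sqrB_le 1 _ _ ltr01 D12 D; rewrite invr1 e2.
    have := cL2sqrB_le 1 _ _ ltr01 D1 D2; rewrite invr1 e2.
    move=> h1 h2; apply: (le_trans (le_trans _ h2)).
      rewrite le_eqVlt; apply/orP; left; apply/eqP; apply: (congr1 cL2sqr).
      by apply/funext => w; exact: (TE n w).
    by rewrite leeD2l// lee_wpmul2l.
  have cv : (2%:E * a n + 2%:E * (2%:E * b n + 2%:E * c n))%E @[n --> \oo] --> 0%E.
    have e0 : (0 = 2%:E * 0 + 2%:E * (2%:E * 0 + 2%:E * 0) :> \bar R)%E.
      by rewrite !(mule0, adde0).
    have two : (2%:E : \bar R) \is a fin_num by [].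
    have ca : (2%:E * a n)%E @[n --> \oo] --> (2%:E * 0)%E := cvgeZl two f12.
    have cb : (2%:E * b n)%E @[n --> \oo] --> (2%:E * 0)%E := cvgeZl two f1.
    have cc : (2%:E * c n)%E @[n --> \oo] --> (2%:E * 0)%E := cvgeZl two f2.
    rewrite [X in _ --> X]e0; apply: cvgeD; first by rewrite !(mule0, adde0).
      exact: ca.
    apply: (cvgeZl two); apply: cvgeD; first by rewrite !mule0.
      exact: cb.
    exact: cc.
  rewrite -(cvg_lim _ cv)//; apply: lime_ge; first by apply/cvg_ex; eexists; exact: cv.
  exact: nearW.
have := cL2sqr0_ae _ mD Z.
by apply: ae_imply => w /eqP; rewrite subr_eq0 => /eqP.
Qed.

End plancherel.

(** * The hyperbolic kernels *)

Section hyperbolic_kernels.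
Local Open Scope complex_scope.
Context {R : realType}.
Implicit Types (a b x w alpha eps : R) (z : R[i]).
Local Notation Re := complex.Re.
Local Notation Im := complex.Im.

Lemma half_complex z : z / 2%:R = (Re z / 2) +i* (Im z / 2).
Proof.
have e2 : (2%:R : R[i]) = (2 : R)%:C by rewrite -raddfMn.
have -> : (2%:R : R[i])^-1 = (2^-1 : R)%:C by rewrite e2 fmorphV.
by case: z => a b; apply/eqP; rewrite eq_complex /= !mulr0 subr0 add0r !eqxx.
Qed.

Lemma ccoshE a b : ccosh (a +i* b) =
  ((expR a + expR (- a)) / 2 * cos b) +i* ((expR a - expR (- a)) / 2 * sin b).
Proof.
rewrite /ccosh half_complex /cexp /= cosN sinN.
by apply/eqP; rewrite eq_complex /=; apply/andP; split; apply/eqP; ring.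
Qed.

Lemma csinhE a b : csinh (a +i* b) =
  ((expR a - expR (- a)) / 2 * cos b) +i* ((expR a + expR (- a)) / 2 * sin b).
Proof.
rewrite /csinh half_complex /cexp /= cosN sinN.
by apply/eqP; rewrite eq_complex /=; apply/andP; split; apply/eqP; ring.
Qed.

Lemma sqr_sin_le b : sin b ^+ 2 <= b ^+ 2.
Proof.
wlog b0 : b / 0 <= b => [H|].
  have [/H//|b0] := leP 0 b.
  by have := H (- b); rewrite sinN !sqrrN oppr_ge0 => /(_ (ltW b0)).
have [c _] := @MVT_segment R sin cos 0 b b0 (fun x _ => is_derive_sin x)
  (continuous_subspaceT (@continuous_sin R)).
rewrite sin0 !subr0 => ->; rewrite exprMn ler_piMl ?sqr_ge0//.
Qed.

(** |cosh(a + i b)|^2 = cosh(a)^2 cos(b)^2 + sinh(a)^2 sin(b)^2, and both hyperbolic squares are at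
    most exp(2 a). *)
Lemma normc_sqr_ccosh_le a b : 0 <= a ->
  (Normc.normc (ccosh (a +i* b))) ^+ 2 <= expR (2 * a).
Proof.
move=> a0; rewrite ccoshE normc_sqr /=.
have e0 := expR_gt0 a; have e1 := expR_gt0 (- a).
have ea : expR (- a) <= expR a by rewrite ler_expR; lra.
have -> : expR (2 * a) = expR a ^+ 2 by rewrite expRM_natl.
rewrite [X in X + _]exprMn [X in _ + X]exprMn; have := cos2Dsin2 b.
move: (cos b ^+ 2) (sqr_ge0 (cos b)) (sin b ^+ 2) (sqr_ge0 (sin b)).
move=> C C0 S S0 CS.
have h1 : ((expR a - expR (- a)) / 2) ^+ 2 <= expR a ^+ 2.
  by rewrite lerXn2r ?nnegrE//; lra.
have h2 : ((expR a + expR (- a)) / 2) ^+ 2 <= expR a ^+ 2.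
  by rewrite lerXn2r ?nnegrE//; lra.
move: (((expR a - expR (- a)) / 2) ^+ 2) (((expR a + expR (- a)) / 2) ^+ 2) (expR a ^+ 2) h1 h2.
move=> p q r h1 h2.
rewrite -[leRHS]mulr1 -CS mulrDr.
have := ler_wpM2r C0 h2; have := ler_wpM2r S0 h1; lra.
Qed.

(** |sinh(a + i b)|^2 = sinh(a)^2 + sin(b)^2, where sinh(a) <= a exp(a) follows from 1 - 2 a <=
    exp(-2 a). The factor a^2 + b^2 is kept in order to absorb the division by k in
    [normc_sinhk_le]. *)
Lemma normc_sqr_csinh_le a b : 0 <= a ->
  (Normc.normc (csinh (a +i* b))) ^+ 2 <= (a ^+ 2 + b ^+ 2) * expR (2 * a).
Proof.
move=> a0; rewrite csinhE normc_sqr /= [X in X + _]exprMn [X in _ + X]exprMn.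
have E1 : expR a * expR (- a) = 1 by rewrite -expRD subrr expR0.
have -> : expR (2 * a) = expR a ^+ 2 by rewrite expRM_natl.
have e1 : 1 <= expR a by rewrite -expR0 ler_expR.
have sh : (expR a - expR (- a)) / 2 <= a * expR a.
  have := expR_ge1Dx (- (2 * a)).
  have -> : expR (- (2 * a)) = expR (- a) ^+ 2 by rewrite -mulrN expRM_natl.
  have e0 := expR_gt0 a; have e0' := expR_gt0 (- a).
  move=> h; have : expR a * (1 + - (2 * a)) <= expR (- a).
    have -> : expR (- a) = expR a * expR (- a) ^+ 2 by rewrite expr2 mulrA E1 mul1r.
    by rewrite ler_wpM2l// ltW.
  lra.
have sh0 : 0 <= (expR a - expR (- a)) / 2.
  have : expR (- a) <= expR a by rewrite ler_expR; lra.
  lra.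
have -> : ((expR a - expR (- a)) / 2) ^+ 2 * cos b ^+ 2 +
    ((expR a + expR (- a)) / 2) ^+ 2 * sin b ^+ 2 =
    ((expR a - expR (- a)) / 2) ^+ 2 + sin b ^+ 2.
  have -> : cos b ^+ 2 = 1 - sin b ^+ 2 by rewrite -(cos2Dsin2 b) addrK.
  transitivity (((expR a - expR (- a)) / 2) ^+ 2 + (expR a * expR (- a)) * sin b ^+ 2).
    by field.
  by rewrite E1 mul1r.
rewrite [leRHS]mulrDl lerD//.
  by rewrite -exprMn lerXn2r ?nnegrE// mulr_ge0// ltW// expR_gt0.
rewrite (le_trans (sqr_sin_le b))// ler_peMr ?sqr_ge0//.
by rewrite exprn_ege1.
Qed.

Lemma cos_alpha_gt0 alpha : 0 < alpha < 1 -> 0 < cos (alpha * pi / 4).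
Proof.
move=> /andP[a0 a1]; apply: cos_gt0_pihalf.
have p0 : 0 < pi :> R := pi_gt0 R.
have : alpha * pi < pi by rewrite gtr_pMl.
have : 0 < alpha * pi by rewrite mulr_gt0.
by move: (alpha * pi) (pi : R) p0 => q p; lra.
Qed.

Lemma Re_kroot alpha w : Re (kroot alpha w) = `|w| `^ (alpha / 2) * cos (alpha * pi / 4).
Proof. by rewrite /kroot /= mul0r subr0. Qed.

Lemma kroot_mulE alpha w x : kroot alpha w * x%:C =
  (x * Re (kroot alpha w)) +i* (x * Im (kroot alpha w)).
Proof.
case: (kroot alpha w) => a b.
by apply/eqP; rewrite eq_complex /= !mulr0 subr0 add0r !(mulrC x) !eqxx.
Qed.

Lemma Re_kroot_ge0 alpha w : 0 < alpha < 1 -> 0 <= Re (kroot alpha w).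
Proof.
by move=> a01; rewrite Re_kroot mulr_ge0 ?powR_ge0// ltW// cos_alpha_gt0.
Qed.

Lemma normc_ccosh_kroot_le alpha w x : 0 < alpha < 1 -> 0 <= x ->
  (Normc.normc (ccosh (kroot alpha w * x%:C))) ^+ 2 <= expR (2 * (x * Re (kroot alpha w))).
Proof.
move=> a01 x0; rewrite kroot_mulE; apply: normc_sqr_ccosh_le.
by rewrite mulr_ge0// Re_kroot_ge0.
Qed.

Lemma kroot_neq0 alpha w : 0 < alpha < 1 -> w != 0 -> 0 < Re (kroot alpha w).
Proof.
by move=> a01 w0; rewrite Re_kroot mulr_gt0 ?cos_alpha_gt0// powR_gt0// normr_gt0.
Qed.

(** The bound for sinh(k x) carries |k x|^2; dividing by |k|^2 leaves x^2 <= 1, so the estimate is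
    uniform as [w] tends to 0. *)
Lemma normc_sinhk_le alpha w x : 0 < alpha < 1 -> 0 <= x <= 1 ->
  (Normc.normc (sinhk alpha w x)) ^+ 2 <= expR (2 * (x * Re (kroot alpha w))).
Proof.
move=> a01 /andP[x0 x1].
have x2 : x ^+ 2 <= 1 by rewrite exprn_ile1.
have xk0 : 0 <= x * Re (kroot alpha w) by rewrite mulr_ge0// Re_kroot_ge0.
rewrite /sinhk; case: ifPn => [_|w0].
  rewrite normc_sqr /= expr0n addr0 (le_trans x2)// -[leLHS]expR0 ler_expR.
  by rewrite mulr_ge0.
have k0 := kroot_neq0 _ _ a01 w0.
have n0 : 0 < (Normc.normc (kroot alpha w)) ^+ 2.
  by rewrite normc_sqr ltr_pwDl ?sqr_ge0// exprn_gt0.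
rewrite Normc.normcM Normc.normcV exprMn exprVn ler_pdivrMr// kroot_mulE.
apply: (le_trans (normc_sqr_csinh_le _ _ xk0)).
rewrite mulrC ler_wpM2l ?expR_ge0//.
rewrite normc_sqr !exprMn -mulrDr ler_piMl// addr_ge0 ?sqr_ge0//.
Qed.

Lemma powRN_inv eps (r : R) : 0 < eps -> eps `^ (- r) = eps^-1 `^ r.
Proof.
move=> e0.
have h : eps `^ r * eps^-1 `^ r = 1.
  by rewrite -powRM ?invr_ge0 ?(ltW e0)// mulfV ?gt_eqF// powR1.
by rewrite powRN -[LHS]mulr1 -h mulKf// gt_eqF// powR_gt0.
Qed.

Lemma Re_kroot_le alpha eps w : 0 < alpha < 1 -> 0 < eps -> `|w| <= eps^-1 ->
  Re (kroot alpha w) <= eps `^ (- (alpha / 2)) * cos (alpha * pi / 4).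
Proof.
move=> a01 e0 we; rewrite Re_kroot ler_wpM2r ?(ltW (cos_alpha_gt0 _ a01))//.
have [a0 _] := andP a01.
by rewrite powRN_inv// ge0_ler_powR// ?nnegrE// ?invr_ge0 ?(ltW e0)// divr_ge0// ltW.
Qed.

Lemma Re_kroot_ge alpha eps w : 0 < alpha < 1 -> 0 < eps -> eps^-1 <= `|w| ->
  eps `^ (- (alpha / 2)) * cos (alpha * pi / 4) <= Re (kroot alpha w).
Proof.
move=> a01 e0 we; rewrite Re_kroot ler_wpM2r ?(ltW (cos_alpha_gt0 _ a01))//.
have [a0 _] := andP a01.
by rewrite powRN_inv// ge0_ler_powR// ?nnegrE// ?invr_ge0 ?(ltW e0)// divr_ge0// ltW.
Qed.

(* With [r = eps |w| >= 1] and [k = eps^(-alpha/2) c] it suffices that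
   [r^(2p) <= exp (2 g k (r^(alpha/2) - 1))]; here [2 p <= alpha g k] and
   [(alpha/2) ln r <= r^(alpha/2) - 1]. *)
Lemma sobolev_weight_le alpha eps p (c g : R) w : 0 < alpha -> 0 < eps -> 0 < p ->
  2 * p <= alpha * g * (eps `^ (- (alpha / 2)) * c) -> 0 <= c -> 0 <= g ->
  eps^-1 <= `|w| ->
  (1 + w ^+ 2) `^ p * expR (2 * g * (eps `^ (- (alpha / 2)) * c)) <=
  (1 + eps ^- 2) `^ p * expR (2 * g * (`|w| `^ (alpha / 2) * c)).
Proof.
move=> a0 e0 p0 hp c0 g0 we.
pose r := eps * `|w|.
have r1 : 1 <= r by rewrite /r mulrC -ler_pdivrMr// mul1r.
have r0 : 0 < r by rewrite (lt_le_trans _ r1).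
have wE : `|w| = eps^-1 * r by rewrite /r mulKf// gt_eqF.
pose k := eps `^ (- (alpha / 2)) * c.
have k0 : 0 <= k by rewrite mulr_ge0// powR_ge0.
have -> : `|w| `^ (alpha / 2) * c = r `^ (alpha / 2) * k.
  by rewrite wE powRM ?invr_ge0 ?(ltW e0) ?(ltW r0)// -powRN_inv// /k; ring.
rewrite -/k.
have base : 1 + w ^+ 2 <= (1 + eps ^- 2) * r ^+ 2.
  rewrite -(real_normK (num_real w)) wE exprMn exprVn mulrDl mul1r lerD2r.
  by rewrite exprn_ege1.
have e2 : 0 <= 1 + eps ^- 2 by rewrite addr_ge0// invr_ge0 sqr_ge0.
have rpow s : r `^ s = expR (s * ln r) by rewrite /powR gt_eqF.
have step1 : (1 + w ^+ 2) `^ p <= (1 + eps ^- 2) `^ p * expR (2 * p * ln r).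
  have -> : expR (2 * p * ln r) = (r ^+ 2) `^ p.
    by rewrite -powR_mulrn ?(ltW r0)// -powRrM rpow.
  rewrite -powRM ?sqr_ge0// ge0_ler_powR ?nnegrE ?(ltW p0)//.
    by rewrite addr_ge0 ?sqr_ge0.
  by rewrite mulr_ge0 ?sqr_ge0.
apply: (le_trans (ler_wpM2r (expR_ge0 _) step1)).
rewrite -[leLHS]mulrA -expRD ler_wpM2l ?powR_ge0// ler_expR.
have ln0 : 0 <= ln r by rewrite ln_ge0.
have h : 1 + alpha / 2 * ln r <= r `^ (alpha / 2) by rewrite rpow expR_ge1Dx.
have h1 := ler_wpM2r ln0 hp.
have gk0 : 0 <= g * k by rewrite mulr_ge0.
have h2 := ler_wpM2l gk0 h.
rewrite -/k in h1.
move: (r `^ (alpha / 2)) (ln r) h1 h2 => P L h1 h2.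
have -> : 2 * g * (P * k) = 2 * (g * k * P) by ring.
have -> : 2 * g * k = 2 * (g * k) by ring.
have e : g * k * (1 + alpha / 2 * L) = g * k + 2^-1 * (alpha * g * k * L) by field.
lra.
Qed.

End hyperbolic_kernels.

(** * The Duhamel term *)

Section duhamel.
Local Open Scope complex_scope.
Context {R : realType}.
Implicit Types (a b x w alpha : R) (V W G : R -> R[i]).
Local Notation mu := (@lebesgue_measure R).
Local Notation Re := complex.Re.
Local Notation Im := complex.Im.

Lemma ReM (z z' : R[i]) : Re (z * z') = Re z * Re z' - Im z * Im z'.
Proof. by case: z => a b; case: z' => c d. Qed.

Lemma ImM (z z' : R[i]) : Im (z * z') = Re z * Im z' + Im z * Re z'.
Proof. by case: z => a b; case: z' => c d. Qed.

Lemma cmeasurableM V W : cmeasurable V -> cmeasurable W ->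
  cmeasurable (fun w => V w * W w).
Proof.
move=> [mr mi] [mr' mi']; split.
  rewrite (_ : (fun _ => _) = (fun w => Re (V w) * Re (W w) - Im (V w) * Im (W w))).
    by apply: measurable_funB; exact: measurable_funM.
  by apply/funext => w; rewrite ReM.
rewrite (_ : (fun _ => _) = (fun w => Re (V w) * Im (W w) + Im (V w) * Re (W w))).
  by apply: measurable_funD; exact: measurable_funM.
by apply/funext => w; rewrite ImM.
Qed.

Lemma cmeasurable_sinhk alpha w x : cmeasurable (fun z => sinhk alpha w (x - z)).
Proof.
have [w0|w0] := boolP (w == 0).
  rewrite (_ : (fun _ => _) = (fun z => (x - z)%:C)); last first.
    by apply/funext => z; rewrite /sinhk w0.
  split; first exact: measurable_funB.
  exact: measurable_cst.
rewrite (_ : (fun _ => _) =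
    (fun z => csinh (kroot alpha w * (x - z)%:C) * (kroot alpha w)^-1)); last first.
  by apply/funext => z; rewrite /sinhk (negbTE w0).
apply: (cmeasurableM (fun z => csinh (kroot alpha w * (x - z)%:C))
  (fun=> (kroot alpha w)^-1)); last by split.
have ml (c : R) : measurable_fun setT (fun z : R => (x - z) * c).
  by apply: measurable_funM => //; exact: measurable_funB.
have me (c : R) : measurable_fun setT (fun z : R => expR ((x - z) * c)).
  exact: measurableT_comp.
have meN (c : R) : measurable_fun setT (fun z : R => expR (- ((x - z) * c))).
  by apply: measurableT_comp => //; exact: measurableT_comp.
have mc (c : R) : measurable_fun setT (fun z : R => cos ((x - z) * c)).
  apply: (measurableT_comp (f := cos)) => //.
  by apply: continuous_measurable_fun; exact: continuous_cos.
have ms (c : R) : measurable_fun setT (fun z : R => sin ((x - z) * c)).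
  apply: (measurableT_comp (f := sin)) => //.
  by apply: continuous_measurable_fun; exact: continuous_sin.
split; under eq_fun do rewrite kroot_mulE csinhE /=.
  apply: measurable_funM => //; apply: measurable_funM => //.
  exact: measurable_funB.
apply: measurable_funM => //; apply: measurable_funM => //.
exact: measurable_funD.
Qed.

(** Cauchy-Schwarz on an interval of length at most 1. Expanding the integral of (A - m)^2 >= 0,
    with [m] the integral itself, gives that of A^2 at least 2 m^2 - m^2 x >= m^2. *)
Lemma sqr_Rintegral_le x (A : R -> R) : 0 <= x <= 1 ->
  mu.-integrable `]0, x[ (EFin \o A) ->
  mu.-integrable `]0, x[ (EFin \o (fun z => A z ^+ 2)) ->
  (\int[mu]_(z in `]0, x[) A z) ^+ 2 <= \int[mu]_(z in `]0, x[) (A z ^+ 2).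
Proof.
move=> /andP[x0 x1] iA iA2.
pose m := \int[mu]_(z in `]0, x[) A z; rewrite -/m.
have mI : measurable (`]0, x[%classic : set (measurableTypeR R)).
  exact: measurable_itv.
have mux : mu `]0, x[ = x%:E.
  rewrite lebesgue_measure_itv/= lte_fin; case: ltP => // x0'.
    by rewrite sube0.
  by congr EFin; apply/eqP; rewrite eq_le x0 x0'.
have ic (c : R) : mu.-integrable `]0, x[ (EFin \o cst c).
  apply: measurable_bounded_integrable => //; first by have := ltry x; rewrite -mux.
  by exists `|c|; split; [exact: num_real|move=> M cM z _ /=; exact: ltW].
have h : 0 <= \int[mu]_(z in `]0, x[) ((A z ^+ 2 + (- (2 * m)) * A z) + m ^+ 2).
  apply: Rintegral_ge0 => z _.
  by have := sqr_ge0 (A z - m); move: (A z) => y; nra.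
move: h; rewrite RintegralD//; [|by apply: integrable_addr => //; exact: integrable_mulrl|exact: ic].
rewrite RintegralD//; last exact: integrable_mulrl.
have fmu : fine (mu `]0, x[) = x := congr1 fine mux.
rewrite RintegralZl// Rintegral_cst// [fine _]fmu -/m => h.
have m2 : m ^+ 2 * x <= m ^+ 2 by rewrite ler_piMr ?sqr_ge0.
by move: h; rewrite mulNr -mulrA -expr2; lra.
Qed.

Lemma Rintegral_itv_cc_oo x (A : R -> R) : measurable_fun `]0, x[ A ->
  \int[mu]_(z in `[0, x]) A z = \int[mu]_(z in `]0, x[) A z.
Proof.
move=> mA; rewrite /Rintegral (@integral_itv_bndoo _ 0 x (EFin \o A) true false)//.
exact/measurable_EFinP.
Qed.

Lemma integrable_of_sqr_itv x (A : R -> R) :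
  measurable_fun `]0, x[ A ->
  mu.-integrable `]0, x[ (EFin \o (fun z => A z ^+ 2)) ->
  mu.-integrable `]0, x[ (EFin \o A).
Proof.
move=> mA iA2.
have mI : measurable (`]0, x[%classic : set (measurableTypeR R)).
  exact: measurable_itv.
have mux : (mu `]0%R, x[ < +oo)%E.
  by rewrite lebesgue_measure_itv/=; case: ifPn => _; rewrite ?ltry// -EFinB ltry.
have i1 : mu.-integrable `]0, x[ (EFin \o cst 1).
  apply: measurable_bounded_integrable => //.
  by exists 1; split; [exact: num_real|move=> M M1 z _ /=; rewrite normr1 ltW].
apply: le_integrable (integrable_addr _ _ _ mI i1 iA2) => //.
  exact/measurable_EFinP.
move=> z _; rewrite /= lee_fin (ger0_norm (addr_ge0 _ _)) ?sqr_ge0//.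
rewrite -(real_normK (num_real (A z))).
have := sqr_ge0 (`|A z| - 1); have := normr_ge0 (A z); nra.
Qed.

(** Cauchy-Schwarz in [z] at a fixed frequency. The [H] are sections known only on the open interval
    and the [G] measurable functions that agree with them there; removing the endpoints from the
    domain of integration lets one replace the other. *)
Lemma duhamel_diff_le alpha w x (kap : R) (G1 G2 H1 H2 : R -> R[i]) :
  0 < alpha < 1 -> 0 <= x < 1 -> Re (kroot alpha w) <= kap ->
  cmeasurable G1 -> cmeasurable G2 ->
  (cL2sqr G1 < +oo)%E -> (cL2sqr G2 < +oo)%E ->
  (forall z, 0 < z < 1 -> H1 z = G1 z) -> (forall z, 0 < z < 1 -> H2 z = G2 z) ->
  (((Normc.normc (cintegral `[0, x] (fun z => sinhk alpha w (x - z) * H1 z)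
     - cintegral `[0, x] (fun z => sinhk alpha w (x - z) * H2 z))%R) ^+ 2)%:E <=
  \int[mu]_(z in `]0%R, x[)
    (expR (2 * (kap * (x - z))) * (Normc.normc (G1 z - G2 z)%R) ^+ 2)%:E)%E.
Proof.
move=> a01 /andP[x0 x1] kk mG1 mG2 G1fin G2fin HG1 HG2.
have mI : measurable (`]0%R, x[%classic : set (measurableTypeR R)).
  exact: measurable_itv.
have ms := cmeasurable_sinhk alpha w x.
have kap0 : 0 <= kap by rewrite (le_trans _ kk)// Re_kroot_ge0.
have in01 z : z \in `]0, x[ -> 0 < z < 1.
  by rewrite in_itv/= => /andP[-> zx] /=; exact: lt_trans zx x1.
have sle z : z \in `]0, x[ ->
    (Normc.normc (sinhk alpha w (x - z))) ^+ 2 <= expR (2 * (kap * (x - z))).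
  rewrite in_itv/= => /andP[z0 zx].
  have xz : 0 <= x - z <= 1 by lra.
  apply: (le_trans (normc_sinhk_le _ _ _ a01 xz)).
  by rewrite ler_expR ler_wpM2l// mulrC ler_wpM2r//; lra.
(* A bound independent of [z], used only for integrability; the weight in the conclusion keeps its
   dependence on [x - z]. *)
pose E := expR (2 * kap).
have sleE z : z \in `]0, x[ -> expR (2 * (kap * (x - z))) <= E.
  rewrite in_itv/= => /andP[z0 zx]; rewrite ler_expR ler_wpM2l// ler_piMr//; lra.
pose P G z := sinhk alpha w (x - z) * G z.
have mP G : cmeasurable G -> cmeasurable (P G) by move=> mG; exact: cmeasurableM.
have iG G : cmeasurable G -> (cL2sqr G < +oo)%E ->
    mu.-integrable `]0, x[ (EFin \o (fun z => E * (Normc.normc (G z)) ^+ 2)).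
  move=> mG Gfin; apply: integrable_mulrl => //.
  apply: (integrableS measurableT) => //; apply/integrableP; split.
    by apply/measurable_EFinP; exact: measurable_normc_sqr.
  by under eq_integral do rewrite /= ger0_norm ?sqr_ge0//.
have Ple G z : z \in `]0, x[ -> (Normc.normc (P G z)) ^+ 2 <=
    expR (2 * (kap * (x - z))) * (Normc.normc (G z)) ^+ 2.
  by move=> zx; rewrite Normc.normcM exprMn ler_wpM2r ?sqr_ge0// sle.
have PleE G z : z \in `]0, x[ -> (Normc.normc (P G z)) ^+ 2 <= E * (Normc.normc (G z)) ^+ 2.
  by move=> zx; rewrite (le_trans (Ple G z zx))// ler_wpM2r ?sqr_ge0// sleE.
have iRe2 G : cmeasurable G -> (cL2sqr G < +oo)%E ->
    mu.-integrable `]0, x[ (EFin \o (fun z => Re (P G z) ^+ 2)).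
  move=> mG Gfin; apply: le_integrable (iG G mG Gfin) => //.
    apply/measurable_EFinP; apply: measurable_funX; apply: measurable_funTS.
    exact: (mP G mG).1.
  move=> z zx; rewrite /= lee_fin ger0_norm ?sqr_ge0//.
  rewrite (le_trans _ (ler_norm _))// (le_trans _ (PleE G z _))//.
  by rewrite normc_sqr lerDl sqr_ge0.
have iIm2 G : cmeasurable G -> (cL2sqr G < +oo)%E ->
    mu.-integrable `]0, x[ (EFin \o (fun z => Im (P G z) ^+ 2)).
  move=> mG Gfin; apply: le_integrable (iG G mG Gfin) => //.
    apply/measurable_EFinP; apply: measurable_funX; apply: measurable_funTS.
    exact: (mP G mG).2.
  move=> z zx; rewrite /= lee_fin ger0_norm ?sqr_ge0//.
  rewrite (le_trans _ (ler_norm _))// (le_trans _ (PleE G z _))//.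
  by rewrite normc_sqr lerDr sqr_ge0.
have mRe G : cmeasurable G -> measurable_fun `]0, x[ (fun z => Re (P G z)).
  by move=> mG; apply: measurable_funTS; exact: (mP G mG).1.
have mIm G : cmeasurable G -> measurable_fun `]0, x[ (fun z => Im (P G z)).
  by move=> mG; apply: measurable_funTS; exact: (mP G mG).2.
have iRe G (mG : cmeasurable G) (Gf : (cL2sqr G < +oo)%E) :=
  integrable_of_sqr_itv _ _ (mRe G mG) (iRe2 G mG Gf).
have iIm G (mG : cmeasurable G) (Gf : (cL2sqr G < +oo)%E) :=
  integrable_of_sqr_itv _ _ (mIm G mG) (iIm2 G mG Gf).
have cI G H : cmeasurable G -> (forall z, 0 < z < 1 -> H z = G z) ->
    cintegral `[0, x] (fun z => sinhk alpha w (x - z) * H z) =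
    (\int[mu]_(z in `]0, x[) Re (P G z)) +i* (\int[mu]_(z in `]0, x[) Im (P G z)).
  move=> mG HG; rewrite /cintegral.
  have HE z : z \in (`]0, x[%classic : set R) ->
      P G z = sinhk alpha w (x - z) * H z.
    by rewrite inE => zx; rewrite /P HG// in01.
  congr (_ +i* _).
    rewrite Rintegral_itv_cc_oo; first by apply: eq_Rintegral => z /HE ->.
    by apply: eq_measurable_fun (mRe G mG) => z /HE ->.
  rewrite Rintegral_itv_cc_oo; first by apply: eq_Rintegral => z /HE ->.
  by apply: eq_measurable_fun (mIm G mG) => z /HE ->.
rewrite (cI G1 H1 mG1 HG1) (cI G2 H2 mG2 HG2).
pose D z := G1 z - G2 z.
have mD : cmeasurable D := cmeasurableB _ _ mG1 mG2.
have Dfin : (cL2sqr D < +oo)%E.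
  apply: (le_lt_trans (cL2sqrB_le 1 _ _ ltr01 mG1 mG2)).
  by apply: lte_add_pinfty; apply: lte_mul_pinfty.
have PD z : P G1 z - P G2 z = P D z by rewrite /P /D mulrBr.
rewrite normc_sqr ReB ImB /=.
rewrite -!RintegralB//; [|exact: iIm|exact: iIm|exact: iRe|exact: iRe].
have -> : \int[mu]_(z in `]0, x[) (Re (P G1 z) - Re (P G2 z)) =
    \int[mu]_(z in `]0, x[) Re (P D z).
  by apply: eq_Rintegral => z _; rewrite -ReB PD.
have -> : \int[mu]_(z in `]0, x[) (Im (P G1 z) - Im (P G2 z)) =
    \int[mu]_(z in `]0, x[) Im (P D z).
  by apply: eq_Rintegral => z _; rewrite -ImB PD.
have x01 : 0 <= x <= 1 by rewrite x0 ltW.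
have cs1 := sqr_Rintegral_le x _ x01 (iRe D mD Dfin) (iRe2 D mD Dfin).
have cs2 := sqr_Rintegral_le x _ x01 (iIm D mD Dfin) (iIm2 D mD Dfin).
apply: (@le_trans _ _ (\int[mu]_(z in `]0, x[) (Re (P D z) ^+ 2) +
   \int[mu]_(z in `]0, x[) (Im (P D z) ^+ 2))%:E); first by rewrite lee_fin lerD.
rewrite -RintegralD//; [|exact: iRe2|exact: iIm2].
rewrite /Rintegral fineK; last first.
  by apply: integrable_fin_num => //; apply: integrable_addr => //; [exact: iRe2|exact: iIm2].
apply: ge0_le_integral => //.
- by move=> z _; rewrite lee_fin addr_ge0 ?sqr_ge0.
- apply/measurable_EFinP; apply: measurable_funD; apply: measurable_funX.
    exact: mRe.
  exact: mIm.
- apply/measurable_EFinP; apply: measurable_funM.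
    apply: measurableT_comp => //; apply: measurable_funM => //.
    by apply: measurable_funM => //; apply: measurable_funB.
  by apply: measurable_funTS; exact: measurable_normc_sqr.
- by move=> z zx; rewrite lee_fin -normc_sqr; exact: Ple.
Qed.

End duhamel.

(** * Transforms in the second variable of functions on the strip *)

Section strip.
Local Open Scope complex_scope.
Context {R : realType}.
Implicit Types (F : R -> R -> R) (G : R -> R -> R[i]) (x z w t : R).
Local Notation mu := (@lebesgue_measure R).
Local Notation Re := complex.Re.
Local Notation Im := complex.Im.
Local Notation strip := ((`]0, 1[ : set R) `*` [set: R]).

(** Extension by zero: sections and iterated integrals can be taken over the whole line, and the
    values of [G] outside the strip, about which [is_fourier_snd] says nothing, disappear. *)
Definition strip_ext (T : zmodType) (F : R -> R -> T) z w : T :=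
  if 0 < z < 1 then F z w else 0.

Lemma strip_extE (T : zmodType) (F : R -> R -> T) z : 0 < z < 1 ->
  strip_ext T F z = F z.
Proof. by move=> z01; apply/funext => w; rewrite /strip_ext z01. Qed.

Lemma strip_ext_out (T : zmodType) (F : R -> R -> T) z w : ~~ (0 < z < 1) ->
  strip_ext T F z w = 0.
Proof. by move=> z01; rewrite /strip_ext (negbTE z01). Qed.

Lemma measurable_strip_ext (H : R -> R -> R) :
  measurable_fun strip (fun q : R * R => H q.1 q.2) ->
  measurable_fun setT (fun q : R * R => strip_ext R H q.1 q.2).
Proof.
move=> mH.
have mS : measurable strip by apply: measurableX; [exact: measurable_itv|exact: measurableT].
have := (measurable_restrictT _ mS).1 mH; apply: eq_measurable_fun => q _.
rewrite patchE /strip_ext; case: ifPn => [|qS].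
  by rewrite inE /= in_itv/= => -[-> _].
case: ifPn => // q01; case/negP: qS.
by rewrite inE /=; split=> //; rewrite in_itv.
Qed.

Lemma strip_L2 F : in_L2_strip F ->
  measurable_fun setT (fun q : R * R => strip_ext R F q.1 q.2) /\
  (mu \x mu)%E.-integrable setT (fun q => (strip_ext R F q.1 q.2 ^+ 2)%:E).
Proof.
move=> FL.
have E : (fun q : R * R => F q.1 q.2) \_ strip = (fun q => strip_ext R F q.1 q.2).
  apply/funext => q; rewrite patchE /strip_ext; case: ifPn => [|qS].
    by rewrite inE /= in_itv/= => -[-> _].
  case: ifPn => // q01; case/negP: qS.
  by rewrite inE /=; split=> //; rewrite in_itv.
rewrite /in_L2_strip E in FL.
split; last exact: Lfun2_integrable_sqr.
by move: FL; rewrite inE => /andP[]; rewrite inE.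
Qed.

Lemma strip_section_L2 F : in_L2_strip F ->
  {ae mu, forall z, 0 < z < 1 -> in_L2 (F z)}.
Proof.
move=> /strip_L2[mF iF].
have := ae_integrable1 iF; apply: ae_imply => z iz z01.
apply/in_L2P; split.
  have := measurableT_comp mF (measurable_pair1 z); apply: eq_measurable_fun => t _ /=.
  by rewrite strip_extE.
by move: iz; rewrite /= strip_extE.
Qed.

Lemma strip_integral_lty F : in_L2_strip F ->
  (\int[mu]_z \int[mu]_t (strip_ext R F z t ^+ 2)%:E < +oo)%E.
Proof.
move=> /strip_L2[mF iF].
have [miF _] := integrableP _ _ _ iF.
have := (@integrable12ltyP _ _ _ _ R mu mu _ miF).1 iF; apply: le_lt_trans.
rewrite le_eqVlt; apply/orP; left; apply/eqP.
apply: eq_integral => z _; apply: eq_integral => t _ /=.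
by rewrite ger0_norm ?sqr_ge0.
Qed.

Lemma measurable_fourier_snd F G : is_fourier_snd F G ->
  measurable_fun setT (fun q : R * R => Re (strip_ext R[i] G q.1 q.2)) /\
  measurable_fun setT (fun q : R * R => Im (strip_ext R[i] G q.1 q.2)).
Proof.
move=> [mr mi _]; split.
  have := measurable_strip_ext (fun z w => Re (G z w)) mr.
  by apply: eq_measurable_fun => q _; rewrite /strip_ext; case: ifPn.
have := measurable_strip_ext (fun z w => Im (G z w)) mi.
by apply: eq_measurable_fun => q _; rewrite /strip_ext; case: ifPn.
Qed.

Lemma cmeasurable_section1 F G z : is_fourier_snd F G ->
  cmeasurable (fun w => strip_ext R[i] G z w).
Proof.
move=> /measurable_fourier_snd[mr mi]; split.
  exact: (measurableT_comp mr (measurable_pair1 z)).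
exact: (measurableT_comp mi (measurable_pair1 z)).
Qed.

Lemma cmeasurable_section2 F G w : is_fourier_snd F G ->
  cmeasurable (fun z => strip_ext R[i] G z w).
Proof.
move=> /measurable_fourier_snd[mr mi]; split.
  exact: (measurableT_comp mr (measurable_pair2 w)).
exact: (measurableT_comp mi (measurable_pair2 w)).
Qed.

Lemma cL2sqr_ae_eq (V W : R -> R[i]) : cmeasurable V -> cmeasurable W ->
  {ae mu, forall w, V w = W w} -> cL2sqr V = cL2sqr W.
Proof.
move=> mV mW VW; apply: ge0_ae_eq_integral => //.
- by apply/measurable_EFinP; exact: measurable_normc_sqr.
- by apply/measurable_EFinP; exact: measurable_normc_sqr.
- by move=> w _; rewrite lee_fin sqr_ge0.
- by move=> w _; rewrite lee_fin sqr_ge0.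
- by apply: ae_imply VW => w -> _.
Qed.

Lemma fourier_snd_plancherel F G : in_L2_strip F -> is_fourier_snd F G ->
  {ae mu, forall z, cL2sqr (strip_ext R[i] G z) =
    (\int[mu]_t (strip_ext R F z t ^+ 2)%:E)%E}.
Proof.
move=> FL FG; have [_ _ GF] := FG.
apply: ae_imply2 (strip_section_L2 _ FL) GF => z FzL Gz.
have [z01|z01] := boolP (0 < z < 1); last first.
  transitivity (0%E : \bar R).
    rewrite /cL2sqr; under eq_integral do rewrite strip_ext_out//.
    apply: integral0_eq => w _; by rewrite normc_sqr /= expr0n addr0.
  apply/esym/integral0_eq => t _; by rewrite strip_ext_out// expr0n.
have L := FzL z01; have [_ iF] := (in_L2P _).1 L.
rewrite strip_extE// (cL2sqr_ae_eq (G z) (fourier (F z))).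
- rewrite plancherel// strip_extE// /Rintegral fineK//.
  exact: (integrable_fin_num measurableT iF).
- by have := cmeasurable_section1 F G z FG; rewrite strip_extE.
- exact: cmeasurable_fourier.
- exact: Gz.
Qed.

Lemma fourier_snd_plancherelB F1 F2 G1 G2 : in_L2_strip F1 -> in_L2_strip F2 ->
  is_fourier_snd F1 G1 -> is_fourier_snd F2 G2 ->
  {ae mu, forall z, 0 < z < 1 -> [/\ in_L2 (F1 z), in_L2 (F2 z) &
    cL2sqr (fun w => strip_ext R[i] G1 z w - strip_ext R[i] G2 z w) =
    (\int[mu]_t ((F1 z t - F2 z t) ^+ 2)%:E)%E]}.
Proof.
move=> FL1 FL2 FG1 FG2; have [_ _ GF1] := FG1; have [_ _ GF2] := FG2.
have A1 := ae_imply2 _ _ (fun z => 0 < z < 1 -> in_L2 (F1 z) /\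
  {ae mu, forall w, G1 z w = fourier (F1 z) w})
  (fun z a b z01 => conj (a z01) (b z01)) (strip_section_L2 _ FL1) GF1.
have A2 := ae_imply2 _ _ (fun z => 0 < z < 1 -> in_L2 (F2 z) /\
  {ae mu, forall w, G2 z w = fourier (F2 z) w})
  (fun z a b z01 => conj (a z01) (b z01)) (strip_section_L2 _ FL2) GF2.
apply: ae_imply2 A1 A2 => z a1 a2 z01.
have [L1 e1] := a1 z01; have [L2 e2] := a2 z01; split=> //.
have M1 := cmeasurable_section1 F1 G1 z FG1; have M2 := cmeasurable_section1 F2 G2 z FG2.
rewrite strip_extE// in M1; rewrite strip_extE// in M2.
rewrite !strip_extE//.
have L12 := in_L2B _ _ L1 L2.
have [_ i12] := (in_L2P _).1 L12.
rewrite (cL2sqr_ae_eq _ (fourier (F1 z \- F2 z))).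
- by rewrite plancherel// /Rintegral fineK//; exact: (integrable_fin_num measurableT i12).
- exact: cmeasurableB.
- exact: cmeasurable_fourier.
- have e12 := ae_imply2 _ _ (fun w => G1 z w - G2 z w = fourier (F1 z) w - fourier (F2 z) w)
    (fun w a b => congr2 (fun p q => p - q) a b) e1 e2.
  apply: ae_imply2 e12 (fourierB _ _ L1 L2) => w p q.
  by rewrite p q.
Qed.

(** Plancherel in [t] for almost every [z] makes the transform square integrable on the plane;
    Tonelli then reads this along the other sections. It is what [duhamel_diff_le] requires at a
    fixed frequency. *)
Lemma fourier_snd_section_lty F G : in_L2_strip F -> is_fourier_snd F G ->
  {ae mu, forall w, (cL2sqr (fun z => strip_ext R[i] G z w) < +oo)%E}.
Proof.
move=> FL FG; have [mr mi] := measurable_fourier_snd _ _ FG.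
pose N (q : R * R) := ((Normc.normc (strip_ext R[i] G q.1 q.2)) ^+ 2)%:E.
have mN : measurable_fun setT N.
  apply/measurable_EFinP.
  rewrite (_ : (fun _ => _) = (fun q : R * R => Re (strip_ext R[i] G q.1 q.2) ^+ 2 +
     Im (strip_ext R[i] G q.1 q.2) ^+ 2)).
    by apply: measurable_funD; exact: measurable_funX.
  by apply/funext => q; rewrite normc_sqr.
have N0 q : (0 <= N q)%E by rewrite lee_fin sqr_ge0.
have T := fubini_tonelli (m1 := mu) (m2 := mu) N mN N0.
have fin : (\int[mu]_z \int[mu]_w N (z, w) < +oo)%E.
  apply: le_lt_trans (strip_integral_lty _ FL).
  rewrite le_eqVlt; apply/orP; left; apply/eqP.
  have [mF _] := strip_L2 _ FL.
  apply: ge0_ae_eq_integral => //.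
  - exact: measurable_tonelli.
  - apply: (measurable_tonelli (fun q => (strip_ext R F q.1 q.2 ^+ 2)%:E)).
      by apply/measurable_EFinP; exact: measurable_funX.
    by move=> q; rewrite lee_fin sqr_ge0.
  - by move=> z _; exact: integral_ge0.
  - by move=> z _; apply: integral_ge0 => t _; rewrite lee_fin sqr_ge0.
  - by apply: ae_imply (fourier_snd_plancherel _ _ FL FG) => z + _.
rewrite T in fin.
have mW : measurable_fun setT (fun w => \int[mu]_z N (z, w))%E.
  exact: (measurable_fun_fubini_tonelli_G (m1 := mu) N mN N0).
have iW : mu.-integrable setT (fun w => \int[mu]_z N (z, w))%E.
  apply/integrableP; split=> //.
  by under eq_integral do rewrite gee0_abs ?integral_ge0//.
have := integrable_ae measurableT iW.
apply: ae_imply => w /(_ I); rewrite ge0_fin_numE ?integral_ge0//.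
Qed.

(** Tonelli, with the indicator of []0, x[] moved into the integrand: the bound of
    [duhamel_diff_le], integrated over all frequencies, becomes an integral over [z] of squared
    norms. *)
Lemma duhamel_energy F1 F2 G1 G2 (E : R -> R) x : in_L2_strip F1 -> in_L2_strip F2 ->
  is_fourier_snd F1 G1 -> is_fourier_snd F2 G2 -> 0 <= x < 1 ->
  measurable_fun setT E -> (forall z, 0 <= E z) ->
  let D w := (\int[mu]_(z in `]0%R, x[)
    (E z * (Normc.normc (strip_ext R[i] G1 z w - strip_ext R[i] G2 z w)%R) ^+ 2)%:E)%E in
  measurable_fun setT D /\
  (\int[mu]_w D w = \int[mu]_(z in `]0%R, x[)
    ((E z)%:E * cL2sqr (fun w => (strip_ext R[i] G1 z w - strip_ext R[i] G2 z w)%R)))%E.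
Proof.
move=> FL1 FL2 FG1 FG2 /andP[x0 x1] mE E0 D.
have [mr1 mi1] := measurable_fourier_snd _ _ FG1.
have [mr2 mi2] := measurable_fourier_snd _ _ FG2.
pose I : R -> R := \1_(`]0%R, x[%classic : set R).
have IE z : I z = (z \in `]0, x[)%:R by rewrite /I indicE mem_setE.
have mI : measurable_fun setT I by apply: measurable_indic; exact: measurable_itv.
pose n z w := (Normc.normc (strip_ext R[i] G1 z w - strip_ext R[i] G2 z w)) ^+ 2.
pose N (q : R * R) := (I q.1 * (E q.1 * n q.1 q.2))%:E.
have mn : measurable_fun setT (fun q : R * R => n q.1 q.2).
  rewrite (_ : (fun _ => _) = (fun q : R * R =>
     (Re (strip_ext R[i] G1 q.1 q.2) - Re (strip_ext R[i] G2 q.1 q.2)) ^+ 2 +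
     (Im (strip_ext R[i] G1 q.1 q.2) - Im (strip_ext R[i] G2 q.1 q.2)) ^+ 2)).
    by apply: measurable_funD; apply: measurable_funX; exact: measurable_funB.
  by apply/funext => q; rewrite /n normc_sqr ReB ImB.
have mN : measurable_fun setT N.
  apply/measurable_EFinP; apply: measurable_funM.
    exact: (measurableT_comp mI measurable_fst).
  apply: measurable_funM => //; exact: (measurableT_comp mE measurable_fst).
have n0 z w : 0 <= n z w by rewrite sqr_ge0.
have N0 q : (0 <= N q)%E by rewrite lee_fin mulr_ge0 ?IE// mulr_ge0.
have DE : D = (fun w => \int[mu]_z N (z, w))%E.
  apply/funext => w; rewrite /D integral_mkcond; apply: eq_integral => z _.
  by rewrite patchE /N /= IE mem_setE; case: ifPn => _; rewrite ?mul1r ?mul0r.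
split.
  by rewrite DE; exact: (measurable_fun_fubini_tonelli_G (m1 := mu) N mN N0).
rewrite DE -(fubini_tonelli (m1 := mu) (m2 := mu) N mN N0) [RHS]integral_mkcond.
apply: eq_integral => z _; rewrite patchE mem_setE /N /=.
have [zx|zx] := boolP (z \in `]0, x[); last first.
  by apply: integral0_eq => w _; rewrite IE (negbTE zx) mul0r.
have mnz : measurable_fun setT (fun w => (n z w)%:E).
  by apply/measurable_EFinP; exact: (measurableT_comp mn (measurable_pair1 z)).
rewrite /cL2sqr -ge0_integralZl; [|exact: measurableT|exact: mnz|
  by move=> w _; rewrite lee_fin sqr_ge0|by rewrite lee_fin].
by apply: eq_integral => w _; rewrite IE zx mul1r EFinM.
Qed.

End strip.

Lemma affine_diff (M : comNzRingType) (c s gd g hd h i j : M) :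
  c * gd + s * hd - i - (c * g + s * h - j) =
  c * (gd - g) + s * (hd - h) - (i - j).
Proof. by ring. Qed.

(** * Elementary inequalities, smallness of epsilon, measurability of norms in z *)

Section estimates.
Local Open Scope complex_scope.
Context {R : realType}.
Implicit Types (x z w t alpha eps : R).
Local Notation mu := (@lebesgue_measure R).
Local Notation Re := complex.Re.
Local Notation Im := complex.Im.

Lemma normc_sqrM (z z' : R[i]) :
  (Normc.normc (z * z')) ^+ 2 = (Normc.normc z) ^+ 2 * (Normc.normc z') ^+ 2.
Proof. by rewrite Normc.normcM exprMn. Qed.

Lemma normc_sqrD_le (z z' : R[i]) :
  (Normc.normc (z + z')) ^+ 2 <= 2 * (Normc.normc z) ^+ 2 + 2 * (Normc.normc z') ^+ 2.
Proof.
rewrite !normc_sqr; case: z => a b; case: z' => c d /=.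
by have := sqr_ge0 (a - c); have := sqr_ge0 (b - d); nra.
Qed.

Lemma L2normE (v : R -> R) : in_L2 v ->
  L2norm v = (Num.sqrt (\int[mu]_t (v t ^+ 2)))%:E.
Proof.
move=> /in_L2P[mv iv]; rewrite /L2norm unlock /Lnorm.
have -> : (\int[mu]_t (`|(EFin \o v) t| `^ 2) = (\int[mu]_t (v t ^+ 2))%:E)%E.
  rewrite /Rintegral fineK; last exact: (integrable_fin_num measurableT iv).
  by apply: eq_integral => t _ /=; rewrite powR_mulrn// real_normK// num_real.
rewrite poweR_EFin powR12_sqrt//.
by apply: Rintegral_ge0 => t _; rewrite sqr_ge0.
Qed.

Lemma data_error_sqr (v1 v2 : R -> R) (delta : R) : in_L2 v1 -> in_L2 v2 ->
  (L2norm v1 + L2norm v2 <= delta%:E)%E ->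
  \int[mu]_t (v1 t ^+ 2) + \int[mu]_t (v2 t ^+ 2) <= delta ^+ 2.
Proof.
move=> L1 L2; rewrite !L2normE// -EFinD lee_fin.
have i1 : 0 <= \int[mu]_t (v1 t ^+ 2) by apply: Rintegral_ge0 => t _; exact: sqr_ge0.
have i2 : 0 <= \int[mu]_t (v2 t ^+ 2) by apply: Rintegral_ge0 => t _; exact: sqr_ge0.
move=> h; rewrite -{1}(sqr_sqrtr i1) -{1}(sqr_sqrtr i2).
have a0 := sqrtr_ge0 (\int[mu]_t (v1 t ^+ 2)).
have b0 := sqrtr_ge0 (\int[mu]_t (v2 t ^+ 2)).
move: (Num.sqrt (\int[mu]_t (v1 t ^+ 2))) (Num.sqrt (\int[mu]_t (v2 t ^+ 2))) h a0 b0.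
move=> a b h a0 b0; have := mulr_ge0 a0 b0; nra.
Qed.

(** The conclusion makes (1 + w^2)^p exp(-2 gamma c w^(alpha/2)) nonincreasing for w >= 1/eps: its
    logarithmic derivative is at most (2 p - alpha gamma c w^(alpha/2)) / w. *)
Lemma eps_smallness alpha (gamma p c eps : R) : 0 < alpha -> 0 < p -> 0 < gamma -> 0 < c ->
  0 < eps -> eps < (alpha * gamma * c / (2 * p)) `^ (2 / alpha) ->
  2 * p <= alpha * gamma * (eps `^ (- (alpha / 2)) * c).
Proof.
move=> a0 p0 g0 c0 e0 he.
pose q := alpha * gamma * c / (2 * p).
have q0 : 0 < q by rewrite divr_gt0 ?mulr_gt0.
have h : eps `^ (alpha / 2) <= q.
  have : eps `^ (alpha / 2) <= (q `^ (2 / alpha)) `^ (alpha / 2).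
    by rewrite ge0_ler_powR ?nnegrE ?powR_ge0 ?divr_ge0// ltW.
  rewrite -powRrM (_ : 2 / alpha * (alpha / 2) = 1); last by field; rewrite gt_eqF.
  by rewrite powRr1// ltW.
have e1 : 0 < eps `^ (alpha / 2) by rewrite powR_gt0.
rewrite powRN.
have -> : alpha * gamma * ((eps `^ (alpha / 2))^-1 * c) =
    (alpha * gamma * c) / eps `^ (alpha / 2) by ring.
have p2 : 0 < 2 * p by rewrite mulr_gt0.
by rewrite ler_pdivlMr// (mulrC (2 * p)) -ler_pdivlMr.
Qed.

(** The lower endpoint contributes -1/b, which is dropped. With [b = 2 * K ^+ 2] the gain 1/b
    absorbs the Lipschitz constant. *)
Lemma integral_expR_le (b x : R) : 0 < b -> 0 <= x ->
  (\int[mu]_(z in `]0%R, x[) (expR (b * z))%:E <= (expR (b * x) / b)%:E)%E.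
Proof.
move=> b0; rewrite le_eqVlt => /orP[/eqP <-|x0].
  rewrite set_itvoo0 integral_set0 lee_fin divr_ge0 ?expR_ge0 ?ltW//.
have m : measurable_fun `]0, x[ (EFin \o (fun z => expR (b * z))).
  apply/measurable_EFinP; apply: measurable_funTS.
  by apply: measurableT_comp => //; exact: measurable_funM.
rewrite -(integral_itv_bndoo true false m).
have dF z : is_derive z 1 (fun z => expR (b * z) / b) (expR (b * z)).
  apply: is_derive_eq; rewrite /GRing.scale/=.
  by field; rewrite gt_eqF.
rewrite (@continuous_FTC2 _ _ (fun z => expR (b * z) / b))//.
- by rewrite -EFinB lee_fin lerBlDr lerDl divr_ge0 ?expR_ge0 ?ltW.
- apply: continuous_subspaceT => z.
  apply: (cvg_comp _ expR); last exact: continuous_expR.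
  by apply: cvgMr; exact: cvg_id.
- split.
  + by move=> z _; case: (dF z).
  + apply: cvg_at_right_filter; case: (dF 0) => + _.
    by move=> /derivable1_diffP/differentiable_continuous.
  + apply: cvg_at_left_filter; case: (dF x) => + _.
    by move=> /derivable1_diffP/differentiable_continuous.
- by move=> z _; rewrite derive1E; case: (dF z).
Qed.

Lemma measurable_cL2sqr (H : R -> R -> R[i]) :
  measurable_fun setT (fun q : R * R => Re (H q.1 q.2)) ->
  measurable_fun setT (fun q : R * R => Im (H q.1 q.2)) ->
  measurable_fun setT (fun z => cL2sqr (H z)).
Proof.
move=> mr mi.
apply: (measurable_tonelli (fun q => ((Normc.normc (H q.1 q.2)) ^+ 2)%:E)).
  apply/measurable_EFinP.
  rewrite (_ : (fun _ => _) = (fun q : R * R => Re (H q.1 q.2) ^+ 2 + Im (H q.1 q.2) ^+ 2)).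
    by apply: measurable_funD; exact: measurable_funX.
  by apply/funext => q; rewrite normc_sqr.
by move=> q; rewrite lee_fin sqr_ge0.
Qed.

Lemma measurable_cL2sqr_snd F G : is_fourier_snd F G ->
  measurable_fun setT (fun z => cL2sqr (fun w => strip_ext R[i] G z w)).
Proof.
by move=> /measurable_fourier_snd[mr mi]; exact: measurable_cL2sqr.
Qed.

Lemma measurable_cL2sqr_sndB F1 F2 G1 G2 : is_fourier_snd F1 G1 -> is_fourier_snd F2 G2 ->
  measurable_fun setT (fun z =>
    cL2sqr (fun w => strip_ext R[i] G1 z w - strip_ext R[i] G2 z w)).
Proof.
move=> /measurable_fourier_snd[mr mi] /measurable_fourier_snd[mr' mi'].
apply: (measurable_cL2sqr (fun z w => strip_ext R[i] G1 z w - strip_ext R[i] G2 z w)).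
  rewrite (_ : (fun _ => _) = (fun q : R * R =>
     Re (strip_ext R[i] G1 q.1 q.2) - Re (strip_ext R[i] G2 q.1 q.2))).
    exact: measurable_funB.
  by apply/funext => q; rewrite ReB.
rewrite (_ : (fun _ => _) = (fun q : R * R =>
   Im (strip_ext R[i] G1 q.1 q.2) - Im (strip_ext R[i] G2 q.1 q.2))).
  exact: measurable_funB.
by apply/funext => q; rewrite ImB.
Qed.

Lemma integral_cL2sqr_sndB_lty F1 F2 G1 G2 : in_L2_strip F1 -> in_L2_strip F2 ->
  is_fourier_snd F1 G1 -> is_fourier_snd F2 G2 ->
  (\int[mu]_z cL2sqr (fun w => (strip_ext R[i] G1 z w - strip_ext R[i] G2 z w)%R) < +oo)%E.
Proof.
move=> FL1 FL2 FG1 FG2.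
have fin F G : in_L2_strip F -> is_fourier_snd F G ->
    (\int[mu]_z cL2sqr (fun w => strip_ext R[i] G z w) < +oo)%E.
  move=> FL FG; apply: le_lt_trans (strip_integral_lty _ FL).
  rewrite le_eqVlt; apply/orP; left; apply/eqP.
  have [mF _] := strip_L2 _ FL.
  apply: ge0_ae_eq_integral => //.
  - exact: measurable_cL2sqr_snd FG.
  - apply: (measurable_tonelli (fun q => (strip_ext R F q.1 q.2 ^+ 2)%:E)).
      by apply/measurable_EFinP; exact: measurable_funX.
    by move=> q; rewrite lee_fin sqr_ge0.
  - by move=> z _; exact: cL2sqr_ge0.
  - by move=> z _; apply: integral_ge0 => t _; rewrite lee_fin sqr_ge0.
  - by apply: ae_imply (fourier_snd_plancherel _ _ FL FG) => z + _.
have M1 := measurable_cL2sqr_snd _ _ FG1; have M2 := measurable_cL2sqr_snd _ _ FG2.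
apply: (@le_lt_trans _ _ (\int[mu]_z ((1 + 1)%:E * cL2sqr (fun w => strip_ext R[i] G1 z w) +
   (1 + 1^-1)%:E * cL2sqr (fun w => strip_ext R[i] G2 z w)))%E).
  apply: ge0_le_integral => //.
  - by move=> z _; exact: cL2sqr_ge0.
  - exact: measurable_cL2sqr_sndB FG1 FG2.
  - by apply: emeasurable_funD; exact: measurable_funeM.
  - move=> z _; apply: cL2sqrB_le => //.
      exact: cmeasurable_section1 FG1.
    exact: cmeasurable_section1 FG2.
rewrite ge0_integralD//.
- rewrite !ge0_integralZl//; try (by move=> z _; exact: cL2sqr_ge0);
    try (by rewrite lee_fin).
  apply: lte_add_pinfty; apply: lte_mul_pinfty; rewrite ?lee_fin//.
    exact: fin FL1 FG1.
  exact: fin FL2 FG2.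
- by move=> z _; rewrite mule_ge0 ?cL2sqr_ge0// lee_fin.
- exact: measurable_funeM.
- by move=> z _; rewrite mule_ge0 ?cL2sqr_ge0// lee_fin.
- exact: measurable_funeM.
Qed.

End estimates.

(** * The error estimate *)

(** Here 1 + 2 is 1 + theta for theta = 2, and the inner 2 separates the contributions of the two
    data. *)
Lemma weighted_sum_le (R : realFieldType) (X Y c2 s2 p q e : R) :
  X = c2 * p -> Y = s2 * q -> c2 <= e -> s2 <= e -> 0 <= p -> 0 <= q ->
  (1 + 2) * (2 * X + 2 * Y) <= 6 * e * (p + q).
Proof.
move=> -> -> ce se p0 q0.
by have := ler_wpM2r p0 ce; have := ler_wpM2r q0 se; lra.
Qed.
Arguments weighted_sum_le {R X Y c2 s2 p q e}.

(** With [S] = exp(K^2), the noise part needs 24 <= 5^2 and the a priori part 4 S^2 + 1 <= 9 (S +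
    1)^2. The factor [B] becomes [B ^+ 2] because [B >= 1]. *)
Lemma final_arithmetic (R : realFieldType) (phi S X Y M C B d : R) :
  phi <= 24 * (S * X * d) ^+ 2 + 4 * (S * M * Y) ^+ 2 ->
  5 * S <= C -> 3 * M * (S + 1) <= C -> 1 <= B ->
  0 <= S -> 0 <= X -> 0 <= Y -> 0 <= M -> 0 <= d ->
  B * (phi + Y ^+ 2 * M ^+ 2) <= (C * B * X * d + C * B * Y) ^+ 2.
Proof.
move=> hphi C5 CM B1 S0 X0 Y0 M0 d0.
have C0 : 0 <= C by rewrite (le_trans _ C5)// mulr_ge0.
have B0 : 0 <= B by rewrite (le_trans _ B1).
have h1 : (5 * S * (X * d)) ^+ 2 <= (C * (X * d)) ^+ 2.
  by rewrite lerXn2r ?nnegrE ?mulr_ge0// ler_wpM2r// mulr_ge0.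
have h2 : (3 * M * (S + 1) * Y) ^+ 2 <= (C * Y) ^+ 2.
  by rewrite lerXn2r ?nnegrE ?mulr_ge0 ?addr_ge0// ler_wpM2r.
have h3 : 0 <= C * (X * d) * (C * Y) by rewrite !mulr_ge0.
have h4 : phi + Y ^+ 2 * M ^+ 2 <= (C * (X * d) + C * Y) ^+ 2.
  have -> : (C * (X * d) + C * Y) ^+ 2 =
    (C * (X * d)) ^+ 2 + (C * Y) ^+ 2 + 2 * (C * (X * d) * (C * Y)) by ring.
  have h5 : 0 <= (S * X * d) ^+ 2 by exact: sqr_ge0.
  have h6 : 0 <= M ^+ 2 * Y ^+ 2 * S by rewrite !mulr_ge0 ?sqr_ge0.
  have h7 : 0 <= (M * Y) ^+ 2 by exact: sqr_ge0.
  have h8 : 0 <= (S * M * Y) ^+ 2 by exact: sqr_ge0.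
  have e1 : (5 * S * (X * d)) ^+ 2 = 25 * (S * X * d) ^+ 2 by ring.
  have e2 : (3 * M * (S + 1) * Y) ^+ 2 =
    9 * (S * M * Y) ^+ 2 + 18 * (M ^+ 2 * Y ^+ 2 * S) + 9 * (M * Y) ^+ 2 by ring.
  have e3 : Y ^+ 2 * M ^+ 2 = (M * Y) ^+ 2 by ring.
  move: h1 h2; rewrite e1 e2 e3; lra.
have -> : (C * B * X * d + C * B * Y) ^+ 2 = B * (B * (C * (X * d) + C * Y) ^+ 2) by ring.
by rewrite ler_wpM2l// (le_trans h4)// ler_peMl ?sqr_ge0.
Qed.
Arguments final_arithmetic {R phi S X Y M C B d}.

Lemma le_sum_EFin (R : realFieldType) (X Y : \bar R) (a b c : R) :
  X = a%:E -> Y = b%:E -> a + b <= c -> (X + Y <= c%:E)%E.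
Proof. by move=> -> ->; rewrite -EFinD lee_fin. Qed.
Arguments le_sum_EFin {R X Y a b c}.

Section error_analysis.
Local Open Scope complex_scope.
Context {R : realType}.
Local Notation mu := (@lebesgue_measure R).
Local Notation Re := complex.Re.

Context (alpha : R) (f : R -> R -> R -> R) (K gamma delta M3 eps : R)
  (g h gd hd : R -> R) (u ued : R -> R -> R) (G1 G2 : R -> R -> R[i]).
Context (a01 : 0 < alpha < 1)
  (strip : forall w, in_CL2 w -> in_L2_strip (fun z t => f z t (w z t)))
  (K0 : 0 < K)
  (lip : forall (x t v1 v2 : R), 0 <= x <= 1 ->
     `|f x t v1 - f x t v2| <= K * `|v1 - v2|)
  (gamma0 : 0 < gamma) (delta0 : 0 < delta)
  (gL : in_L2 g) (hL : in_L2 h) (gdL : in_L2 gd) (hdL : in_L2 hd)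
  (data : (L2norm (gd \- g)%R + L2norm (hd \- h)%R <= delta%:E)%E)
  (M30 : 0 < M3)
  (apriori : forall x : R, 0 <= x < 1 ->
     (\int[lebesgue_measure]_w
        (expR (2 * (1 + gamma - x) * complex.Re (kroot alpha w)) *
         (Normc.normc (fourier (u x) w)) ^+ 2)%:E < (M3 ^+ 2)%:E)%E)
  (eps0 : 0 < eps)
  (uC : in_CL2 u) (uedC : in_CL2 ued)
  (FG1 : is_fourier_snd (fun z t => f z t (ued z t)) G1)
  (FG2 : is_fourier_snd (fun z t => f z t (u z t)) G2)
  (sol1 : forall x : R, 0 <= x <= 1 ->
      {ae mu, forall w, fourier (ued x) w =
        (\1_(`[- eps^-1, eps^-1] : set R) w)%:C * mild_rhs alpha gd hd G1 x w})
  (sol2 : forall x : R, 0 <= x <= 1 ->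
      {ae mu, forall w, fourier (u x) w = mild_rhs alpha g h G2 x w}).

Let kap := eps `^ (- (alpha / 2)) * cos (alpha * pi / 4).
Let phi x := \int[mu]_t ((ued x t - u x t) ^+ 2).
Let E x z := expR (2 * (kap * (x - z))).
(** The integrals in [z] carry [N], which is measurable by Tonelli; [phi] enters through the almost
    everywhere bound [N_le]. *)
Let N z := cL2sqr (fun w => strip_ext R[i] G1 z w - strip_ext R[i] G2 z w).
Let D x w : \bar R := (\int[mu]_(z in `]0%R, x[)
    (E x z * (Normc.normc (strip_ext R[i] G1 z w - strip_ext R[i] G2 z w)%R) ^+ 2)%:E)%E.
Let F1 z t := f z t (ued z t).
Let F2 z t := f z t (u z t).

Let FL1 : in_L2_strip F1 := strip ued uedC.
Let FL2 : in_L2_strip F2 := strip u uC.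

Let kap_ge0 : 0 <= kap.
Proof. by rewrite mulr_ge0 ?powR_ge0// ltW// cos_alpha_gt0. Qed.

Let low_frequency x : 0 <= x < 1 ->
  {ae mu, forall w, `|w| <= eps^-1 ->
    (((Normc.normc (fourier (ued x) w - fourier (u x) w)%R) ^+ 2)%:E <=
    (6 * expR (2 * (kap * x)) * ((Normc.normc (fourier (gd \- g) w)) ^+ 2 +
       (Normc.normc (fourier (hd \- h) w)) ^+ 2))%R%:E + (3 / 2)%:E * D x w)%E}.
Proof.
move=> x01; have [x0 x1] := andP x01.
have x01' : 0 <= x <= 1 by rewrite x0 ltW.
have S1 := fourier_snd_section_lty _ _ FL1 FG1.
have S2 := fourier_snd_section_lty _ _ FL2 FG2.
have S12 := ae_imply2 _ _ _ (fun w a b => conj a b) S1 S2.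
have B12 := ae_imply2 _ _ _ (fun w a b => conj a b) (fourierB _ _ gdL gL) (fourierB _ _ hdL hL).
have E12 := ae_imply2 _ _ _ (fun w a b => conj a b) (sol1 x x01') (sol2 x x01').
have SB := ae_imply2 _ _ _ (fun w a b => conj a b) S12 B12.
apply: ae_imply2 SB E12 => w [[s1 s2] [bg bh]] [e1 e2] we.
have wI : \1_(`[- eps^-1, eps^-1] : set R) w = 1 :> R.
  by rewrite indicE mem_setE in_itv/= -ler_norml we.
have kk : Re (kroot alpha w) <= kap := Re_kroot_le _ _ _ a01 eps0 we.
have DD := duhamel_diff_le alpha w x kap _ _ _ _ a01 x01 kk
  (cmeasurable_section2 _ _ w FG1) (cmeasurable_section2 _ _ w FG2) s1 s2
  (fun z z01 => esym (congr1 (fun q => q w) (strip_extE R[i] G1 z z01)))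
  (fun z z01 => esym (congr1 (fun q => q w) (strip_extE R[i] G2 z z01))).
rewrite -/(E x _) in DD.
pose c := ccosh (kroot alpha w * x%:C); pose s := sinhk alpha w x.
pose I1 := cintegral `[0, x] (fun z => sinhk alpha w (x - z) * G1 z w).
pose I2 := cintegral `[0, x] (fun z => sinhk alpha w (x - z) * G2 z w).
have m1 : mild_rhs alpha gd hd G1 x w = c * fourier gd w + s * fourier hd w - I1 by [].
have m2 : mild_rhs alpha g h G2 x w = c * fourier g w + s * fourier h w - I2 by [].
have e1' : fourier (ued x) w = mild_rhs alpha gd hd G1 x w.
  by rewrite e1 wI; exact: mul1r.
have -> : fourier (ued x) w - fourier (u x) w =
    c * fourier (gd \- g) w + s * fourier (hd \- h) w - (I1 - I2).
  rewrite e1' e2 m1 m2 bg bh.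
  exact: (affine_diff R[i] c s (fourier gd w) (fourier g w) (fourier hd w) (fourier h w) I1 I2).
(* Theta = 2 favours the Duhamel term, whose factor 3/2 must stay below 2 for the Gronwall step to
   contract. *)
apply: (@le_trans _ _ ((1 + 2) * (Normc.normc (c * fourier (gd \- g) w +
   s * fourier (hd \- h) w)) ^+ 2 + (1 + 2^-1) * (Normc.normc (I1 - I2)) ^+ 2)%:E).
  by rewrite lee_fin; exact: normc_sqrB_le.
rewrite EFinD; apply: leeD.
  rewrite lee_fin.
  apply: (@le_trans _ _ ((1 + 2) * (2 * (Normc.normc (c * fourier (gd \- g) w)) ^+ 2 +
     2 * (Normc.normc (s * fourier (hd \- h) w)) ^+ 2))).
    by rewrite ler_wpM2l//; exact: normc_sqrD_le.
  have kx : expR (2 * (x * Re (kroot alpha w))) <= expR (2 * (kap * x)).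
    by rewrite ler_expR ler_wpM2l// mulrC ler_wpM2r.
  have cb := le_trans (normc_ccosh_kroot_le alpha w x a01 x0) kx.
  have sb := le_trans (normc_sinhk_le alpha w x a01 x01') kx.
  exact: (weighted_sum_le (normc_sqrM c (fourier (gd \- g) w))
    (normc_sqrM s (fourier (hd \- h) w)) cb sb (sqr_ge0 _) (sqr_ge0 _)).
have -> : 1 + 2^-1 = 3 / 2 :> R by field.
by rewrite EFinM lee_wpmul2l// lee_fin.
Qed.

Let high_frequency x : 0 <= x < 1 ->
  {ae mu, forall w, eps^-1 < `|w| -> fourier (ued x) w = 0}.
Proof.
move=> /andP[x0 x1]; have x01 : 0 <= x <= 1 by rewrite x0 ltW.
apply: ae_imply (sol1 x x01) => w -> we.
have -> : \1_(`[- eps^-1, eps^-1] : set R) w = 0 :> R.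
  by rewrite indicE mem_setE in_itv/= -ler_norml leNgt we.
by rewrite mul0r.
Qed.

Let uL x : 0 <= x < 1 -> in_L2 (u x).
Proof. by move=> /andP[x0 x1]; have [_ H _] := uC; apply: H; rewrite x0 ltW. Qed.

Let uedL x : 0 <= x < 1 -> in_L2 (ued x).
Proof. by move=> /andP[x0 x1]; have [_ H _] := uedC; apply: H; rewrite x0 ltW. Qed.

Let W x := fourier (ued x \- u x).

Let W_E x : 0 <= x < 1 -> {ae mu, forall w, W x w = fourier (ued x) w - fourier (u x) w}.
Proof. by move=> x01; apply: fourierB; [exact: uedL|exact: uL]. Qed.

Let phiE x : 0 <= x < 1 -> cL2sqr (W x) = (phi x)%:E.
Proof. by move=> x01; apply: plancherel; apply: in_L2B; [exact: uedL|exact: uL]. Qed.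

Let mE x : measurable_fun setT (E x).
Proof.
apply: measurableT_comp => //; apply: measurable_funM => //; apply: measurable_funM => //.
exact: measurable_funB.
Qed.

Let energy x : 0 <= x < 1 -> measurable_fun setT (D x) /\
  (\int[mu]_w D x w = \int[mu]_(z in `]0%R, x[) ((E x z)%:E * N z))%E.
Proof.
move=> x01; exact: (duhamel_energy F1 F2 G1 G2 (E x) x FL1 FL2 FG1 FG2 x01 (mE x)
  (fun z => expR_ge0 _)).
Qed.

Let T x w := expR (2 * (1 + gamma - x) * Re (kroot alpha w)) *
  (Normc.normc (fourier (u x) w)) ^+ 2.

Let T_ge0 x w : 0 <= T x w.
Proof. by rewrite mulr_ge0 ?expR_ge0 ?sqr_ge0. Qed.

Let mT x : 0 <= x < 1 -> measurable_fun setT (T x).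
Proof.
move=> x01; apply: measurable_funM; last first.
  by apply: measurable_normc_sqr; apply: cmeasurable_fourier; exact: uL.
apply: measurableT_comp => //; apply: measurable_funM => //.
under eq_fun do rewrite Re_kroot; apply: measurable_funM => //.
apply: (measurableT_comp (f := fun y : R => y `^ (alpha / 2))) => //.
Qed.

(** Beyond the cutoff Re k(w) is at least [kap], so the a priori weight inside [T] is at least the
    inverse of the exponential in front. *)
Let tail_le x w : 0 <= x < 1 -> eps^-1 < `|w| ->
  (Normc.normc (fourier (u x) w)) ^+ 2 <= expR (- (2 * (1 + gamma - x) * kap)) * T x w.
Proof.
move=> /andP[x0 x1] we; rewrite /T mulrA -expRD ler_peMl ?sqr_ge0//.
rewrite -[leLHS]expR0 ler_expR addrC subr_ge0 ler_wpM2l//.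
  rewrite mulr_ge0//. by have := gamma0; have := x1; lra.
by apply: Re_kroot_ge => //; exact: ltW.
Qed.

Let energy_estimate x : 0 <= x < 1 ->
  ((phi x)%:E <= (expR (- (2 * (1 + gamma - x) * kap)) * M3 ^+ 2 +
     6 * expR (2 * (kap * x)) * delta ^+ 2)%:E +
   (3 / 2)%:E * \int[mu]_(z in `]0%R, x[) ((E x z)%:E * N z))%E.
Proof.
move=> x01; have [mD ID] := energy x x01.
have L1 := in_L2B _ _ gdL gL; have L2 := in_L2B _ _ hdL hL.
have Mg := cmeasurable_fourier _ L1; have Mh := cmeasurable_fourier _ L2.
have MW : cmeasurable (W x).
  by apply: cmeasurable_fourier; apply: in_L2B; [exact: uedL|exact: uL].
pose a := expR (- (2 * (1 + gamma - x) * kap)).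
pose b := 6 * expR (2 * (kap * x)).
have a0 : 0 <= a by exact: expR_ge0.
have b0 : 0 <= b by rewrite mulr_ge0// expR_ge0.
pose q w := (Normc.normc (fourier (gd \- g) w)) ^+ 2 + (Normc.normc (fourier (hd \- h) w)) ^+ 2.
have q0 w : 0 <= q w by rewrite addr_ge0 ?sqr_ge0.
have mg := measurable_normc_sqr _ Mg; have mh := measurable_normc_sqr _ Mh.
have mq : measurable_fun setT q := measurable_funD mg mh.
have D0 w : (0 <= D x w)%E.
  by apply: integral_ge0 => z _; rewrite lee_fin mulr_ge0 ?expR_ge0 ?sqr_ge0.
(* One bound serves all frequencies: each range uses its own terms and the others are nonnegative,
   so the integral need not be split at the cutoff. *)
have pw : {ae mu, forall w, setT w -> (((Normc.normc (W x w)) ^+ 2)%:E <=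
    (a * T x w)%:E + ((b * q w)%:E + (3 / 2)%:E * D x w))%E}.
  have lh := ae_imply2 _ _ _ (fun w p r => conj p r) (low_frequency x x01) (high_frequency x x01).
  apply: ae_imply2 lh (W_E x x01) => w [lo hi] -> _.
  have aT0 : (0 <= (a * T x w)%:E)%E by rewrite lee_fin mulr_ge0.
  have bq0 : (0 <= (b * q w)%:E)%E by rewrite lee_fin mulr_ge0.
  have cD0 : (0 <= (3 / 2)%:E * D x w)%E by rewrite mule_ge0// lee_fin.
  have [we|we] := leP `|w| eps^-1.
    exact: (le_trans (lo we) (leeDr _ aT0)).
  rewrite (hi we); apply: (@le_trans _ _ (a * T x w)%:E).
    rewrite lee_fin; have -> : (Normc.normc (0 - fourier (u x) w)) ^+ 2 =
        (Normc.normc (fourier (u x) w)) ^+ 2.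
      by rewrite !normc_sqr; case: (fourier (u x) w) => r i /=; rewrite !sub0r !sqrrN.
    exact: tail_le.
  exact: (leeDl _ (adde_ge0 bq0 cD0)).
have mT' : measurable_fun setT (fun w => (a * T x w)%:E).
  by apply/measurable_EFinP; apply: measurable_funM; [exact: measurable_cst|exact: mT].
have mq' : measurable_fun setT (fun w => (b * q w)%:E).
  by apply/measurable_EFinP; apply: measurable_funM; [exact: measurable_cst|exact: mq].
have mD' : measurable_fun setT (fun w => (3 / 2)%:E * D x w)%E.
  exact: measurable_funeM.
have aT0 w : setT w -> (0 <= (a * T x w)%:E)%E by move=> _; rewrite lee_fin mulr_ge0.
have bq0 w : setT w -> (0 <= (b * q w)%:E)%E by move=> _; rewrite lee_fin mulr_ge0.
have cD0 w : setT w -> (0 <= (3 / 2)%:E * D x w)%E by move=> _; rewrite mule_ge0// lee_fin.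
have mqD : measurable_fun setT (fun w => (b * q w)%:E + (3 / 2)%:E * D x w)%E.
  exact: emeasurable_funD.
have qD0 w : setT w -> (0 <= (b * q w)%:E + (3 / 2)%:E * D x w)%E.
  by move=> tw; apply: adde_ge0; [exact: bq0|exact: cD0].
rewrite -(phiE x x01).
have mW2 : measurable_fun setT (fun w => ((Normc.normc (W x w)) ^+ 2)%:E).
  by apply/measurable_EFinP; exact: measurable_normc_sqr.
have W0 w : setT w -> (0 <= ((Normc.normc (W x w)) ^+ 2)%:E)%E.
  by move=> _; rewrite lee_fin sqr_ge0.
have step : (cL2sqr (W x) <=
    \int[mu]_w ((a * T x w)%:E + ((b * q w)%:E + (3 / 2)%:E * D x w)))%E.
  apply: ae_ge0_le_integral; [exact: measurableT|exact: W0|exact: mW2| | |exact: pw].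
    by move=> w tw; exact: (adde_ge0 (aT0 w tw) (qD0 w tw)).
  exact: (emeasurable_funD mT' mqD).
apply: (le_trans step).
rewrite (ge0_integralD mu measurableT aT0 mT' qD0 mqD).
rewrite (ge0_integralD mu measurableT bq0 mq' cD0 mD').
have I1 : (\int[mu]_w (a * T x w)%:E <= (a * M3 ^+ 2)%:E)%E.
  under eq_integral do rewrite EFinM.
  rewrite (ge0_integralZl mu measurableT); last 3 first.
  - by apply/measurable_EFinP; exact: mT.
  - by move=> w _; rewrite lee_fin.
  - by rewrite lee_fin.
  rewrite EFinM; have aE : (0 <= a%:E)%E by rewrite lee_fin.
  exact: (lee_wpmul2l aE (ltW (apriori x x01))).
have I2 : (\int[mu]_w (b * q w)%:E <= (b * delta ^+ 2)%:E)%E.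
  under eq_integral do rewrite EFinM.
  rewrite (ge0_integralZl mu measurableT); last 3 first.
  - by apply/measurable_EFinP; exact: mq.
  - by move=> w _; rewrite lee_fin.
  - by rewrite lee_fin.
  rewrite EFinM; have bE : (0 <= b%:E)%E by rewrite lee_fin.
  suff qd : (\int[mu]_w (q w)%:E <= (delta ^+ 2)%:E)%E by exact: (lee_wpmul2l bE qd).
  rewrite /q; under eq_integral do rewrite EFinD.
  rewrite (ge0_integralD mu measurableT); last 4 first.
  - by move=> w _; rewrite lee_fin sqr_ge0.
  - by apply/measurable_EFinP; exact: mg.
  - by move=> w _; rewrite lee_fin sqr_ge0.
  - by apply/measurable_EFinP; exact: mh.
  suff qd2 : (cL2sqr (fourier (gd \- g)%R) + cL2sqr (fourier (hd \- h)%R) <=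
    (delta ^+ 2)%:E)%E by exact: qd2.
  exact: (le_sum_EFin (plancherel _ L1) (plancherel _ L2) (data_error_sqr _ _ _ L1 L2 data)).
rewrite addeA EFinD; apply: leeD; first exact: leeD.
rewrite (ge0_integralZl mu measurableT mD); last 2 first.
- by move=> w _.
- by rewrite lee_fin.
by rewrite ID.
Qed.

Let phi_ge0 x : 0 <= phi x.
Proof. by apply: Rintegral_ge0 => t _; exact: sqr_ge0. Qed.

Let N_ge0 z : (0 <= N z)%E.
Proof. exact: cL2sqr_ge0. Qed.

Let mN : measurable_fun setT N.
Proof. exact: measurable_cL2sqr_sndB FG1 FG2. Qed.

(** Plancherel turns the squared norm of the transforms into that of the sources, where the
    Lipschitz condition acts pointwise in [t]. *)
Let N_le : {ae mu, forall z, 0 < z < 1 -> (N z <= (K ^+ 2 * phi z)%:E)%E}.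
Proof.
apply: ae_imply (fourier_snd_plancherelB _ _ _ _ FL1 FL2 FG1 FG2) => z H z01.
have [L1 L2 NE] := H z01; rewrite /N NE {NE H}.
have [z0 z1] := andP z01.
have z01' : 0 <= z < 1 by rewrite (ltW z0).
have [_ iF] := (in_L2P _).1 (in_L2B _ _ L1 L2).
have [_ iu] := (in_L2P _).1 (in_L2B _ _ (uedL z z01') (uL z z01')).
have -> : (\int[mu]_t ((F1 z t - F2 z t) ^+ 2)%:E)%E =
    (\int[mu]_t ((F1 z t - F2 z t) ^+ 2))%:E.
  by rewrite /Rintegral fineK//; exact: (integrable_fin_num measurableT iF).
rewrite lee_fin /phi -RintegralZl//.
apply: le_Rintegral => //; first exact: integrable_mulrl.
move=> t _; rewrite -exprMn -(real_normK (num_real (F1 z t - F2 z t))).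
rewrite -(real_normK (num_real (K * _))) lerXn2r ?nnegrE//.
rewrite normrM (gtr0_norm K0); apply: lip.
by rewrite ltW//= ltW.
Qed.

Let A := expR (- (2 * (1 + gamma) * kap)) * M3 ^+ 2 + 6 * delta ^+ 2.

Let A_ge0 : 0 <= A.
Proof. by rewrite /A; apply: addr_ge0; apply: mulr_ge0; rewrite ?expR_ge0 ?sqr_ge0. Qed.

Let data_term x : 0 <= x < 1 ->
  expR (- (2 * (1 + gamma - x) * kap)) * M3 ^+ 2 + 6 * expR (2 * (kap * x)) * delta ^+ 2 =
  expR (2 * (kap * x)) * A.
Proof.
move=> _.
have -> : expR (- (2 * (1 + gamma - x) * kap)) =
    expR (2 * (kap * x)) * expR (- (2 * (1 + gamma) * kap)).
  by rewrite -expRD; congr expR; ring.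
by rewrite /A; ring.
Qed.

(** The energy estimate is used here without the Lipschitz bound: [N] is integrable over the line
    and [E x z] is at most exp(2 kap). This makes the supremum in [error_L2] finite. *)
Let phi_bounded : exists B, forall x, 0 <= x < 1 -> phi x <= B.
Proof.
have fin := integral_cL2sqr_sndB_lty _ _ _ _ FL1 FL2 FG1 FG2.
rewrite -/N in fin.
have finN : (\int[mu]_z N z)%E \is a fin_num.
  by rewrite ge0_fin_numE//; apply: integral_ge0 => z _; exact: N_ge0.
exists (expR (2 * kap) * A + 3 / 2 * (expR (2 * kap) * fine (\int[mu]_z N z)%E)) => x x01.
have [x0 x1] := andP x01.
have ek : expR (2 * (kap * x)) <= expR (2 * kap).
  by rewrite ler_expR ler_wpM2l// ler_piMr// ltW.
have A0 := A_ge0.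
rewrite -lee_fin; apply: (le_trans (energy_estimate x x01)).
rewrite (data_term x x01) EFinD; apply: leeD.
  by rewrite lee_fin ler_wpM2r.
have c0 : (0 <= (3 / 2 : R)%:E)%E by rewrite lee_fin.
suff I : (\int[mu]_(z in `]0%R, x[) ((E x z)%:E * N z) <=
    (expR (2 * kap) * fine (\int[mu]_z N z)%E)%:E)%E.
  by rewrite EFinM; exact: (lee_wpmul2l c0 I).
have e0 : (0 <= (expR (2 * kap))%:E)%E by rewrite lee_fin expR_ge0.
rewrite EFinM fineK// -(ge0_integralZl mu measurableT mN (fun z _ => N_ge0 z) e0).
rewrite [leLHS]integral_mkcond; apply: ge0_le_integral.
- exact: measurableT.
- move=> z _; rewrite patchE; case: ifPn => // _.
  by rewrite mule_ge0// lee_fin expR_ge0.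
- apply/(measurable_restrictT _ _).1; first exact: measurable_itv.
  apply: measurable_funTS; apply: emeasurable_funM; last exact: mN.
  by apply/measurable_EFinP; exact: mE.
- exact: measurable_funeM.
- move=> z _; rewrite patchE mem_setE; case: ifPn => [|_]; last by rewrite mule_ge0.
  rewrite in_itv/= => /andP[z0 zx].
  rewrite lee_wpmul2r// lee_fin /E ler_expR ler_wpM2l// ler_piMr//.
  by rewrite lerBlDr; rewrite (le_trans (ltW x1))// lerDl ltW.
Qed.

(** Since [E x z] times exp(2 kap z) is exp(2 kap x), only exp(2 K^2 z) is left to integrate; this
    gives K^2 m / (2 K^2) = m/2, and 3/2 of it is (3/4) m. *)
Let gronwall_step m : (forall x, 0 <= x < 1 -> phi x <= m * expR (2 * (kap * x) + 2 * K ^+ 2 * x)) ->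
  0 <= m -> forall x, 0 <= x < 1 ->
  phi x <= (A + 3 / 4 * m) * expR (2 * (kap * x) + 2 * K ^+ 2 * x).
Proof.
move=> phim m0 x x01; have [x0 x1] := andP x01.
have K2 : 0 < 2 * K ^+ 2 by rewrite mulr_gt0// exprn_gt0.
pose c := K ^+ 2 * m * expR (2 * (kap * x)).
have c0 : 0 <= c by rewrite /c; apply: mulr_ge0; [apply: mulr_ge0; rewrite ?sqr_ge0|exact: expR_ge0].
have I : (\int[mu]_(z in `]0%R, x[) ((E x z)%:E * N z) <=
    (m / 2 * expR (2 * (kap * x) + 2 * K ^+ 2 * x))%:E)%E.
  apply: (@le_trans _ _ (\int[mu]_(z in `]0%R, x[) (c%:E * (expR (2 * K ^+ 2 * z))%:E))%E).
    apply: ae_ge0_le_integral.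
    - exact: measurable_itv.
    - by move=> z _; rewrite mule_ge0// lee_fin expR_ge0.
    - apply: measurable_funTS; apply: emeasurable_funM; last exact: mN.
      by apply/measurable_EFinP; exact: mE.
    - by move=> z _; rewrite mule_ge0// lee_fin expR_ge0.
    - apply: measurable_funTS; apply: measurable_funeM; apply/measurable_EFinP.
      by apply: measurableT_comp => //; exact: measurable_funM.
    - apply: ae_imply N_le => z Nz; rewrite /= in_itv/= => /andP[z0 zx].
      have z01 : 0 < z < 1 by rewrite z0 (lt_trans zx x1).
      have z01' : 0 <= z < 1 by have [-> ->] := (ltW z0, lt_trans zx x1).
      have E0 : (0 <= (E x z)%:E)%E by rewrite lee_fin expR_ge0.
      apply: (le_trans (lee_wpmul2l E0 (Nz z01))).
      rewrite -!EFinM lee_fin.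
      have h1 := ler_wpM2l (sqr_ge0 K) (phim z z01').
      apply: (le_trans (ler_wpM2l (expR_ge0 _) h1)).
      rewrite le_eqVlt; apply/orP; left; apply/eqP.
      transitivity (K ^+ 2 * m * (expR (2 * (kap * (x - z))) *
        expR (2 * (kap * z) + 2 * K ^+ 2 * z))); first by rewrite /E; ring.
      by rewrite /c -[RHS]mulrA -!expRD; congr (_ * expR _); ring.
  rewrite ge0_integralZl; last 4 first.
  - exact: measurable_itv.
  - apply: measurable_funTS; apply/measurable_EFinP.
    by apply: measurableT_comp => //; exact: measurable_funM.
  - by move=> z _; rewrite lee_fin expR_ge0.
  - by rewrite lee_fin.
  have cE : (0 <= c%:E)%E by rewrite lee_fin.
  apply: (le_trans (lee_wpmul2l cE (integral_expR_le _ _ K2 x0))).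
  rewrite -EFinM lee_fin /c expRD le_eqVlt; apply/orP; left; apply/eqP.
  by field; rewrite gt_eqF.
rewrite -lee_fin; apply: (le_trans (energy_estimate x x01)).
rewrite (data_term x x01).
have c32 : (0 <= (3 / 2 : R)%:E)%E by rewrite lee_fin.
apply: (le_trans (leeD2l _ (lee_wpmul2l c32 I))).
rewrite -EFinM -EFinD lee_fin [leRHS]mulrDl; apply: lerD.
  rewrite mulrC ler_wpM2l ?A_ge0//.
  by rewrite ler_expR lerDl mulr_ge0// ltW.
by rewrite le_eqVlt; apply/orP; left; apply/eqP; field.
Qed.

Let error_L2 x : 0 <= x < 1 ->
  phi x <= 4 * A * expR (2 * (kap * x) + 2 * K ^+ 2 * x).
Proof.
have [B phiB] := phi_bounded.
pose e x := expR (2 * (kap * x) + 2 * K ^+ 2 * x).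
have e1 x' : 0 <= x' -> 1 <= e x'.
  move=> x0; rewrite /e -[leLHS]expR0 ler_expR; apply: addr_ge0; apply: mulr_ge0 => //.
    exact: mulr_ge0.
  by apply: mulr_ge0 => //; exact: sqr_ge0.
have e0 x' : 0 < e x' by exact: expR_gt0.
pose S := [set y : R | exists2 x, 0 <= x < 1 & y = phi x / e x].
have S0 : S (phi 0 / e 0) by exists 0; rewrite ?lexx ?ltr01.
have Sub : has_sup S.
  split; first by exists (phi 0 / e 0).
  exists B => _ [y y01 ->]; have [y0 _] := andP y01.
  rewrite ler_pdivrMr// (le_trans (phiB y y01))//.
  by rewrite ler_peMr ?e1// (le_trans (phi_ge0 y))// phiB.
pose m := sup S.
have m0 : 0 <= m.
  by apply: (le_trans _ (ub_le_sup Sub.2 S0)); rewrite divr_ge0 ?phi_ge0// ltW.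
have phim y : 0 <= y < 1 -> phi y <= m * e y.
  move=> y01; rewrite -ler_pdivrMr//; apply: (ub_le_sup Sub.2).
  by exists y.
have step := gronwall_step m phim m0.
(* The step improves every upper bound, in particular the least one; as [m] is finite, this gives
   m/4 <= A. *)
have mle : m <= A + 3 / 4 * m.
  apply: ge_sup; first by exists (phi 0 / e 0).
  by move=> _ [y y01 ->]; rewrite ler_pdivrMr//; exact: step.
have mA : m <= 4 * A by lra.
move=> x01; apply: (le_trans (phim x x01)).
by rewrite ler_wpM2r// ltW// e0.
Qed.

Context (p : R) (p0 : 0 < p)
  (eps_small : 2 * p <= alpha * gamma * (eps `^ (- (alpha / 2)) * cos (alpha * pi / 4))).

Let B := (1 + eps ^- 2) `^ p.

Let B_ge1 : 1 <= B.
Proof.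
rewrite /B -[leLHS](@powRr0 R (1 + eps ^- 2)) ler_powR ?(ltW p0)//.
by rewrite lerDl invr_ge0 sqr_ge0.
Qed.

Let sobolev_pointwise x : 0 <= x < 1 ->
  {ae mu, forall w, setT w ->
    (((1 + w ^+ 2) `^ p * (Normc.normc (W x w)) ^+ 2)%:E <=
     (B * (Normc.normc (W x w)) ^+ 2)%:E +
     (B * expR (- (2 * (1 + gamma - x) * kap)) * T x w)%:E)%E}.
Proof.
move=> x01; have [x0 x1] := andP x01.
have B0 : 0 <= B by rewrite powR_ge0.
apply: ae_imply2 (high_frequency x x01) (W_E x x01) => w hi WE _.
have w0 : 0 <= 1 + w ^+ 2 by rewrite addr_ge0 ?sqr_ge0.
have e0 : 0 <= 1 + eps ^- 2 by rewrite addr_ge0 ?invr_ge0 ?sqr_ge0.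
have BaT0 : 0 <= B * expR (- (2 * (1 + gamma - x) * kap)) * T x w.
  by rewrite mulr_ge0 ?T_ge0// mulr_ge0 ?expR_ge0.
rewrite -EFinD lee_fin.
have [we|we] := leP `|w| eps^-1.
  apply: (@le_trans _ _ (B * (Normc.normc (W x w)) ^+ 2)); last by rewrite lerDl.
  rewrite ler_wpM2r ?sqr_ge0// /B; apply: ge0_ler_powR.
  - exact: ltW.
  - by rewrite nnegrE.
  - by rewrite nnegrE.
  - by rewrite lerD2l -exprVn; exact: ler_norm_sqr.
have -> : (Normc.normc (W x w)) ^+ 2 = (Normc.normc (fourier (u x) w)) ^+ 2.
  rewrite WE (hi we) !normc_sqr; case: (fourier (u x) w) => r i /=.
  by rewrite !sub0r !sqrrN.
apply: (@le_trans _ _ (B * expR (- (2 * (1 + gamma - x) * kap)) * T x w)); last first.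
  by rewrite lerDr mulr_ge0 ?sqr_ge0.
rewrite /T mulrA ler_wpM2r ?sqr_ge0//.
have g0 : 0 <= 1 + gamma - x by have := gamma0; have := x1; lra.
have [al0 _] := andP a01.
have c0 := ltW (cos_alpha_gt0 _ a01).
(* Smallness is assumed for [gamma]; the rate 1 + gamma - x available here is larger because
   [x < 1]. *)
have hp : 2 * p <= alpha * (1 + gamma - x) * kap.
  apply: (le_trans eps_small); rewrite ler_wpM2r//.
  by rewrite ler_wpM2l ?(ltW al0)//; have := x1; lra.
have := sobolev_weight_le alpha eps p _ _ w al0 eps0 p0 hp c0 g0 (ltW we).
rewrite -/kap -/B -Re_kroot => hw.
have E1 : expR (2 * (1 + gamma - x) * kap) * expR (- (2 * (1 + gamma - x) * kap)) = 1.
  by rewrite -expRD subrr expR0.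
have := ler_wpM2r (expR_ge0 (- (2 * (1 + gamma - x) * kap))) hw.
by rewrite -[leLHS]mulrA E1 mulr1 mulrAC.
Qed.

Let sobolev_integral x : 0 <= x < 1 ->
  (\int[mu]_w ((1 + w ^+ 2) `^ p * (Normc.normc (W x w)) ^+ 2)%:E <=
   (B * (phi x + expR (- (2 * (1 + gamma - x) * kap)) * M3 ^+ 2))%:E)%E.
Proof.
move=> x01.
have B0 : 0 <= B by rewrite powR_ge0.
pose a := B * expR (- (2 * (1 + gamma - x) * kap)).
have a0 : 0 <= a by rewrite mulr_ge0 ?expR_ge0.
have MW : cmeasurable (W x).
  by apply: cmeasurable_fourier; apply: in_L2B; [exact: uedL|exact: uL].
have mW2 := measurable_normc_sqr _ MW.
have mBW : measurable_fun setT (fun w => (B * (Normc.normc (W x w)) ^+ 2)%:E).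
  by apply/measurable_EFinP; exact: (measurable_funM (measurable_cst B) mW2).
have maT : measurable_fun setT (fun w => (a * T x w)%:E).
  by apply/measurable_EFinP; exact: (measurable_funM (measurable_cst a) (mT x x01)).
have BW0 w : setT w -> (0 <= (B * (Normc.normc (W x w)) ^+ 2)%:E)%E.
  by move=> _; rewrite lee_fin mulr_ge0 ?sqr_ge0.
have aT0 w : setT w -> (0 <= (a * T x w)%:E)%E.
  by move=> _; rewrite lee_fin mulr_ge0.
have mwt : measurable_fun setT (fun w : R => (1 + w ^+ 2) `^ p).
  apply: (measurableT_comp (f := fun y : R => y `^ p)); first exact: measurable_powR.
  by apply: measurable_funD => //; exact: measurable_funX.
have step : (\int[mu]_w ((1 + w ^+ 2) `^ p * (Normc.normc (W x w)) ^+ 2)%:E <=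
    \int[mu]_w ((B * (Normc.normc (W x w)) ^+ 2)%:E + (a * T x w)%:E))%E.
  apply: ae_ge0_le_integral.
  - exact: measurableT.
  - by move=> w _; rewrite lee_fin mulr_ge0 ?powR_ge0 ?sqr_ge0.
  - by apply/measurable_EFinP; exact: (measurable_funM mwt mW2).
  - by move=> w tw; exact: (adde_ge0 (BW0 w tw) (aT0 w tw)).
  - exact: (emeasurable_funD mBW maT).
  - exact: sobolev_pointwise.
apply: (le_trans step).
rewrite (ge0_integralD mu measurableT BW0 mBW aT0 maT) mulrDr EFinD.
have I1 : (\int[mu]_w (B * (Normc.normc (W x w)) ^+ 2)%:E <= (B * phi x)%:E)%E.
  under eq_integral do rewrite EFinM.
  rewrite (ge0_integralZl mu measurableT); last 3 first.
  - by apply/measurable_EFinP; exact: mW2.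
  - by move=> w _; rewrite lee_fin sqr_ge0.
  - by rewrite lee_fin.
  have BE : (0 <= B%:E)%E by rewrite lee_fin.
  have h1 : (cL2sqr (W x) <= (phi x)%:E)%E by rewrite (phiE x x01).
  by rewrite EFinM; exact: (lee_wpmul2l BE h1).
have I2 : (\int[mu]_w (a * T x w)%:E <=
    (B * (expR (- (2 * (1 + gamma - x) * kap)) * M3 ^+ 2))%:E)%E.
  under eq_integral do rewrite EFinM.
  rewrite (ge0_integralZl mu measurableT); last 3 first.
  - by apply/measurable_EFinP; exact: mT.
  - by move=> w _; rewrite lee_fin.
  - by rewrite lee_fin.
  have aE : (0 <= a%:E)%E by rewrite lee_fin.
  by rewrite mulrA EFinM; exact: (lee_wpmul2l aE (ltW (apriori x x01))).
exact: (leeD I1 I2).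
Qed.

Lemma regularization_error :
  let C3 := Num.max (5 * expR (K ^+ 2)) (3 * M3 * (expR (K ^+ 2) + 1)) in
  forall x : R, 0 <= x < 1 ->
  (Hnorm p (ued x \- u x)%R <=
      (C3 * (1 + eps ^- 2) `^ p *
         expR (x * eps `^ (- (alpha / 2)) * cos (alpha * pi / 4)) * delta
       + C3 * (1 + eps ^- 2) `^ p *
         expR ((x - gamma - 1) * eps `^ (- (alpha / 2))
               * cos (alpha * pi / 4)))%:E)%E.
Proof.
move=> C3 x x01; have [x0 x1] := andP x01.
rewrite -/B; set X := expR (x * _ * _); set Y := expR ((x - _ - _) * _ * _).
pose S := expR (K ^+ 2).
have S0 : 0 <= S by exact: expR_ge0.
have X0 : 0 <= X by exact: expR_ge0.
have Y0 : 0 <= Y by exact: expR_ge0.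
have C5 : 5 * S <= C3 by rewrite le_max lexx.
have C3M : 3 * M3 * (S + 1) <= C3 by rewrite le_max lexx orbT.
(* The Gronwall exponent 2 K^2 x is bounded by 2 K^2, which makes the constant C3 independent of
   [x]. *)
have X2 : expR (2 * (kap * x) + 2 * K ^+ 2 * x) <= X ^+ 2 * S ^+ 2.
  rewrite -!expRM_natl -expRD ler_expR /kap; apply: lerD.
    by rewrite le_eqVlt; apply/orP; left; apply/eqP; ring.
  by rewrite ler_piMr ?(ltW x1)// mulr_ge0 ?sqr_ge0.
have Y2 : expR (- (2 * (1 + gamma - x) * kap)) = Y ^+ 2.
  by rewrite -expRM_natl; congr expR; rewrite /kap; ring.
(* The a priori part of [A], amplified by [X ^+ 2], decays exactly like the truncation error
   [Y ^+ 2], so both fall under the second term of the estimate. *)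
have XY : X ^+ 2 * expR (- (2 * (1 + gamma) * kap)) = Y ^+ 2.
  by rewrite -!expRM_natl -expRD; congr expR; rewrite /kap; ring.
have phix : phi x <= 24 * (S * X * delta) ^+ 2 + 4 * (S * M3 * Y) ^+ 2.
  apply: (le_trans (error_L2 x x01)).
  apply: (le_trans (ler_wpM2l _ X2)); first by rewrite mulr_ge0 ?A_ge0.
  rewrite le_eqVlt; apply/orP; left; apply/eqP.
  transitivity (4 * M3 ^+ 2 * S ^+ 2 * (X ^+ 2 * expR (- (2 * (1 + gamma) * kap))) +
    24 * delta ^+ 2 * (X ^+ 2 * S ^+ 2)); first by rewrite /A; ring.
  by rewrite XY; ring.
have C30 : 0 <= C3 by rewrite (le_trans _ C5)// mulr_ge0.
pose Z := C3 * B * X * delta + C3 * B * Y.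
have B0 : 0 <= B by rewrite powR_ge0.
have d0 := ltW delta0.
have Z0 : 0 <= Z.
  by apply: addr_ge0; rewrite !mulr_ge0.
have J := sobolev_integral x x01.
have JZ : (\int[mu]_w ((1 + w ^+ 2) `^ p * (Normc.normc (W x w)) ^+ 2)%:E <= (Z ^+ 2)%:E)%E.
  apply: (le_trans J); rewrite lee_fin Y2.
  exact: final_arithmetic phix C5 C3M B_ge1 S0 X0 Y0 (ltW M30) d0.
have J0 : (0 <= \int[mu]_w ((1 + w ^+ 2) `^ p * (Normc.normc (W x w)) ^+ 2)%:E)%E.
  by apply: integral_ge0 => w _; rewrite lee_fin mulr_ge0 ?powR_ge0 ?sqr_ge0.
rewrite /Hnorm -/(W x).
move: (\int[mu]_w ((1 + w ^+ 2) `^ p * (Normc.normc (W x w)) ^+ 2)%:E)%E J0 JZ => j j0 jZ.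
have jfin : j \is a fin_num by rewrite ge0_fin_numE// (le_lt_trans jZ)// ltry.
rewrite -(fineK jfin) in jZ *.
rewrite lee_fin in jZ.
have fj0 : 0 <= fine j by rewrite fine_ge0.
rewrite poweR_EFin powR12_sqrt// lee_fin -/Z -[leRHS](ger0_norm Z0) -sqrtr_sqr.
by rewrite ler_sqrt// sqr_ge0.
Qed.

End error_analysis.

Theorem theorem3p3 (R : realType) (alpha : R) (f : R -> R -> R -> R)
    (K p gamma delta M3 eps : R) (g h gd hd : R -> R) (u ued : R -> R -> R) :
  0 < alpha < 1 ->
  in_Linfty f ->
  (forall w, in_CL2 w -> in_L2_strip (fun z t => f z t (w z t))) ->
  0 < K ->
  (forall (x t v1 v2 : R), 0 <= x <= 1 ->
     `|f x t v1 - f x t v2| <= K * `|v1 - v2|) ->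
  0 < p -> 0 < gamma -> 0 < delta ->
  in_L2 g -> in_L2 h -> in_L2 gd -> in_L2 hd ->
  (L2norm (gd \- g)%R + L2norm (hd \- h)%R <= delta%:E)%E ->
  is_unique_exact_solution alpha f g h u ->
  0 < M3 ->
  (forall x : R, 0 <= x < 1 ->
     (\int[lebesgue_measure]_w
        (expR (2 * (1 + gamma - x) * complex.Re (kroot alpha w)) *
         (Normc.normc (fourier (u x) w)) ^+ 2)%:E < (M3 ^+ 2)%:E)%E) ->
  0 < eps ->
  eps < (alpha * gamma * cos (alpha * pi / 4) / (2 * p)) `^ (2 / alpha) ->
  is_regularized_solution alpha f eps gd hd ued ->
  let C3 := Num.max (5 * expR (K ^+ 2)) (3 * M3 * (expR (K ^+ 2) + 1)) in
  forall x : R, 0 <= x < 1 ->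
    (Hnorm p (ued x \- u x)%R <=
      (C3 * (1 + eps ^- 2) `^ p *
         expR (x * eps `^ (- (alpha / 2)) * cos (alpha * pi / 4)) * delta
       + C3 * (1 + eps ^- 2) `^ p *
         expR ((x - gamma - 1) * eps `^ (- (alpha / 2))
               * cos (alpha * pi / 4)))%:E)%E.
Proof.
move=> a01 _ strip K0 lip p0 gamma0 delta0 gL hL gdL hdL data [[uC [G2 FG2 sol2]] _].
move=> M30 apriori eps0 epslt [uedC [G1 FG1 sol1]].
have [a0 _] := andP a01.
have eps_small := eps_smallness _ _ _ _ _ a0 p0 gamma0 (cos_alpha_gt0 _ a01) eps0 epslt.
exact: (regularization_error alpha f K gamma delta M3 eps g h gd hd u ued G1 G2).
Qed.
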